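(* Let $E\subset\mathbb H$ be a monotone set in the Heisenberg group. Then, modulo a set of Haar measure zero, either $E=\emptyset$, or $E=\mathbb H$, or $E$ is a half-space.
   Context: $\mathbb H$ is the Heisenberg group of matrices $\begin{bmatrix}1&a&c\\0&1&b\\0&0&1\end{bmatrix}$ with $a,b,c\in\mathbb R$; its Lie algebra has basis $X,Y,Z$ (elementary matrices in positions $(1,2)$, $(2,3)$, $(1,3)$), with $[X,Y]=Z$, $Z$ central. $\Delta=\mathrm{span}\{X,Y\}$. $\pi:\mathbb H\to\mathbb R^2$ sends the matrix above to $(a,b)$. A line in $\mathbb H$ is a set $\{g\exp(tv): t\in\mathbb R\}$ with $g\in\mathbb H$, $v\in\Delta\setminus\{0\}$. $\mathbb L(\mathbb H)$ is the set of lines with its natural smooth manifold structure, equipped with a smooth measure of positive density (''almost every line'' refers to this measure class). Each line is identified with $\mathbb R$ by an affine parametrization $t\mapsto g\exp(tv)$. A measurable subset of $\mathbb R$ is monotone if, up to a null set, it equals a measurable set which is connected and has connected complement (i.e. it is, up to null sets, empty, a ray, or $\mathbb R$). A measurable subset $E\subset\mathbb H$ is monotone if $E\cap L$ is a monotone subset of $L\simeq\mathbb R$ for almost every $L\in\mathbb L(\mathbb H)$. A vertical plane is a set $\pi^{-1}(\ell)$ with $\ell\subset\mathbb R^2$ a straight line. The horizontal plane centered at $p\in\mathbb H$ is the union of all lines passing through $p$. A half-space is a connected component of $\mathbb H\setminus P$, where $P$ is a vertical or horizontal plane. *)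

(* Defs.v *)
From HB Require Import structures.
From mathcomp Require Import all_boot all_order all_algebra.
From mathcomp Require Import all_classical all_reals all_analysis.
From mathcomp Require Import measurable_realfun.
From mathcomp Require Import ring lra.
Set Implicit Arguments.
Unset Strict Implicit.
Unset Printing Implicit Defensive.
Import Order.TTheory GRing.Theory Num.Theory.
Import numFieldNormedType.Exports.
Local Open Scope classical_set_scope.
Local Open Scope ring_scope.

Lemma product_sigma_finite d1 d2 (T1 : measurableType d1)
    (T2 : measurableType d2) (R : realType)
    (m1 : {sigma_finite_measure set T1 -> \bar R})
    (m2 : {sigma_finite_measure set T2 -> \bar R}) :
  sigma_finite setT (m1 \x m2)%E.
Proof.
have /sigma_finiteP[F [TF ndF Foo]] := sigma_finiteT m1.
have /sigma_finiteP[G [TG ndG Goo]] := sigma_finiteT m2.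
exists (fun n => F n `*` G n).
  rewrite -setXTT TF TG predeqE => -[x y]; split.
    move=> [/= [n _ Fnx] [k _ Gky]]; exists (maxn n k) => //; split.
    - by move: x Fnx; exact/subsetPset/ndF/leq_maxl.
    - by move: y Gky; exact/subsetPset/ndG/leq_maxr.
  by move=> [n _ []/= ? ?]; split; exists n.
move=> k; have [? ?] := Foo k; have [? ?] := Goo k.
split; first exact: measurableX.
by rewrite product_measure1E// lte_mul_pinfty// ge0_fin_numE.
Qed.

(* [measurableTypeR R] is R with its Borel sigma-algebra; it carries the usual
   topology and arithmetic of R. *)
Definition R3 (R : realType) : Type :=
  (measurableTypeR R * measurableTypeR R * measurableTypeR R)%type.

(* Separate constants for the Lebesgue measures on R^2 and R^3: the instance of
   sigma-finite measure is not inferred for [lebesgue_measure \x lebesgue_measure]. *)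
Definition leb2 (R : realType) :
    set (measurableTypeR R * measurableTypeR R)%type -> \bar R :=
  (@lebesgue_measure R \x @lebesgue_measure R)%E.
HB.instance Definition _ (R : realType) := Measure.on (@leb2 R).
HB.instance Definition _ (R : realType) := Measure_isSigmaFinite.Build _ _ _
  (@leb2 R) (product_sigma_finite (@lebesgue_measure R) (@lebesgue_measure R)).

Definition leb3 (R : realType) : set (R3 R) -> \bar R :=
  (@leb2 R \x @lebesgue_measure R)%E.
HB.instance Definition _ (R : realType) := Measure.on (@leb3 R).
HB.instance Definition _ (R : realType) := Measure_isSigmaFinite.Build _ _ _
  (@leb3 R) (product_sigma_finite (@leb2 R) (@lebesgue_measure R)).

(* The triple (a, b, c) stands for the matrix [heis_mx (a, b, c)] below;
   the topology and the Borel sigma-algebra are those of R^3. *)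
Definition heis (R : realType) : Type := R3 R.

Section heisenberg_group.
Context {R : realType}.
Implicit Types (g h p : heis R) (v : R * R) (t : R).

Definition ha g : R := g.1.1.
Definition hb g : R := g.1.2.
Definition hc g : R := g.2.

Definition heis_mx g : 'M[R]_3 :=
  \matrix_(i, j) nth 0 (nth [::] [:: [:: 1; ha g; hc g];
                                     [:: 0; 1;    hb g];
                                     [:: 0; 0;    1   ]] i) j.

Definition hmul g h : heis R := (ha g + ha h, hb g + hb h, hc g + hc h + ha g * hb h).

(* The element x X + y Y of the span Delta of X and Y is encoded as the pair
   (x, y). *)
Definition delta_lie_mx v : 'M[R]_3 :=
  v.1 *: delta_mx 0 1 + v.2 *: delta_mx 1 ord_max.

(* The exponential of [delta_lie_mx v], see [heis_mx_hexp]. *)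
Definition hexp v : heis R := (v.1, v.2, v.1 * v.2 / 2).

Definition hcurve g v t : heis R := hmul g (hexp (t * v.1, t * v.2)).

Definition hline g v : set (heis R) := range (hcurve g v).

Definition is_line (L : set (heis R)) :=
  exists g v, v <> (0, 0) /\ L = hline g v.

Lemma heis_mx_inj : injective heis_mx.
Proof.
move=> [[a b] c] [[a' b'] c'] /matrixP E.
have := E 0 1; have := E 1 ord_max; have := E 0 ord_max.
by rewrite !mxE /= /ha /hb /hc /= => -> -> ->.
Qed.

Lemma heis_mxM g h : heis_mx (hmul g h) = heis_mx g *m heis_mx h.
Proof.
apply/matrixP => i j; rewrite !mxE !big_ord_recl big_ord0 !mxE.
case: i => -[|[|[|//]]] ?; case: j => -[|[|[|//]]] ? /=;
  rewrite /ha /hb /hc /=; ring.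
Qed.

(* The exponential series stops after the quadratic term. *)
Lemma heis_mx_hexp v :
  let N := delta_lie_mx v in
  N ^+ 3 = 0 /\ heis_mx (hexp v) = 1%:M + N + 2^-1 *: (N ^+ 2).
Proof.
move=> N.
have N2 : N ^+ 2 = (v.1 * v.2) *: delta_mx 0 ord_max.
  apply/matrixP => i j; rewrite expr2 -mulmxE !mxE !big_ord_recl big_ord0 !mxE.
  case: i => -[|[|[|//]]] ?; case: j => -[|[|[|//]]] ?; rewrite /=; ring.
split.
  rewrite exprS N2; apply/matrixP => i j.
  rewrite -mulmxE !mxE !big_ord_recl big_ord0 !mxE.
  case: i => -[|[|[|//]]] ?; case: j => -[|[|[|//]]] ?; rewrite /=; ring.
rewrite N2; apply/matrixP => i j; rewrite !mxE.
case: i => -[|[|[|//]]] ?; case: j => -[|[|[|//]]] ?;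
  by rewrite /= /ha /hb /hc /=; field.
Qed.

Lemma hcurve_affine g v r s t :
  hcurve (hcurve g v r) (s * v.1, s * v.2) t = hcurve g v (s * t + r).
Proof.
rewrite /hcurve /hmul /hexp /ha /hb /hc /=; congr (_, _, _); [ring|ring|].
by field.
Qed.

Lemma hline_affine g v r s : s != 0 ->
  hline (hcurve g v r) (s * v.1, s * v.2) = hline g v.
Proof.
move=> s0; apply/seteqP; split => _ [t _ <-].
  by rewrite hcurve_affine; exists (s * t + r).
exists ((t - r) / s) => //; rewrite hcurve_affine; congr hcurve.
by field.
Qed.

Lemma hline_inj g v g' v' : v' <> (0, 0) -> hline g' v' = hline g v ->
  exists r s, [/\ s != 0, g' = hcurve g v r & v' = (s * v.1, s * v.2)].
Proof.
move=> v'0 E.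
have [r _ Er] : hline g v g'.
  rewrite -E; exists 0 => //; case: (g') => [[a b] c].
  by rewrite /hcurve /hmul /hexp /ha /hb /hc /=; congr (_, _, _); ring.
have [r1 _ Er1] : hline g v (hcurve g' v' 1) by rewrite -E; exists 1.
have Ev : v' = ((r1 - r) * v.1, (r1 - r) * v.2).
  move: Er1; rewrite -Er /hcurve /hmul /hexp /ha /hb /hc /= => -[e1 e2 _].
  rewrite [LHS]surjective_pairing; congr (_, _); lra.
exists r, (r1 - r); split => //.
apply/eqP => e; apply: v'0; rewrite Ev e; congr (_, _); ring.
Qed.

End heisenberg_group.

(* The space of lines is a 3-manifold with an atlas of two charts with values
   in R^3: the lines that are not tangent to Y meet {a = 0} in one point
   (0, b, c) and have a unique direction X + m Y; the lines that are not tangent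
   to X meet {b = 0} in one point (a, 0, c) and have a unique direction
   m X + Y. *)
Section space_of_lines.
Context {R : realType}.

Definition line_of_X (q : R3 R) : set (heis R) :=
  hline (0, q.1.2, q.2) (1, q.1.1).

Definition line_of_Y (q : R3 R) : set (heis R) :=
  hline (q.1.2, 0, q.2) (q.1.1, 1).

Lemma is_lineP L : is_line L <->
  (exists q, L = line_of_X q) \/ (exists q, L = line_of_Y q).
Proof.
split=> [[g [v [v0 ->]]]|[] [q ->]]; last 2 first.
- by exists (0, q.1.2, q.2), (1, q.1.1); split => // -[/eqP]; rewrite oner_eq0.
- by exists (q.1.2, 0, q.2), (q.1.1, 1); split => // -[_ /eqP]; rewrite oner_eq0.
have [v10|v10] := eqVneq v.1 0; [right|left].
- have v20 : v.2 != 0.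
    by apply/eqP => v20; apply: v0; rewrite [v]surjective_pairing v10 v20.
  pose h := hcurve g v (- hb g / v.2).
  exists (v.1 / v.2, ha h, hc h); rewrite -(hline_affine g v (- hb g / v.2) (invr_neq0 v20)).
  rewrite /line_of_Y /=; congr hline; last by congr (_, _); field.
  by rewrite /h /hcurve /hmul /hexp /ha /hb /hc /=; congr (_, _, _); field.
- pose h := hcurve g v (- ha g / v.1).
  exists (v.2 / v.1, hb h, hc h); rewrite -(hline_affine g v (- ha g / v.1) (invr_neq0 v10)).
  rewrite /line_of_X /=; congr hline; last by congr (_, _); field.
  by rewrite /h /hcurve /hmul /hexp /ha /hb /hc /=; congr (_, _, _); field.
Qed.

Lemma line_of_X_inj : injective line_of_X.
Proof.
move=> [[m b] c] [[m' b'] c'] /hline_inj[|r [s [_ + [s1 ->]]]].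
  by move=> [/eqP]; rewrite oner_eq0.
rewrite /hcurve /hmul /hexp /ha /hb /hc /= => -[r0 -> ->].
have -> : r = 0 by lra.
have -> : s = 1 by lra.
by congr (_, _, _); ring.
Qed.

Lemma line_of_Y_inj : injective line_of_Y.
Proof.
move=> [[m a] c] [[m' a'] c'] /hline_inj[|r [s [_ + [-> s1]]]].
  by move=> [_ /eqP]; rewrite oner_eq0.
rewrite /hcurve /hmul /hexp /ha /hb /hc /= => -[-> r0 ->].
have -> : r = 0 by lra.
have -> : s = 1 by lra.
by congr (_, _, _); ring.
Qed.

Lemma line_of_XY (m b c : R) : m != 0 ->
  line_of_X (m, b, c) = line_of_Y (m^-1, - b / m, c + b ^+ 2 / (2 * m)).
Proof.
move=> m0; rewrite /line_of_X -(hline_affine _ _ (- b / m) (invr_neq0 m0)).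
rewrite /line_of_Y /=; congr hline; last by congr (_, _); field.
by rewrite /hcurve /hmul /hexp /ha /hb /hc /=; congr (_, _, _); field.
Qed.

(* A smooth measure of positive density has the null sets of Lebesgue measure
   in every chart. *)
Definition null_lines (N : set (set (heis R))) :=
  (@leb3 R).-negligible (line_of_X @^-1` N) /\
  (@leb3 R).-negligible (line_of_Y @^-1` N).

Definition almost_every_line (P : set (heis R) -> Prop) :=
  null_lines [set L | ~ P L].

End space_of_lines.

Section monotone_sets.
Context {R : realType}.

(* "Measurable" means measurable for the completed measure here; such a set M
   is an interval, and [S] is then measurable as well. *)
Definition monotoneR (S : set (measurableTypeR R)) :=
  exists M : set (measurableTypeR R),
    [/\ measurable M, connected M, connected (~` M) &
        (@lebesgue_measure R).-negligible (S `+` M)].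

(* The choice of the affine parametrization is irrelevant, see
   [monotone_on_lineP]. *)
Definition monotone_on (E L : set (heis R)) :=
  exists g v, [/\ v <> (0, 0), L = hline g v & monotoneR (hcurve g v @^-1` E)].

Definition monotone_set (mu : set (heis R) -> \bar R) (E : set (heis R)) :=
  completed_algebra_gen mu E /\ almost_every_line (monotone_on E).

End monotone_sets.

Section affine_invariance.
Context {R : realType}.

Let aff (s r t : R) : R := s * t + r.

Let measurable_aff s r :
  measurable_fun [set: measurableTypeR R] (aff s r : _ -> measurableTypeR R).
Proof.
by apply: (@measurable_funD _ _ R setT (fun t => s * t) (cst r)) => //;
  exact: (@measurable_funM _ _ R setT (cst s) id).
Qed.

Lemma lebesgue_measure_aff (s r : R) (A : set (measurableTypeR R)) :
  s != 0 -> measurable A ->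
  lebesgue_measure A = (`|s|%:E * lebesgue_measure ((fun t => (s * t + r)%R) @^-1` A))%E.
Proof.
move=> s0 mA; have s0' : (0 <= `|s|)%R by [].
pose m := mscale (NngNum s0')
  (measure_function_pushforward__canonical__measure_function_Measure
    (@lebesgue_measure R) (measurable_aff s r)).
apply: (lebesgue_measure_unique (mu := m)) => //.
move=> _ [[a b]] _ <-; change (lebesgue_measure `]a, b]%classic =
  (`|s|%:E * lebesgue_measure (aff s r @^-1` `]a, b]%classic))%E).
have [sp|sn|/esym/eqP] := ltgtP 0 s; last by rewrite (negPf s0).
- rewrite (_ : _ @^-1` _ = [set` `](a - r) / s, (b - r) / s] ]); last first.
    apply/seteqP; split => t /=; rewrite !in_itv /= /aff;
    by rewrite ltr_pdivrMr // ler_pdivlMr // ltrBlDr lerBrDr (mulrC t).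
  rewrite !lebesgue_measure_itv /= !lte_fin ltr_pM2r ?invr_gt0 // ltrD2r.
  case: ifP => _; last by rewrite mule0.
  by rewrite -!EFinB -EFinM gtr0_norm //; congr EFin; field.
- rewrite (_ : _ @^-1` _ = [set` `[(b - r) / s, (a - r) / s[ ]); last first.
    apply/seteqP; split => t /=; rewrite !in_itv /= /aff;
    by rewrite ltr_ndivlMr // ler_ndivrMr // ltrBlDr lerBrDr (mulrC t) andbC.
  rewrite !lebesgue_measure_itv /= !lte_fin ltr_nM2r ?invr_lt0 // ltrD2r.
  case: ifP => _; last by rewrite mule0.
  by rewrite -!EFinB -EFinM ltr0_norm //; congr EFin; field.
Qed.

Lemma monotoneR_aff (s r : R) (S : set (measurableTypeR R)) : s != 0 ->
  monotoneR S -> monotoneR ((fun t => s * t + r) @^-1` S).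
Proof.
move=> s0 [M [mM cM cMC [N [mN N0 SN]]]].
have pre (B : set R) : connected B -> connected ((fun t : R => s * t + r) @^-1` B).
  move=> /connected_intervalP cB; apply/connected_intervalP => x y /= Bx By z.
  have [sp|sn|/esym/eqP] := ltgtP 0 s; last by rewrite (negPf s0).
  - by move=> /andP[xz zy]; apply: (cB _ _ Bx By); rewrite !lerD2r !ler_pM2l ?xz.
  - by move=> /andP[xz zy]; apply: (cB _ _ By Bx); rewrite !lerD2r !ler_nM2l ?xz ?zy.
exists ((fun t => s * t + r) @^-1` M); split.
- by rewrite -[X in measurable X]setTI; exact: measurable_aff.
- exact: pre.
- exact: (pre (~` M)).
exists ((fun t => s * t + r) @^-1` N); split.
- by rewrite -[X in measurable X]setTI; exact: measurable_aff.
- have /esym/eqP := lebesgue_measure_aff r s0 mN.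
  by rewrite N0 mule_eq0 eqe normr_eq0 (negPf s0) => /eqP.
- by move=> t St; apply: SN.
Qed.

Lemma monotone_on_lineP (E : set (heis R)) g v : v <> (0, 0) ->
  monotone_on E (hline g v) <-> monotoneR (hcurve g v @^-1` E).
Proof.
move=> v0; split=> [[g' [v' [v'0 /(hline_inj v0)[r [s [s0 -> ->]]] mE]]]|mE].
  rewrite (_ : _ @^-1` E = (fun t => s * t + r) @^-1` (hcurve g' v' @^-1` E)).
    exact: monotoneR_aff.
  by apply/seteqP; split => t /=; rewrite hcurve_affine.
by exists g, v.
Qed.

End affine_invariance.

(* Compact sets are Borel; [measurable K] only spares the proof of it. *)
Definition is_haar (R : realType) (mu : {measure set (heis R) -> \bar R}) :=
  [/\ forall g A, measurable A -> mu (hmul g @` A) = mu A,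
      forall K : set (heis R), measurable K -> compact K -> (mu K < +oo)%E &
      mu setT != 0%E].

Lemma product_measure_preserved d1 d2 (T1 : measurableType d1)
    (T2 : measurableType d2) (R : realType)
    (m1 : {sigma_finite_measure set T1 -> \bar R})
    (m2 : {sigma_finite_measure set T2 -> \bar R}) (f : T1 * T2 -> T1 * T2) :
  measurable_fun setT f ->
  (forall B C, measurable B -> measurable C ->
    (m1 \x m2)%E (f @^-1` (B `*` C)) = (m1 B * m2 C)%E) ->
  forall A, measurable A -> (m1 \x m2)%E (f @^-1` A) = (m1 \x m2)%E A.
Proof.
move=> mf fE A mA.
pose m := measure_function_pushforward__canonical__measure_function_Measure
    (m1 \x m2)%E mf.
by rewrite (@product_measure_unique _ _ _ _ _ m1 m2 m fE A mA).
Qed.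

Section haar_exists.
Context {R : realType}.
Notation T := (measurableTypeR R).
Notation leb := (@lebesgue_measure R).

Let lebD (r : R) (A : set T) : measurable A ->
  leb ((fun t : T => (t + r : T)) @^-1` A) = leb A.
Proof.
move=> mA; rewrite (lebesgue_measure_aff r (oner_neq0 R) mA) normr1 mul1e.
rewrite (_ : (fun t : R => 1 * t + r) = (fun t => t + r)) //.
by apply/funext => t; rewrite mul1r.
Qed.

Let measurable_shift (r : R) : measurable_fun setT (fun t : T => (t + r : T)).
Proof. exact: (@measurable_funD _ _ R setT id (cst r)). Qed.

Let sh2 (x y : R) (p : T * T) : T * T := (p.1 + x, p.2 + y).

Let measurable_sh2 x y : measurable_fun setT (sh2 x y).
Proof.
apply: measurable_fun_pair.
- exact: (measurableT_comp (measurable_shift x) measurable_fst).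
- exact: (measurableT_comp (measurable_shift y) measurable_snd).
Qed.

Let leb2D x y (A : set (T * T)) : measurable A ->
  @leb2 R (sh2 x y @^-1` A) = @leb2 R A.
Proof.
apply: (product_measure_preserved (m1 := leb) (m2 := leb) (measurable_sh2 x y)) => B C mB mC.
rewrite (_ : _ @^-1` _ = ((fun t : T => (t + x : T)) @^-1` B)
                         `*` ((fun t : T => (t + y : T)) @^-1` C)) //.
have mpre r (D : set T) : measurable D ->
    measurable ((fun t : T => (t + r : T)) @^-1` D).
  by move=> mD; rewrite -[X in measurable X]setTI; exact: measurable_shift.
rewrite product_measure1E; [|exact: mpre|exact: mpre].
by congr (_ * _)%E; exact: lebD.
Qed.

Lemma measurable_hmul (g : heis R) : measurable_fun setT (hmul g).
Proof.
apply: measurable_fun_pair.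
  apply: measurable_fun_pair.
  - apply: (@measurable_funD _ _ R setT (cst (ha g)) ha) => //.
    exact: (measurableT_comp measurable_fst measurable_fst).
  - apply: (@measurable_funD _ _ R setT (cst (hb g)) hb) => //.
    exact: (measurableT_comp measurable_snd measurable_fst).
apply: (@measurable_funD _ _ R setT (fun h => hc g + hc h) (fun h => ha g * hb h)).
- by apply: (@measurable_funD _ _ R setT (cst (hc g)) hc) => //; exact: measurable_snd.
- apply: (@measurable_funM _ _ R setT (cst (ha g)) hb) => //.
  exact: (measurableT_comp measurable_snd measurable_fst).
Qed.

Let leb3_hmul g (A : set (heis R)) : measurable A ->
  @leb3 R (hmul g @^-1` A) = @leb3 R A.
Proof.
apply: (product_measure_preserved (m1 := @leb2 R) (m2 := leb) (measurable_hmul g)) => B C mB mC.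
pose B' := sh2 (ha g) (hb g) @^-1` B.
have mB' : measurable B'.
  by rewrite -[X in measurable X]setTI; exact: measurable_sh2.
have -> : (@leb2 R B * leb C)%E = (@leb2 R \x leb)%E (B' `*` C).
  rewrite product_measure1E //; congr (_ * _)%E; exact/esym/leb2D.
apply: eq_integral => -[a b] _ /=.
rewrite /xsection.
have E1 : (ha g + a, hb g + b) = sh2 (ha g) (hb g) (a, b).
  by rewrite /sh2 /= [ha g + a]addrC [hb g + b]addrC.
have [Bab|Bab] := pselect (B' (a, b)); last first.
  congr (leb _); apply/seteqP; split => c /=; rewrite !inE /= => -[] //.
  by rewrite /ha /hb /= -/(ha g) -/(hb g) E1 => /Bab.
rewrite [in RHS](_ : [set _ | _] = C); last first.
  by apply/seteqP; split => c /=; rewrite !inE => // -[].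
rewrite -[RHS](lebD (hc g + ha g * b) mC); congr (leb _).
have E2 (c : R) : hc g + c + ha g * b = c + (hc g + ha g * b) by ring.
apply/seteqP; split => c /=; rewrite !inE /= /hmul /ha /hb /hc /=
   -/(ha g) -/(hb g) -/(hc g) E1 E2; [by case|by split].
Qed.

(* Non-vacuity of [is_haar]. *)
Lemma leb3_haar : is_haar (@leb3 R).
Proof.
have box (I : set T) : measurable I ->
    @leb3 R ((I `*` I) `*` I) = (leb I * leb I * leb I)%E.
  move=> mI; transitivity (@leb2 R (I `*` I) * leb I)%E.
    exact: (product_measure1E _ _ (measurableX mI mI) mI).
  by congr (_ * _)%E; exact: product_measure1E.
split.
- move=> g A mA.
  pose h : heis R := (- ha g, - hb g, ha g * hb g - hc g).
  have hK : cancel (hmul h) (hmul g).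
    move=> [[a b] c]; rewrite /hmul /h /ha /hb /hc /=; congr (_, _, _); ring.
  have gK : cancel (hmul g) (hmul h).
    move=> [[a b] c]; rewrite /hmul /h /ha /hb /hc /=; congr (_, _, _); ring.
  rewrite -[RHS](leb3_hmul h mA) /leb3; congr (_ _).
  apply/seteqP; split => [_ [p Ap <-]|p Ap /=]; first by rewrite /= gK.
  by exists (hmul h p).
- move=> K mK cK.
  have [M [_ KM]] := @compact_bounded R (R^o * R^o * R^o)%type K cK.
  pose N : R := `|M| + 1; pose I : set T := `[(- N)%R, N]%classic.
  have KI : K `<=` (I `*` I) `*` I.
    move=> [[a b] c] /(KM N _) /=.
    have MN : M < N by rewrite /N ltr_pwDr // ler_norm.
    move=> /(_ MN); rewrite !prod_normE !ge_max /= !ler_norml /I /=.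
    by rewrite !in_itv /= => /andP[/andP[-> ->] ->].
  have mI : measurable I by exact: measurable_itv.
  have mII := measurableX mI mI; have mIII := measurableX mII mI.
  apply: (@le_lt_trans _ _ (@leb3 R ((I `*` I) `*` I))).
    by apply: le_measure; rewrite ?inE.
  have oI : (leb I < +oo)%E.
    rewrite /I lebesgue_measure_itv /=; case: ifP => _; last exact: ltry.
    by rewrite -EFinB ltry.
  by rewrite box // !lte_mul_pinfty ?ge0_fin_numE ?mule_ge0 // lte_mul_pinfty ?ge0_fin_numE.
- have oo : leb setT = +oo%E by rewrite -set_itvNyy lebesgue_measure_itv.
  have := box _ (measurableT : measurable [set: T]); rewrite !setXTT oo => E.
  suff : @leb3 R setT != 0%E by [].
  by rewrite E.
Qed.

End haar_exists.

Section half_spaces.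
Context {R : realType}.

Definition hproj (g : heis R) : R * R := (ha g, hb g).

Definition straight_line (l : set (R * R)) :=
  exists p v : R * R, v <> (0, 0) /\
    l = [set (p.1 + t * v.1, p.2 + t * v.2) | t in [set: R]].

Definition vertical_plane (P : set (heis R)) :=
  exists2 l, straight_line l & P = hproj @^-1` l.

Definition horizontal_plane (p : heis R) : set (heis R) :=
  \bigcup_(L in [set L | is_line L /\ L p]) L.

Definition half_space (W : set (heis R)) :=
  exists P, (vertical_plane P \/ exists p, P = horizontal_plane p) /\
    exists2 x, (~` P) x & W = connected_component (~` P) x.

End half_spaces.

(* Main.v *)
(** Call a point interior if a neighbourhood of it is almost contained in [E], and
    exterior if it is interior to the complement. On a line where [E] is monotone,
    neither of the patterns in, out, in and out, in, out occurs; by Fubini this passes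
    from almost every line to every horizontal line through interior and exterior
    points: a point between two interior points is interior, and so is a point that an
    interior point separates from an exterior one. One-dimensional Lebesgue density,
    applied in the slices [a = t], shows that the interior points accumulate at every
    point where [E] is not null.

    In the coordinates [(a, b, g) = (a, b, c - a b / 2)], placed at height 1 in R^4,
    the horizontal lines become the planes that are isotropic for a symplectic form
    [om]. Let [C] be the cone over the interior points together with the opposite of
    the cone over the exterior points. Then [C] is open, disjoint from [- C], every
    point outside [C] is a limit of points of [- C], and [x + y] is in [C] for
    [x, y] in [C] with [om x y = 0]. Such a cone is an open half-space: the point is
    that no three elements [x, y, z] of [C] have sum 0. Otherwise one finds [e]
    orthogonal to [y] and [z] and in neither [C] nor [- C], then [c] in [C] and [- d]
    in [C] close to [e] with [om c d] of the order of [|c - d|]; after a small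
    change of [y] and [z], a suitable [T] makes [y + T c] and [z - T d] orthogonal
    elements of [C], whose sum is close to [- x]. *)

(* The hard part is to produce interior points, as the horizontal lines through one point only fill
   a null surface. Three directions do it. If [E] is not null near a point, half-lines in the
   direction X show that [E] contains almost all of a cylinder I x S, with [S] not null in the (b,
   c)-plane. From a point of the complement in the slice a = t, half-lines along Y and then X + Y
   stay in the complement and avoid the cylinder. As X and Y do not commute, a time [u] along X + Y
   moves c - t b by u^2/2, so the points reached, projected along X, fill a plane region; [S] would
   miss too much of it at a place where it is dense. Fixed directions need not be good for [E],
   whence the automorphisms [frame m], which carry X, Y and X + Y to generic slopes.

   In the cone argument, T^2 is of order 1 / |om c d|, and the sum of the two new elements contains
   T (c - d). Only a lower bound of |om c d| by a multiple of |c - d| makes that term small, so [c]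
   and [d] cannot be arbitrary points close to [e]. *)
From HB Require Import structures.
Require Import Defs.
From mathcomp Require Import all_boot all_order all_algebra.
From mathcomp Require Import all_classical all_reals all_analysis.
From mathcomp Require Import measurable_realfun ring lra.
Set Implicit Arguments.
Unset Strict Implicit.
Unset Printing Implicit Defensive.
Import Order.TTheory GRing.Theory Num.Theory.
Import numFieldNormedType.Exports.
Local Open Scope classical_set_scope.
Local Open Scope ring_scope.

(** * Null sets in products *)

Section almost_everywhere_product.
Context d1 d2 (T1 : measurableType d1) (T2 : measurableType d2) (R : realType).
Context (m1 : {sigma_finite_measure set T1 -> \bar R})
        (m2 : {sigma_finite_measure set T2 -> \bar R}).

Lemma ae_measurableP d (T : measurableType d) (m : {measure set T -> \bar R})
    (P : set T) : measurable P ->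
  (\forall x \ae m, P x) <-> m (~` P) = 0%E.
Proof. by move=> mP; apply: negligibleP; exact: measurableC. Qed.

Let prod_null1 (A : set (T1 * T2)) : measurable A ->
  (m1 \x m2)%E A = 0%E <-> \forall x \ae m1, m2 (xsection A x) = 0%E.
Proof.
move=> mA; have mf := measurable_fun_xsection m2 mA.
have := ae_eq_integral_abs m1 measurableT mf; rewrite /ae_eq /=.
under eq_integral do rewrite /= gee0_abs //.
rewrite -/(product_measure1 m1 m2 A) => ->; split; apply: filterS => x //.
by move=> /(_ I).
Qed.

Let prod_null2 (A : set (T1 * T2)) : measurable A ->
  (m1 \x m2)%E A = 0%E <-> \forall y \ae m2, m1 (ysection A y) = 0%E.
Proof.
move=> mA; have mf := measurable_fun_ysection m1 mA.
have -> : (m1 \x m2)%E A = (m1 \x^ m2)%E A.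
  by apply: product_measure_unique => //= ? ? ? ?; rewrite product_measure2E.
have := ae_eq_integral_abs m2 measurableT mf; rewrite /ae_eq /=.
under eq_integral do rewrite /= gee0_abs //.
rewrite -/(product_measure2 m1 m2 A) => ->; split; apply: filterS => x //.
by move=> /(_ I).
Qed.

Let ae_xsection (P : set (T1 * T2)) : measurable P ->
  (fun x => \forall y \ae m2, P (x, y)) = (fun x => m2 (xsection (~` P) x) = 0%E).
Proof.
move=> mP; apply/funext => x; apply/propext.
rewrite xsectionE; apply: ae_measurableP.
by have := measurable_xsection x mP; rewrite xsectionE.
Qed.

Let ae_ysection (P : set (T1 * T2)) : measurable P ->
  (fun y => \forall x \ae m1, P (x, y)) = (fun y => m1 (ysection (~` P) y) = 0%E).
Proof.
move=> mP; apply/funext => y; apply/propext.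
rewrite ysectionE; apply: ae_measurableP.
by have := measurable_ysection y mP; rewrite ysectionE.
Qed.

Lemma measurable_ae (P : set (T1 * T2)) : measurable P ->
  measurable [set x | \forall y \ae m2, P (x, y)].
Proof.
move=> mP; have mf := measurable_fun_xsection m2 (measurableC mP).
rewrite (ae_xsection mP) (_ : [set x | _] = (m2 \o xsection (~` P)) @^-1` [set 0%E]) //.
by rewrite -[X in measurable X]setTI; exact: mf.
Qed.

Lemma ae_prodP (P : set (T1 * T2)) : measurable P ->
  (\forall p \ae (m1 \x m2)%E, P p) <-> (\forall x \ae m1, \forall y \ae m2, P (x, y)).
Proof.
move=> mP; rewrite [X in _ <-> X]/prop_near1 (ae_xsection mP).
apply: iff_trans (prod_null1 (measurableC mP)).
exact: ae_measurableP.
Qed.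

Lemma ae_prodP2 (P : set (T1 * T2)) : measurable P ->
  (\forall p \ae (m1 \x m2)%E, P p) <-> (\forall y \ae m2, \forall x \ae m1, P (x, y)).
Proof.
move=> mP; rewrite [X in _ <-> X]/prop_near1 (ae_ysection mP).
apply: iff_trans (prod_null2 (measurableC mP)).
exact: ae_measurableP.
Qed.

(** A measurable null set covers the exceptional points, and [ae_prodP] applies to its
    complement. *)
Lemma ae_prod (P : set (T1 * T2)) :
  (\forall p \ae (m1 \x m2)%E, P p) -> \forall x \ae m1, \forall y \ae m2, P (x, y).
Proof.
move=> [N [mN N0 PN]].
have : \forall p \ae (m1 \x m2)%E, (~` N) p.
  by apply/(ae_measurableP _ (measurableC mN)); rewrite setCK.
move=> /(ae_prodP (measurableC mN)); apply: filterS => x; apply: filterS => y.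
by apply: contra_notP => nP; exact: PN.
Qed.
End almost_everywhere_product.

Lemma ae_swap d1 d2 (T1 : measurableType d1) (T2 : measurableType d2) (R : realType)
    (m1 : {sigma_finite_measure set T1 -> \bar R})
    (m2 : {sigma_finite_measure set T2 -> \bar R}) (P : set (T1 * T2)) :
  measurable P -> (\forall x \ae m1, \forall y \ae m2, P (x, y)) ->
  \forall y \ae m2, \forall x \ae m1, P (x, y).
Proof.
by move=> mP /(ae_prodP m1 m2 mP) /(ae_prodP2 m1 m2 mP).
Qed.

Lemma ae_countable d (T : measurableType d) (R : realType) (m : {measure set T -> \bar R})
    (I : countType) (P : I -> T -> Prop) :
  (forall i, \forall t \ae m, P i t) -> \forall t \ae m, forall i, P i t.
Proof.
move=> aeP; have : forall n, \forall t \ae m, forall i, unpickle n = Some i -> P i t.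
  move=> n; case: (unpickle n) => [i|]; last by apply: aeW.
  by apply: filterS (aeP i) => t Pt _ [<-].
move=> /ae_foralln; apply: filterS => t Ht i.
by apply: (Ht (pickle i)); rewrite pickleK.
Qed.

Lemma measurable_preimT d1 d2 (T1 : measurableType d1) (T2 : measurableType d2)
    (f : T1 -> T2) (A : set T2) :
  measurable_fun setT f -> measurable A -> measurable (f @^-1` A).
Proof. by move=> mf mA; rewrite -[X in measurable X]setTI; exact: mf. Qed.

Ltac mfun :=
  lazymatch goal with
  | |- measurable_fun _ (fun x => (@?f x, @?g x)) => apply: measurable_fun_pair; mfun
  | |- measurable_fun _ (fun x => @?f x - @?g x) =>
      apply: (@measurable_funB _ _ _ setT); mfun
  | |- measurable_fun _ (fun x => @?f x + @?g x) =>
      apply: (@measurable_funD _ _ _ setT); mfun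
  | |- measurable_fun _ (fun x => @?f x * @?g x) =>
      apply: (@measurable_funM _ _ _ setT); mfun
  | |- measurable_fun _ (fun x => @?f x ^+ ?n) =>
      apply: (@measurable_funX _ _ _ setT); mfun
  | |- measurable_fun _ (fun x => fst (@?f x)) =>
      first [exact: measurable_fst | apply: (measurableT_comp measurable_fst); mfun]
  | |- measurable_fun _ (fun x => snd (@?f x)) =>
      first [exact: measurable_snd | apply: (measurableT_comp measurable_snd); mfun]
  | |- measurable_fun _ (fun x => x) => exact: measurable_id
  | |- _ => try by []
  end.

#[local] Hint Extern 0 (Filter (nbhs (almost_everywhere (@lebesgue_measure ?R)))) =>
  exact: (ae_filter_ringOfSetsType (@lebesgue_measure R)) : typeclass_instances.
#[local] Hint Extern 0 (Filter (nbhs (almost_everywhere (@leb3 ?R)))) =>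
  exact: (ae_filter_ringOfSetsType (@leb3 R)) : typeclass_instances.

(** * Lebesgue null sets of the line and of R^3, and their invariance *)

Section lebesgue3.
Context {R : realType}.
Notation T := (measurableTypeR R).
Notation leb := (@lebesgue_measure R).
Implicit Types (P : T -> Prop).

Lemma leb_setT_gt0 : (0 < leb setT)%E.
Proof.
by rewrite (_ : leb setT = +oo%E) ?ltry // -set_itvNyy lebesgue_measure_itv.
Qed.

Lemma ae_leb_ex P : (\forall t \ae leb, P t) -> exists t, P t.
Proof.
move=> Pt; have := ae_properfilter_algebraOfSetsType leb_setT_gt0 => F.
exact: (@filter_ex _ _ F _ Pt).
Qed.

Lemma ae_leb_affine (s r : R) P : s != 0 -> (\forall t \ae leb, P t) ->
  \forall t \ae leb, P (s * t + r).
Proof.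
move=> s0 [N [mN N0 PN]]; exists ((fun t => s * t + r) @^-1` N); split.
- by apply: measurable_preimT mN; mfun.
- have /esym/eqP := lebesgue_measure_aff r s0 mN.
  by rewrite N0 mule_eq0 eqe normr_eq0 (negPf s0) => /eqP.
- by move=> t; exact: PN.
Qed.

Lemma ae_leb_shift (r : R) P : (\forall t \ae leb, P t) -> \forall t \ae leb, P (t + r).
Proof.
by move=> /(ae_leb_affine r (oner_neq0 R)); apply: filterS => t; rewrite mul1r.
Qed.

Lemma ae_leb3P (Q : set (R3 R)) : measurable Q ->
  (\forall p \ae @leb3 R, Q p) <->
  (\forall x \ae leb, \forall y \ae leb, \forall z \ae leb, Q (x, y, z)).
Proof.
move=> mQ; apply: iff_trans (ae_prodP (@leb2 R) leb mQ) _.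
by apply: (ae_prodP leb leb); exact: (measurable_ae leb mQ).
Qed.
End lebesgue3.

Section lebesgue3_invariance.
Context {R : realType}.
Notation T := (measurableTypeR R).
Notation leb := (@lebesgue_measure R).
Notation leb3 := (@leb3 R).

(** Fubini needs measurable sets, while a property such as monotonicity of the trace on a line is
    not known to be measurable in the point; it is replaced by a measurable [Q] of full measure. *)
Lemma ae_cover d (U : measurableType d) (m : {measure set U -> \bar R}) (P : U -> Prop) :
  (\forall x \ae m, P x) -> exists Q : set U,
    [/\ measurable Q, \forall x \ae m, Q x & forall x, Q x -> P x].
Proof.
move=> [N [mN N0 PN]]; exists (~` N); split; first exact: measurableC.
  by exists N; split => // x /= /contrapT.
by move=> x; apply: contra_notP; exact: PN.
Qed.

(** Each coordinate is translated by an amount that depends only on the earlier ones, so translation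
    invariance on the line is applied one coordinate at a time. Right translations and shears have
    this form. *)
Lemma ae_leb3_triangular (al : R) (be : R -> R) (ga : R -> R -> R) (P : R3 R -> Prop) :
  measurable_fun setT (fun p : R3 R =>
    (p.1.1 + al : T, p.1.2 + be p.1.1 : T, p.2 + ga p.1.1 p.1.2 : T)) ->
  (\forall p \ae leb3, P p) ->
  \forall p \ae leb3, P (p.1.1 + al, p.1.2 + be p.1.1, p.2 + ga p.1.1 p.1.2).
Proof.
set f := (X in measurable_fun _ X) => mf /ae_cover[Q [mQ aeQ QP]].
apply: (@filterS _ _ _ (fun p => Q (f p))); first by move=> p; exact: QP.
apply/(ae_leb3P (measurable_preimT mf mQ)).
move/(ae_leb3P mQ): aeQ.
move=> /(ae_leb_shift al); apply: filterS => x.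
move=> /(ae_leb_shift (be x)); apply: filterS => y.
exact: (ae_leb_shift (ga x y)).
Qed.

Lemma ae_leb3_swap (P : R3 R -> Prop) :
  (\forall p \ae leb3, P p) -> \forall p \ae leb3, P (p.1.2, p.1.1, p.2).
Proof.
move=> /ae_cover[Q [mQ aeQ QP]].
apply: (@filterS _ _ _ (fun p : R3 R => Q (p.1.2, p.1.1, p.2))); first by move=> p; exact: QP.
have mf : measurable_fun setT (fun p : R3 R => (p.1.2, p.1.1, p.2) : R3 R) by mfun.
apply/(ae_leb3P (measurable_preimT mf mQ)).
apply: (ae_swap (P := [set p | \forall z \ae leb, Q (p, z)])).
  exact: (measurable_ae leb mQ).
exact/(ae_leb3P mQ).
Qed.

Lemma ae_hmul_r (g : heis R) (P : heis R -> Prop) :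
  (\forall p \ae leb3, P p) -> \forall p \ae leb3, P (hmul p g).
Proof.
move=> /(@ae_leb3_triangular (ha g) (fun=> hb g) (fun x _ => hc g + x * hb g)).
move=> H; have {}H := H _; apply: filterS (H _).
  by move=> -[[x y] z]; rewrite /hmul /= addrA.
by mfun.
Qed.

Lemma measurable_hcurve (v : R * R) :
  measurable_fun setT (fun p : heis R * T => hcurve p.1 v p.2).
Proof.
rewrite /hcurve /hmul /hexp /ha /hb /hc /=; mfun.
Qed.

(** For fixed [s] the map is the right translation by an exponential, which preserves null sets;
    Fubini then exchanges [s] and the point. *)
Lemma ae_hcurve (v : R * R) (P : heis R -> Prop) :
  (\forall p \ae leb3, P p) -> \forall p \ae leb3, \forall s \ae leb, P (hcurve p v s).
Proof.
move=> /ae_cover[Q [mQ aeQ QP]].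
have : \forall p \ae leb3, \forall s \ae leb, Q (hcurve p v s).
  apply: (ae_swap (m1 := leb) (m2 := leb3) (P := [set q : T * heis R | Q (hcurve q.2 v q.1)])).
    apply: (@measurable_preimT _ _ _ _ (fun p : T * heis R => hcurve p.2 v p.1) Q _ mQ).
    rewrite /hcurve /hmul /hexp /ha /hb /hc /=; mfun.
  by apply: aeW => s; exact: (@ae_hmul_r (hexp (s * v.1, s * v.2)) Q).
by apply: filterS => p; apply: filterS => s; exact: QP.
Qed.
End lebesgue3_invariance.

(** * Monotone sets along a direction *)

Section monotone_lines.
Context {R : realType}.
Notation T := (measurableTypeR R).
Notation leb := (@lebesgue_measure R).
Notation leb3 := (@leb3 R).
Implicit Types (E : set (heis R)) (v : R * R).

Lemma hcurveD (z : heis R) v r s : hcurve (hcurve z v r) v s = hcurve z v (r + s).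
Proof. by have := hcurve_affine z v r 1 s; rewrite !mul1r addrC -surjective_pairing. Qed.

Lemma hcurve0 (z : heis R) v : hcurve z v 0 = z.
Proof.
by case: z => -[a b] c; rewrite /hcurve /hmul /hexp /ha /hb /hc /=; congr (_, _, _); ring.
Qed.

(** The lines of direction [v] are counted through the points on them, so that no chart of the space
    of lines is involved. *)
Definition monotone_along E v :=
  \forall z \ae leb3, monotoneR (hcurve z v @^-1` E).

Lemma monotoneRC (S : set T) : monotoneR S -> monotoneR (~` S).
Proof.
move=> [M [mM cM cMC [N [mN N0 SN]]]]; exists (~` M); split => //.
- exact: measurableC.
- by rewrite setCK.
- exists N; split => // t [[nS nM]|[nM nS]]; apply: SN; last by left; split => //; exact: contrapT.
  by right; split => //; exact: contrapT.
Qed.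

Lemma monotone_alongC E v : monotone_along E v -> monotone_along (~` E) v.
Proof. by apply: filterS => z; exact: monotoneRC. Qed.

Lemma monotone_along_ae E E' v :
  (\forall z \ae leb3, E z <-> E' z) -> monotone_along E v -> monotone_along E' v.
Proof.
move=> /(ae_hcurve v) EE'; apply: filterS2 EE' => z [N [mN N0 EN]].
move=> [M [mM cM cMC [N' [mN' N'0 SN]]]]; exists M; split => //.
apply: (@negligibleS _ _ _ leb (N `|` N')); last first.
  by apply: negligibleU; [exists N; split=> //|exists N'; split=> //].
move=> s SM; have [/EN|] := pselect (~ (E (hcurve z v s) <-> E' (hcurve z v s))); first by left.
move=> /contrapT [EE' E'E]; right; apply: SN.
by case: SM => -[a b]; [left|right]; split => //; [exact: E'E|move=> /EE'].
Qed.

Lemma monotone_along_slope E :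
  (\forall q \ae leb3, monotone_on E (line_of_X q)) ->
  \forall m \ae leb, monotone_along E (1, m).
Proof.
move=> /ae_cover[Q [mQ /(ae_leb3P mQ) aeQ QP]].
apply: filterS aeQ => m aem.
(* The chart coordinates of the line of slope [m] through [z], followed back to the plane a = 0. For
   fixed a this only translates b and c. *)
pose f (z : heis R) : R3 R := (m, z.1.2 - m * z.1.1, z.2 - m * z.1.1 ^+ 2 / 2).
have mf : measurable_fun setT f by rewrite /f; mfun.
apply: (@filterS _ _ _ (f @^-1` Q)); last first.
  apply/(ae_leb3P (measurable_preimT mf mQ)); apply: aeW => a.
  move: aem => /(ae_leb_shift (- (m * a))); apply: filterS => b.
  exact: (ae_leb_shift (- (m * a ^+ 2 / 2))).
have m0 : (1, m) <> (0, 0) :> R * R by move=> -[/eqP]; rewrite oner_eq0.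
move=> z /QP /(monotone_on_lineP _ _ m0) /(monotoneR_aff z.1.1 (oner_neq0 R)).
have zE : z = hcurve (0, (f z).1.2, (f z).2) (1, (f z).1.1) z.1.1.
  case: z => -[a b] c; rewrite /f /hcurve /hmul /hexp /ha /hb /hc /=.
  by congr (_, _, _); field.
suff -> : hcurve z (1, m) @^-1` E = (fun t => 1 * t + z.1.1) @^-1`
  (hcurve (0, (f z).1.2, (f z).2) (1, (f z).1.1) @^-1` E) by [].
by apply/funext => t; rewrite /preimage /= [in LHS]zE hcurveD mul1r addrC.
Qed.

(* The points at which the pattern is met are negligible on almost every line,
   hence, being a measurable set, negligible. *)
Let ae_along v (B : set (heis R)) : measurable B ->
  (\forall z \ae leb3, \forall s \ae leb, ~ B (hcurve z v s)) ->
  \forall z \ae leb3, ~ B z.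
Proof.
move=> mB.
have mf : measurable_fun setT (fun p : heis R * T => hcurve p.1 v p.2).
  exact: measurable_hcurve.
move=> /(ae_swap (m1 := leb3) (m2 := leb)
  (measurable_preimT mf (measurableC mB)))/ae_leb_ex[s].
move=> /(ae_hmul_r (hexp (- s * v.1, - s * v.2))); apply: filterS => z.
rewrite -/(hcurve z v (- s)) /= => nB Bz; apply: nB.
by rewrite hcurveD addNr hcurve0.
Qed.

Let measurable_on_curve v (E : set (heis R)) (A : set T) :
  measurable E -> measurable A ->
  measurable [set z | \forall s \ae leb, A s -> E (hcurve z v s)].
Proof.
move=> mE mA.
apply: (measurable_ae leb (P := [set p : heis R * T | A p.2 -> E (hcurve p.1 v p.2)])).
rewrite (_ : [set p | _] = (snd @^-1` (~` A)) `|` ((fun p => hcurve p.1 v p.2) @^-1` E)).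
  apply: measurableU; apply: measurable_preimT => //.
  - exact: measurableC.
  - exact: measurable_hcurve.
by apply/seteqP; split => p /= H; [rewrite -implyE|rewrite implyE].
Qed.

(** Rules out the pattern out, in, out with [z] in the middle: the complement of [M] is an interval,
    and points of it on both sides would put the middle one in it. *)
Lemma monotone_along_between E v (A B : set T) :
  measurable E -> monotone_along E v -> measurable A -> measurable B ->
  (forall a b, A a -> B b -> a < 0 < b) ->
  \forall z \ae leb3, E z ->
    (\forall s \ae leb, A s -> E (hcurve z v s)) \/
    (\forall s \ae leb, B s -> E (hcurve z v s)).
Proof.
move=> mE monE mA mB AB.
pose bad : set (heis R) := E `&` (~` [set z | \forall s \ae leb, A s -> E (hcurve z v s)] `&`
  ~` [set z | \forall s \ae leb, B s -> E (hcurve z v s)]).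
have mbad : measurable bad.
  apply: measurableI => //.
  by apply: measurableI; apply: measurableC; apply: measurable_on_curve.
have : \forall z \ae leb3, ~ bad z.
  apply: (ae_along (v := v) mbad); apply: filterS monE => z [M [mM _ /connected_intervalP cMC SM]].
  have aeSM : \forall s \ae leb, E (hcurve z v s) <-> M s.
    apply: negligibleS SM => s /= nEM.
    have [Es|nEs] := pselect (E (hcurve z v s)).
      by left; split => // Ms; apply: nEM; split.
    by right; split => //; apply: contrapT => nMs; apply: nEM; split.
  apply: filterS (aeSM) => s EM [Es [nA nB]].
  have find (D : set T) : ~ (\forall s0 \ae leb, D s0 -> E (hcurve (hcurve z v s) v s0)) ->
      exists2 t, D t & ~ M (s + t).
    apply: contra_notP => nD.
    have := ae_leb_shift s aeSM; apply: filterS => t; rewrite addrC hcurveD => EMt Dt.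
    by apply/EMt; apply: contrapT => nM; apply: nD; exists t.
  have [a Aa Ma] := find _ nA; have [b Bb Mb] := find _ nB.
  have /andP[a0 b0] := AB _ _ Aa Bb.
  have : (~` M) s by apply: (cMC _ _ Ma Mb); rewrite gerDl lerDl !ltW.
  by apply; apply/EM.
apply: filterS => z nbad Ez; apply: contrapT => /not_orP[nA nB].
exact: nbad.
Qed.

(** Rules out in, out, in with [z] at one end, [A] in the middle and [B] at the other end, by the
    connectedness of [M]. *)
Lemma monotone_along_beyond E v (A B : set T) :
  measurable E -> monotone_along E v -> measurable A -> measurable B ->
  (forall a b, A a -> B b -> 0 < a < b \/ b < a < 0) ->
  \forall z \ae leb3, E z ->
    (\forall s \ae leb, A s -> E (hcurve z v s)) \/
    (\forall s \ae leb, B s -> (~` E) (hcurve z v s)).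
Proof.
move=> mE monE mA mB AB.
pose bad : set (heis R) := E `&` (~` [set z | \forall s \ae leb, A s -> E (hcurve z v s)] `&`
  ~` [set z | \forall s \ae leb, B s -> (~` E) (hcurve z v s)]).
have mbad : measurable bad.
  apply: measurableI => //.
  apply: measurableI; apply: measurableC; apply: measurable_on_curve => //.
  exact: measurableC.
have : \forall z \ae leb3, ~ bad z.
  apply: (ae_along (v := v) mbad); apply: filterS monE => z [M [mM /connected_intervalP cM _ SM]].
  have aeSM : \forall s \ae leb, E (hcurve z v s) <-> M s.
    apply: negligibleS SM => s /= nEM.
    have [Es|nEs] := pselect (E (hcurve z v s)).
      by left; split => // Ms; apply: nEM; split.
    by right; split => //; apply: contrapT => nMs; apply: nEM; split.
  apply: filterS (aeSM) => s EM [Es [nA nB]].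
  have [a Aa Ma] : exists2 t, A t & ~ M (s + t).
    move: nA; apply: contra_notP => nD.
    have := ae_leb_shift s aeSM; apply: filterS => t; rewrite addrC hcurveD => EMt Dt.
    by apply/EMt; apply: contrapT => nM; apply: nD; exists t.
  have [b Bb Mb] : exists2 t, B t & M (s + t).
    move: nB; apply: contra_notP => nD.
    have := ae_leb_shift s aeSM; apply: filterS => t; rewrite addrC hcurveD => EMt Dt.
    by move=> /EMt Mt; apply: nD; exists t.
  move/EM: Es => Ms; apply: Ma.
  have [/andP[a0 ab]|/andP[ba a0]] := AB _ _ Aa Bb.
    by apply: (cM _ _ Ms Mb); rewrite lerDl lerD2l !ltW.
  by apply: (cM _ _ Mb Ms); rewrite gerDl lerD2l !ltW.
apply: filterS => z nbad Ez; apply: contrapT => /not_orP[nA nB].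
exact: nbad.
Qed.
End monotone_lines.

(** * Lebesgue density and interior points *)

Section lebesgue1.
Context {R : realType}.
Notation T := (measurableTypeR R).
Notation leb := (@lebesgue_measure R).

(** If an interval of length l of a cover of [N] meets [N], the image of the intersection lies in an
    interval of length 2 K l around the image of any of its points. *)
Lemma negligible_lipschitz_image (f : R -> R) (K : R) (N : set R) : 0 <= K ->
  (forall x y, N x -> N y -> `|f x - f y| <= K * `|x - y|) ->
  leb.-negligible N -> leb.-negligible (f @` N).
Proof.
move=> K0 fK /negligible_outer_measure N0; apply/negligible_outer_measure.
apply/eqP; rewrite eq_le outer_measure_ge0 andbT.
apply/lee_addgt0Pr => e e0; rewrite add0e.
have K2 : 0 < 2 * K + 1 by rewrite ltr_wpDl // mulr_ge0.
(* Dividing by [2 * K + 1] and not by [2 * K] allows [K = 0]. *)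
have [F [Fitv NF] Fe] : exists2 F, open_itv_cover N F &
    (\sum_(0 <= k <oo) wlength idfun (F k) < (e / (2 * K + 1))%:E)%E.
  have : ((wlength idfun)^*%mu N < (e / (2 * K + 1))%:E)%E.
    by rewrite N0 lte_fin divr_gt0.
  by rewrite outer_measure_open_itv_cover => /ereal_inf_lt[_ [F NF <-] Fe]; exists F.
have fNF : f @` N `<=` \bigcup_k (f @` (N `&` F k)).
  move=> _ [x Nx <-]; have [k _ Fkx] := NF _ Nx; exists k => //.
  by exists x.
apply: (@le_trans _ _ ((wlength idfun)^*%mu (\bigcup_k (f @` (N `&` F k))))).
  exact: le_outer_measure.
apply: (le_trans (outer_measure_sigma_subadditive _ _)).
apply: (@le_trans _ _ (\sum_(0 <= k <oo) ((2 * K)%:E * wlength idfun (F k)))%E).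
  apply: lee_nneseries => // k _.
  have [[a b] /= Fk] := Fitv k; rewrite Fk.
  have [ab|ba] := ltP a b; last first.
    rewrite set_itv_ge ?bnd_simp -?leNgt // setI0 image_set0 outer_measure0.
    by rewrite wlength0 mule0.
  rewrite wlength_itv /= lte_fin ab -EFinD -EFinM.
  have [->|/set0P[x [Nx /=]]] := eqVneq (N `&` `]a, b[%classic) set0.
    by rewrite image_set0 outer_measure0 lee_fin !mulr_ge0 // subr_ge0 ltW.
  rewrite in_itv /= => /andP[ax xb].
  have sub : f @` (N `&` `]a, b[%classic) `<=`
      `[f x - K * (b - a), f x + K * (b - a)]%classic.
    move=> _ [y [Ny /=]] + <-; rewrite !in_itv /= => /andP[ay yb].
    rewrite -ler_distl; apply: le_trans (fK _ _ Ny Nx) _.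
    by rewrite ler_wpM2l // ler_distlC; apply/andP; split; lra.
  pose J : set R := `[f x - K * (b - a), f x + K * (b - a)]%classic.
  apply: (@le_trans _ _ ((wlength idfun)^*%mu J)); first exact: le_outer_measure.
  rewrite -[leLHS]/(leb J) /J.
  rewrite lebesgue_measure_itv /=; case: ifP => _.
    by rewrite -EFinD lee_fin; lra.
  by rewrite lee_fin !mulr_ge0 // subr_ge0 ltW.
rewrite nneseriesZl; last first.
  move=> k _; case: (Fitv k) => -[a b] ->; rewrite wlength_itv /=.
  by case: ifP => // ab; rewrite -EFinD lee_fin subr_ge0 ltW.
apply: (@le_trans _ _ ((2 * K)%:E * (e / (2 * K + 1))%:E)%E).
  by apply: lee_wpmul2l; [rewrite lee_fin mulr_ge0|exact: ltW].
rewrite -EFinM lee_fin mulrA ler_pdivrMr // mulrC ler_pM2l //; lra.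
Qed.

(** The time [u] along X + Y enters the sheared coordinate through its half square, which is
    [n]-Lipschitz for 0 < u < n and thus carries null sets to null sets. *)
Lemma ae_half_square (P : R -> Prop) : (\forall u \ae leb, 0 < u -> P (u ^+ 2 / 2)) ->
  \forall c \ae leb, 0 < c -> P c.
Proof.
move=> aeP; pose f (u : R) := u ^+ 2 / 2.
pose N (n : nat) := [set u : R | [/\ 0 < u, u < n%:R & ~ P (f u)]].
have fN n : leb.-negligible (f @` N n).
  apply: (@negligible_lipschitz_image f n%:R) => [//|x y [x0 xn _] [y0 yn _]|].
    have -> : f x - f y = ((x + y) / 2) * (x - y) by rewrite /f; field.
    rewrite normrM ler_wpM2r // ger0_norm; lra.
  by apply: negligibleS aeP => u [u0 _ nP] /= H; exact/nP/H.
apply: negligibleS (negligible_bigcup fN) => c /= /not_implyP[c0 nP].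
pose u := Num.sqrt (2 * c).
have u0 : 0 < u by rewrite sqrtr_gt0 mulr_gt0.
have fu : f u = c by rewrite /f sqr_sqrtr ?mulr_ge0 ?ltW //; field.
exists (Num.truncn u).+1 => //; exists u => //; split => //; last by rewrite fu.
by have := truncnS_gt u.
Qed.

(** [p] and [h] are rational so that exceptional sets can be united over countably many choices. The
    half-width [3 * ratr h] leaves room for the three displacements in [shadow_gap] and for the two
    side thirds in [slices_box]. *)
Lemma high_density_interval (A : set T) (h0 e : R) : measurable A ->
  ~ (\forall t \ae leb, ~ A t) -> 0 < h0 -> 0 < e ->
  exists p h : rat, [/\ 0 < (ratr h : R), (ratr h : R) < h0 &
    (leb (`](ratr p - 3 * ratr h)%R, (ratr p + 3 * ratr h)%R[ `\` A) < (e * ratr h)%:E)%E].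
Proof.
move=> mA nA h00 e0; have dens := lebesgue_density mA.
have [x Ax cv] : exists2 x, A x & (leb (A `&` ball x r) * (leb (ball x r))^-1)%E
    @[r --> 0^'+] --> (\1_A x)%:E.
  apply: contrapT => nx; apply: nA; apply: filterS dens => x cx Ax.
  by apply: nx; exists x.
move: cv; rewrite indicE mem_set //= => cv.
move/fine_cvgP: cv => [_ /cvgr_gt cv].
have /cv{}cv : 1 - e / 8 < 1 by rewrite ltrBlDr ltrDl divr_gt0.
have [r [r0 rh0 rA]] : exists r, [/\ 0 < r, r < h0 &
    1 - e / 8 < fine (leb (A `&` ball x r) * (leb (ball x r))^-1)%E].
  near ((0 : R)^'+) => r; exists r; split.
  - by near: r; exact: nbhs_right_gt.
  - by near: r; exact: nbhs_right_lt.
  - by near: r; exact: cv.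
have ballE : leb (ball x r) = (2 * r)%:E.
  by rewrite lebesgue_measure_ball ?ltW // mulr2n -mulr2n mulr_natl.
have mB : measurable (ball x r : set T) by exact: measurable_ball.
have small : (leb (ball x r `\` A) < (2 * r * (e / 8))%:E)%E.
  have fin : leb (A `&` ball x r) \is a fin_num.
    rewrite ge0_fin_numE //; apply: (@le_lt_trans _ _ (leb (ball x r))).
      by apply: le_measure; rewrite ?inE //; exact: measurableI.
    by rewrite ballE ltry.
  have foo : (leb (ball x r) < +oo)%E by rewrite ballE ltry.
  have -> : leb (ball x r `\` A) = (leb (ball x r) - leb (A `&` ball x r))%E.
    by rewrite setIC; exact: measureD mB mA foo.
  rewrite ballE -(fineK fin) -EFinB lte_fin.
  move: rA; rewrite ballE inver mulf_eq0 pnatr_eq0 /= gt_eqF // -(fineK fin) -EFinM /=.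
  rewrite ltr_pdivlMr ?mulr_gt0 //; lra.
(* The window fits in the ball of radius r because 6/7 + 1/100 < 1, and h > r/4 turns the bound 2 r
   (e/8) into one below e h. *)
have [|h] := @rat_in_itvoo R (r / 4) (2 * r / 7); first by lra.
rewrite in_itv /= => /andP[h1 h2].
have [|p] := @rat_in_itvoo R (x - r / 100) (x + r / 100); first by lra.
rewrite in_itv /= => /andP[p1 p2].
exists p, h; split; [lra|lra|].
apply: (@le_lt_trans _ _ (leb (ball x r `\` A))).
  apply: le_measure; rewrite ?inE; [exact: measurableD|exact: measurableD|].
  apply: setSD => y /=; rewrite in_itv /= /ball /= => /andP[y1 y2].
  by rewrite ltr_distlC; apply/andP; split; lra.
apply: (lt_le_trans small); rewrite lee_fin.
have := ler_wpM2r (ltW e0) (ltW h1); lra.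
Unshelve. all: by end_near. Qed.
End lebesgue1.

(** * Shadows of points in a slice *)

Section slice.
Context {R : realType}.
Notation T := (measurableTypeR R).
Notation leb := (@lebesgue_measure R).

Lemma le_lebesgue_ae (A B : set T) : measurable A -> measurable B ->
  (\forall s \ae leb, A s -> B s) -> (leb A <= leb B)%E.
Proof.
move=> mA mB [N [mN N0 AB]].
apply: (@le_trans _ _ (leb (B `|` N))).
  apply: le_measure; rewrite ?inE //; first exact: measurableU.
  move=> s As; have [Bs|nBs] := pselect (B s); first by left.
  by right; apply: AB => /= /(_ As).
have : (leb (B `|` N) <= leb B + leb N)%E by exact: measureU2.
by rewrite N0 adde0.
Qed.

(** [s] is a time along Y and [u] a time along X + Y; [sg] and [ep] select the half-lines, and [ep]
    may vary with [s]. The first coordinate of [S] is the sheared one, c - t b. *)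
Definition shadowed (S : set (T * T)) (eta b0 c0 : R) : Prop :=
  exists2 sg : R, sg = 1 \/ sg = -1 &
  \forall s \ae leb, 0 < s < eta -> exists2 ep : R, ep = 1 \/ ep = -1 &
  \forall u \ae leb, 0 < u < eta -> ~ S (c0 + u ^+ 2 / 2, b0 + sg * s + ep * u).

(** One sign [ep] serves for values of [s] of measure at least h/2. At the level c0 + u^2/2 their
    shadow is an isometric copy of this set, disjoint from [S] up to a null set, and it stays in the
    window because [b0 - p], [s] and [u] are all less than [h] in absolute value. *)
Let shadow_gap (S : set (T * T)) (eta b0 c0 p h : R) : measurable S ->
  0 < h -> h <= eta -> `|b0 - p| < h -> shadowed S eta b0 c0 ->
  \forall c \ae leb, c0 < c < c0 + h ^+ 2 / 2 ->
    ((h / 2)%:E <= leb (`](p - 3 * h)%R, (p + 3 * h)%R[%classic `\` xsection S c))%E.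
Proof.
move=> mS h0 heta b0p [sg sgP shad].
pose good (ep : R) (q : T * T) := 0 < q.1 < h -> 0 < q.2 < h ->
  ~ S (c0 + q.2 ^+ 2 / 2, b0 + sg * q.1 + ep * q.2).
have mI : measurable (`]0, h[%classic : set T) by exact: measurable_itv.
have mgood ep : measurable [set q | good ep q].
  rewrite (_ : [set q | _] = (fst @^-1` (~` `]0, h[%classic) `|`
    (snd @^-1` (~` `]0, h[%classic) `|`
     (fun q : T * T => (c0 + q.2 ^+ 2 / 2, b0 + sg * q.1 + ep * q.2)) @^-1` (~` S)))).
    apply: measurableU; first by apply: measurable_preimT => //; exact: measurableC.
    apply: measurableU; first by apply: measurable_preimT => //; exact: measurableC.
    by apply: measurable_preimT; [mfun|exact: measurableC].
  apply/seteqP; split => -[s u] /=; rewrite /good /= !in_itv /=.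
    have [s1|s1] := boolP (0 < s < h); last by left => /=; exact/negP.
    have [u1|u1] := boolP (0 < u < h); last by right; left => /=; exact/negP.
    by right; right; exact: H.
  by move=> [/negP|[/negP|]] // H1 H2 H3; rewrite ?(negPf H1) ?(negPf H2).
pose A (ep : R) : set T := `]0, h[%classic `&` [set s | \forall u \ae leb, good ep (s, u)].
have mA ep : measurable (A ep) by apply: measurableI => //; exact: (measurable_ae leb (mgood ep)).
have cover : ((h / 2)%:E <= leb (A 1%R))%E \/ ((h / 2)%:E <= leb (A (-1)%R))%E.
  apply: contrapT => /not_orP[/negP + /negP]; rewrite -!ltNge => A1 A2.
  have : (h%:E <= leb (A 1%R `|` A (-1)%R))%E.
    apply: (@le_trans _ _ (leb `]0, h[%classic)).
      by rewrite lebesgue_measure_itv /= lte_fin h0 sube0.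
    apply: le_lebesgue_ae => //; first exact: measurableU.
    apply: filterS shad => s sP; rewrite /= in_itv /= => /andP[s0 sh].
    have [|ep [->|->] epP] := sP; first by rewrite s0 (lt_le_trans sh).
      left; split; rewrite /= ?in_itv /= ?s0 //; apply: filterS epP => u uP _ /= /andP[u0 uh].
      by apply: uP; rewrite u0 (lt_le_trans uh).
    right; split; rewrite /= ?in_itv /= ?s0 //; apply: filterS epP => u uP _ /= /andP[u0 uh].
    by apply: uP; rewrite u0 (lt_le_trans uh).
  apply/negP; rewrite -ltNge.
  apply: (@le_lt_trans _ _ (leb (A 1%R) + leb (A (-1)%R))%E); first exact: measureU2.
  have -> : h%:E = ((h / 2)%:E + (h / 2)%:E)%E by rewrite -EFinD -splitr.
  exact: lteD.
have [ep epP hA] : exists2 ep : R, ep = 1 \/ ep = -1 & ((h / 2)%:E <= leb (A ep))%E.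
  by case: cover => ?; [exists 1|exists (-1)] => //; [left|right].
(* The order of [s] and [u] is exchanged because the sections of [S] are taken at fixed [u]. *)
have aeu : \forall u \ae leb, \forall s \ae leb, A ep s -> 0 < u < h ->
    ~ S (c0 + u ^+ 2 / 2, b0 + sg * s + ep * u).
  have mP : measurable [set q : T * T | A ep q.1 -> good ep q].
    rewrite (_ : [set q | _] = fst @^-1` (~` A ep) `|` [set q | good ep q]).
      apply: measurableU => //; apply: measurable_preimT; first by mfun.
      exact: (measurableC (mA ep)).
    apply/seteqP; split => q; last by move=> [nA /nA|H _].
    by move=> H; have [Aq|nA] := pselect (A ep q.1); [right; exact: H|left].
  have /(ae_swap (m1 := leb) (m2 := leb) mP) : \forall s \ae leb, \forall u \ae leb,
      [set q : T * T | A ep q.1 -> good ep q] (s, u).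
    apply: aeW => s; have [As|nAs] := pselect (A ep s); last by apply: aeW => u /nAs.
    by apply: filterS As.2 => u gu _.
  apply: filterS => u; apply: filterS => s /= H As; apply: (H As).
  by have := As.1; rewrite /= in_itv.
have : \forall u \ae leb, 0 < u -> u ^+ 2 / 2 < h ^+ 2 / 2 ->
   ((h / 2)%:E <=
    leb (`](p - 3 * h)%R, (p + 3 * h)%R[%classic `\` xsection S (c0 + u ^+ 2 / 2)%R))%E.
  apply: filterS aeu => u us u0 uh2.
  have uh : u < h.
    have : u ^+ 2 < h ^+ 2 by move: uh2; rewrite ltr_pM2r.
    by rewrite ltr_pXn2r // nnegrE ltW.
  set D := (_ `\` _).
  have mD : measurable (D : set T).
    by apply: measurableD => //; exact: measurable_xsection.
  have sg0 : sg != 0 by case: sgP => ->; rewrite ?oppr_eq0 oner_eq0.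
  have sg1 : `|sg| = 1 by case: sgP => ->; rewrite ?normrN normr1.
  rewrite (lebesgue_measure_aff (b0 + ep * u) sg0 mD) sg1 mul1e.
  apply: (le_trans hA); apply: le_lebesgue_ae => //.
    by apply: measurable_preimT mD; mfun.
  apply: filterS us => s + As; rewrite u0 uh => /(_ As isT) nS.
  have := As.1; rewrite /= in_itv /= => /andP[s0 sh].
  split => /=; last first.
    by rewrite /xsection /= inE (_ : sg * s + (b0 + ep * u) = b0 + sg * s + ep * u) //; ring.
  rewrite in_itv /= -ltr_distl.
  rewrite (_ : _ - p = (b0 - p) + (sg * s + ep * u)); last by ring.
  apply: le_lt_trans (ler_normD _ _) _.
  have : `|sg * s + ep * u| <= s + u.
    apply: le_trans (ler_normD _ _) _; rewrite !normrM sg1 mul1r (gtr0_norm s0) (gtr0_norm u0).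
    by case: epP => ->; rewrite ?normrN normr1 mul1r.
  lra.
move=> /(@ae_half_square R (fun c => c < h ^+ 2 / 2 -> ((h / 2)%:E <=
  leb (`](p - 3 * h)%R, (p + 3 * h)%R[%classic `\` xsection S (c0 + c)%R))%E)).
move=> /(ae_leb_shift (- c0)); apply: filterS => c + /andP[c1 c2].
rewrite (_ : c0 + (c + - c0) = c); last by ring.
by rewrite subr_gt0 => /(_ c1); apply; lra.
Qed.

(** Where a section of [S] fills the window up to h/4, there is no room for a shadow, which costs
    h/2. Such levels are not null in some short interval, and every [c0] just below that interval
    reaches them with u < h. *)
Lemma shadowed_free (S : set (T * T)) (eta delta : R) : measurable S ->
  0 < eta -> 0 < delta ->
  ~ (\forall c \ae leb, \forall b \ae leb, ~ S (c, b)) ->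
  exists q1 q2 q3 q4 : R, [/\ q1 < q2, q3 < q4 & forall b0 c0, q1 < b0 < q2 -> q3 < c0 < q4 ->
    ~ shadowed S eta b0 c0 /\
    exists c b, [/\ S (c, b), `|b - b0| < delta & `|c - c0| < delta]].
Proof.
move=> mS eta0 delta0 nS.
pose small := Num.min eta (Num.min 1 (delta / 4)).
have small0 : 0 < small by rewrite !lt_min eta0 ltr01 divr_gt0.
pose J (p h : rat) : set T := `](ratr p - 3 * ratr h)%R, (ratr p + 3 * ratr h)%R[%classic.
pose K p h c := [/\ 0 < ratr h :> R, ratr h < small &
  (leb (J p h `\` xsection S c) < (1 / 4 * ratr h)%:E)%E].
have [p [h nK]] : exists p h, ~ \forall c \ae leb, ~ K p h c.
  apply: contrapT => nK; apply: nS.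
  have : \forall c \ae leb, forall p h, ~ K p h c.
    apply: ae_countable => p; apply: ae_countable => h.
    by apply: contrapT => nKph; apply: nK; exists p, h.
  apply: filterS => c nKc; apply: contrapT => nSc.
  have [||p [h ph]] := @high_density_interval R (xsection S c) small (1 / 4)
    (measurable_xsection c mS) _ small0.
  - by move: nSc; apply: contra_not; apply: filterS => b; rewrite /xsection /= inE.
  - by rewrite divr_gt0.
  - exact: (nKc p h).
pose H : R := ratr h.
have [H0 Hs] : 0 < H /\ H < small.
  apply: contrapT => nH; apply: nK; apply: aeW => c [? ? _]; exact: nH.
(* With [c0] within H^2/8 below [ratr c1], these levels satisfy c - c0 < H^2/4, inside the reach
   H^2/2 of [shadow_gap]. *)
have [c1 nKc] : exists c1 : rat, ~ \forall c \ae leb,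
    ratr c1 < c < ratr c1 + H ^+ 2 / 8 -> ~ K p h c.
  apply: contrapT => nc; apply: nK.
  have : \forall c \ae leb, forall c1 : rat, ratr c1 < c < ratr c1 + H ^+ 2 / 8 -> ~ K p h c.
    by apply: ae_countable => c1; apply: contrapT => nc1; apply: nc; exists c1.
  apply: filterS => c Hc.
  have [|c1] := @rat_in_itvoo R (c - H ^+ 2 / 8) c.
    by rewrite ltrBlDr ltrDl divr_gt0 ?exprn_gt0.
  by rewrite in_itv /= => /andP[h1 h2]; apply: (Hc c1); rewrite h2 -ltrBlDr.
have [c2 c2b Kc2] : exists2 c2, ratr c1 < c2 < ratr c1 + H ^+ 2 / 8 & K p h c2.
  apply: contrapT => nc2; apply: nKc; apply: aeW => c cb Kc; apply: nc2; by exists c.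
have [[_ _ Kc2'] H20] : K p h c2 /\ 0 < H ^+ 2 by split => //; rewrite exprn_gt0.
have [He H1 Hd] : [/\ H < eta, H < 1 & H < delta / 4].
  by move: Hs; rewrite !lt_min => /and3P.
have H2H : H ^+ 2 < delta.
  have : H * H < H * 1 by rewrite ltr_pM2l.
  rewrite -expr2; lra.
exists (ratr p - H), (ratr p + H), (ratr c1 - H ^+ 2 / 8), (ratr c1); split; [lra|lra|].
move=> b0 c0 b0p /andP[c0l c0r]; split.
  move=> shad; apply: nKc.
  have := shadow_gap mS H0 (ltW He) _ shad => /(_ (ratr p)).
  rewrite ltr_distl b0p => /(_ isT); apply: filterS => c cH /andP[cl cr] [_ _].
  apply/negP; rewrite -leNgt; apply: le_trans (cH _); last by apply/andP; split; lra.
  by rewrite lee_fin -/H; lra.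
have [b Jb Sb] : exists2 b, J p h b & S (c2, b).
  apply: contrapT => nb; move: Kc2'; apply/negP; rewrite -leNgt.
  rewrite (_ : J p h `\` _ = J p h); last first.
    apply/seteqP; split => [b []//|b Jb]; split => // Sb; apply: nb; exists b => //.
    by move: Sb; rewrite /xsection /= inE.
  rewrite lebesgue_measure_itv /= lte_fin -/H ifT; last lra.
  by rewrite -EFinB lee_fin; lra.
exists c2, b; split => //; last first.
  by rewrite ltr_distl; move: c2b => /andP[? ?]; apply/andP; split; lra.
move: Jb b0p; rewrite /J /= in_itv /= -/H => /andP[? ?] /andP[? ?].
by rewrite ltr_distl; apply/andP; split; lra.
Qed.
End slice.

(** * Interior points from the directions X, Y and X + Y *)

Section interior_points.
Context {R : realType}.
Notation T := (measurableTypeR R).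
Notation leb := (@lebesgue_measure R).
Notation leb3 := (@leb3 R).

Lemma ae_leb3 (P : R3 R -> Prop) : (\forall p \ae leb3, P p) ->
  \forall x \ae leb, \forall y \ae leb, \forall z \ae leb, P (x, y, z).
Proof.
by move=> /(@ae_prod _ _ _ _ _ (@leb2 R) leb) /(@ae_prod _ _ _ _ _ leb leb).
Qed.

Lemma half_line (E : set (heis R)) v : measurable E -> monotone_along E v ->
  \forall z \ae leb3, E z ->
    (\forall s \ae leb, s < 0 -> E (hcurve z v s)) \/
    (\forall s \ae leb, 0 < s -> E (hcurve z v s)).
Proof.
move=> mE mon.
have := @monotone_along_between R E v `]-oo, 0[%classic `]0, +oo[%classic mE mon.
move=> /(_ _ _ _)/wrap[]; do ?exact: measurable_itv.
  by move=> a b /=; rewrite !in_itv /= andbT => -> ->.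
apply: filterS => z H /H [] aeE; [left|right]; apply: filterS aeE => s;
  by rewrite /= in_itv /= ?andbT.
Qed.

Definition box (p : heis R) (d : R) (z : heis R) :=
  [/\ `|ha z - ha p| < d, `|hb z - hb p| < d & `|hc z - hc p| < d].

Lemma hcurveX (a b c s : R) : hcurve (a, b, c) (1, 0) s = (a + s, b, c).
Proof. by rewrite /hcurve /hmul /hexp /ha /hb /hc /=; congr (_, _, _); ring. Qed.

(** With [a] the starting value, the coordinate c - a b has moved by [w ^+ 2 / 2] alone, whatever
    [r] is. *)
Lemma hcurveYW (a b c r w : R) :
  hcurve (hcurve (a, b, c) (0, 1) r) (1, 1) w =
  (a + w, b + r + w, c - a * b + w ^+ 2 / 2 + a * (b + r + w)).
Proof. by rewrite /hcurve /hmul /hexp /ha /hb /hc /=; congr (_, _, _); field. Qed.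

Lemma ae_cycle (Q : set (R3 R)) : measurable Q ->
  (\forall b \ae leb, \forall c \ae leb, \forall a \ae leb, Q (a, b, c)) <->
  (\forall a \ae leb, \forall b \ae leb, \forall c \ae leb, Q (a, b, c)).
Proof.
move=> mQ; pose Q' : set (R3 R) := [set q | Q (q.2, q.1.1, q.1.2)].
have mQ' : measurable Q'.
  by apply: (@measurable_preimT _ _ _ _ (fun q : R3 R => (q.2, q.1.1, q.1.2) : R3 R)); [mfun|].
apply: iff_trans (iff_sym (ae_leb3P mQ')) _.
apply: iff_trans (ae_prodP2 (@leb2 R) leb mQ') _.
have mQa a : measurable [set q : T * T | Q (a, q.1, q.2)].
  by apply: (@measurable_preimT _ _ _ _ (fun q : T * T => (a, q.1, q.2) : R3 R)); [mfun|].
have E a := ae_prodP leb leb (mQa a).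
by split; apply: filterS => a /E.
Qed.

(** Rational corners leave countably many rectangles, so that a single one will serve for a non-null
    set of slices. *)
Lemma sheared_rectangle (t q1 q2 q3 q4 : R) : q1 < q2 -> q3 < q4 ->
  exists k1 k2 k3 k4 : rat, [/\ ratr k1 < ratr k2 :> R, ratr k3 < ratr k4 :> R &
    forall b c, ratr k1 < b < ratr k2 -> ratr k3 < c < ratr k4 ->
      q1 < b < q2 /\ q3 < c - t * b < q4].
Proof.
move=> q12 q34; have t1 : 0 < 1 + `|t| by rewrite ltr_pwDl.
pose bm := (q1 + q2) / 2; pose cm := (q3 + q4) / 2 + t * bm.
pose r := Num.min ((q2 - q1) / 2) ((q4 - q3) / (2 * (1 + `|t|))).
have r0 : 0 < r by rewrite lt_min !divr_gt0 ?mulr_gt0 ?subr_gt0.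
have [r1 r2] : r <= (q2 - q1) / 2 /\ r * (1 + `|t|) <= (q4 - q3) / 2.
  split; first by rewrite ge_min lexx.
  rewrite -ler_pdivlMr //; rewrite ge_min; apply/orP; right.
  by rewrite invfM mulrA.
have near b c : `|b - bm| < r -> `|c - cm| < r -> q1 < b < q2 /\ q3 < c - t * b < q4.
  move=> bb cc; split.
    by move: bb; rewrite ltr_distl /bm => /andP[? ?]; apply/andP; split; lra.
  rewrite (_ : c - t * b = (q3 + q4) / 2 + ((c - cm) - t * (b - bm))); last first.
    by rewrite /cm; ring.
  have : `|(c - cm) - t * (b - bm)| < (q4 - q3) / 2.
    apply: lt_le_trans r2; apply: le_lt_trans (ler_normB _ _) _.
    by rewrite [ltRHS]mulrDr mulr1 normrM ltr_leD // mulrC ler_wpM2r // ltW.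
  by rewrite ltr_norml => /andP[? ?]; apply/andP; split; lra.
have [|k1] := @rat_in_itvoo R (bm - r) bm; first lra.
rewrite in_itv /= => /andP[k11 k12].
have [|k2] := @rat_in_itvoo R bm (bm + r); first lra.
rewrite in_itv /= => /andP[k21 k22].
have [|k3] := @rat_in_itvoo R (cm - r) cm; first lra.
rewrite in_itv /= => /andP[k31 k32].
have [|k4] := @rat_in_itvoo R cm (cm + r); first lra.
rewrite in_itv /= => /andP[k41 k42].
exists k1, k2, k3, k4; split; [lra|lra|] => b c /andP[? ?] /andP[? ?].
by apply: near; rewrite ltr_distl; apply/andP; split; lra.
Qed.

Lemma sheared_near (t d b c b' c' pb pc : R) : 0 < d ->
  `|b' - pb| < d -> `|c' + t * b' - pc| < d ->
  `|b' - b| < d / (1 + `|t|) -> `|c' - (c - t * b)| < d / (1 + `|t|) ->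
  `|b - pb| < 2 * d /\ `|c - pc| < 2 * d.
Proof.
move=> d0 Sb Sc bb cc; have t1 : 0 < 1 + `|t| by rewrite ltr_pwDl.
pose dl := d / (1 + `|t|); have dE : dl + `|t| * dl = d.
  by rewrite -[X in X + _]mul1r -mulrDl mulrC divfK ?gt_eqF.
have dl0 : 0 < dl by rewrite divr_gt0.
have tdl0 : 0 <= `|t| * dl by rewrite mulr_ge0 // ltW.
split.
  have -> : b - pb = (b' - pb) - (b' - b) by ring.
  apply: le_lt_trans (ler_normB _ _) _; rewrite -/dl in bb; lra.
have -> : c - pc = (c' + t * b' - pc) - ((c' - (c - t * b)) + t * (b' - b)) by ring.
apply: le_lt_trans (ler_normB _ _) _.
have : `|(c' - (c - t * b)) + t * (b' - b)| <= d.
  rewrite -dE; apply: le_trans (ler_normD _ _) _; apply: lerD; first exact: ltW.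
  by rewrite normrM ler_wpM2l // ltW.
lra.
Qed.

Lemma signed_half_line (F : R -> Prop) :
  (\forall s \ae leb, s < 0 -> F s) \/ (\forall s \ae leb, 0 < s -> F s) ->
  exists2 sg : R, sg = 1 \/ sg = -1 & \forall s \ae leb, 0 < s -> F (sg * s).
Proof.
move=> [] aeF; [exists (-1); first by right|exists 1; first by left].
  have N1 : (-1 : R) != 0 by rewrite oppr_eq0 oner_eq0.
  apply: filterS (ae_leb_affine 0 N1 aeF) => s + s0.
  by rewrite addr0; apply; rewrite mulN1r oppr_lt0.
by apply: filterS aeF => s + s0; rewrite mul1r; apply.
Qed.

(* From a point [z] of [F] in the slice [a = t], a half-line in the direction Y
   followed by half-lines in the direction X + Y stays in [F], hence avoids the
   cylinder [I x S] contained in its complement. Projected along X, and with the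
   coordinate [c - t b], the points that are reached are shadowed by [z]. *)
Lemma slice_rectangle (F : set (heis R)) (S : set (T * T)) (t i1 i2 d pb pc : R) :
  measurable S -> ~ (\forall b \ae leb, \forall c \ae leb, ~ S (b, c)) -> 0 < d ->
  (forall b c, S (b, c) -> `|b - pb| < d /\ `|c - pc| < d) -> i1 < t < i2 ->
  let HL v z := F z -> (\forall s \ae leb, s < 0 -> F (hcurve z v s)) \/
    (\forall s \ae leb, 0 < s -> F (hcurve z v s)) in
  (\forall b \ae leb, \forall c \ae leb, HL (0, 1) (t, b, c)) ->
  (\forall b \ae leb, \forall c \ae leb, \forall s \ae leb,
    HL (1, 1) (hcurve (t, b, c) (0, 1) s)) ->
  (\forall b \ae leb, \forall c \ae leb, \forall s \ae leb, \forall u \ae leb,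
    let z := hcurve (hcurve (t, b, c) (0, 1) s) (1, 1) u in
    i1 < ha z < i2 -> S (hb z, hc z) -> ~ F z) ->
  exists q1 q2 q3 q4 : rat, [/\ ratr q1 < ratr q2 :> R, ratr q3 < ratr q4 :> R,
    (forall b c, ratr q1 < b < ratr q2 -> ratr q3 < c < ratr q4 ->
      `|b - pb| < 2 * d /\ `|c - pc| < 2 * d) &
    \forall b \ae leb, \forall c \ae leb, ratr q1 < b < ratr q2 -> ratr q3 < c < ratr q4 ->
      ~ F (t, b, c)].
Proof.
move=> mS nS d0 Sp /andP[i1t ti2] HL HLY G2 G3.
pose S' : set (T * T) := [set q | S (q.2, q.1 + t * q.2)].
have mS' : measurable S'.
  by apply: (@measurable_preimT _ _ _ _ (fun q : T * T => (q.2, q.1 + t * q.2) : T * T)); [mfun|].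
(* Times along X + Y shorter than [eta] keep the first coordinate between [i1] and [i2]. *)
pose eta := Num.min (t - i1) (i2 - t).
have eta0 : 0 < eta by rewrite lt_min !subr_gt0 i1t.
have dl0 : 0 < d / (1 + `|t|) by rewrite divr_gt0 // ltr_pwDl.
have nS' : ~ (\forall c \ae leb, \forall b \ae leb, ~ S' (c, b)).
  move=> /(ae_swap (m1 := leb) (m2 := leb) (measurableC mS')) aeS; apply: nS.
  apply: filterS aeS => b /(ae_leb_shift (- (t * b))); apply: filterS => c.
  by rewrite /S' /= subrK.
have [q1 [q2 [q3 [q4 [q12 q34 free]]]]] := shadowed_free mS' eta0 dl0 nS'.
have [k1 [k2 [k3 [k4 [k12 k34 rect]]]]] := sheared_rectangle t q12 q34.
exists k1, k2, k3, k4; split => // [b c bk ck|].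
  have [bq cq] := rect _ _ bk ck.
  have [_ [c' [b' [/Sp[Sb Sc] bb cc]]]] := free _ _ bq cq.
  exact: (sheared_near d0 Sb Sc bb cc).
apply: filterS3 HLY G2 G3 => b; apply: filterS3 => c HLYz G2z G3z bk ck Fz.
have [bq cq] := rect _ _ bk ck; have [nsh _] := free _ _ bq cq; apply: nsh.
have [sg sgP aeY] := signed_half_line (HLYz Fz).
have sg0 : sg != 0 by case: sgP => ->; rewrite ?oppr_eq0 oner_eq0.
exists sg => //.
have G2s := ae_leb_affine 0 sg0 G2z; have G3s := ae_leb_affine 0 sg0 G3z.
apply: filterS3 aeY G2s G3s => s Fs; rewrite addr0 => HLW aeNs /andP[s0 _].
have [ep epP aeW'] := signed_half_line (HLW (Fs s0)).
have ep0 : ep != 0 by case: epP => ->; rewrite ?oppr_eq0 oner_eq0.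
exists ep => //.
have Nep := ae_leb_affine 0 ep0 aeNs.
apply: filterS2 aeW' Nep => u Fu; rewrite addr0 => Nu.
move=> /andP[u0 ueta] Su; move: (Fu u0); apply: Nu.
  rewrite hcurveYW /ha /=.
  have : `|ep * u| < eta.
    by rewrite normrM (gtr0_norm u0); case: epP => ->; rewrite ?normrN normr1 mul1r.
  rewrite lt_min !ltr_norml => /andP[/andP[e1 e2] /andP[e3 e4]].
  by apply/andP; split; move: e1 e4; clear; lra.
rewrite hcurveYW /hb /hc /=; move: Su; rewrite /S' /=.
have -> : (ep * u) ^+ 2 = u ^+ 2.
  by rewrite exprMn; case: epP => ->; rewrite ?sqrrN expr1n mul1r.
by [].
Qed.

Lemma itv_not_ae_empty (i1 i2 : R) : i1 < i2 -> ~ (\forall t \ae leb, ~ i1 < t < i2).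
Proof.
move=> i12 aeI; have : (leb `]i1, i2[%classic <= leb set0)%E.
  apply: le_lebesgue_ae; [exact: measurable_itv|exact: measurable0|].
  by apply: filterS aeI => t nt; rewrite /= in_itv /= => /nt.
rewrite measure0 lebesgue_measure_itv /= lte_fin i12 -EFinB lee_fin.
by apply/negP; rewrite -ltNge subr_gt0.
Qed.

(** One rational rectangle is good for a non-null set [G] of slices, and [G] nearly fills a window
    of width 6 H. A point outside [E] over the middle third of the window would start a half-line in
    the direction X outside [E]; it crosses one of the side thirds, where the slices in [G] belong
    to [E]. *)
Lemma slices_box (E : set (heis R)) (i1 i2 d : R) (p : heis R) :
  measurable E ->
  (\forall z \ae leb3, (~` E) z -> (\forall s \ae leb, s < 0 -> (~` E) (hcurve z (1, 0) s)) \/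
    (\forall s \ae leb, 0 < s -> (~` E) (hcurve z (1, 0) s))) ->
  0 < d -> i1 < i2 -> (forall t, i1 < t < i2 -> `|t - ha p| < d) ->
  (\forall t \ae leb, i1 < t < i2 -> exists q1 q2 q3 q4 : rat,
    [/\ ratr q1 < ratr q2 :> R, ratr q3 < ratr q4 :> R,
     (forall b c, ratr q1 < b < ratr q2 -> ratr q3 < c < ratr q4 ->
       `|b - hb p| < 2 * d /\ `|c - hc p| < 2 * d) &
     \forall b \ae leb, \forall c \ae leb, ratr q1 < b < ratr q2 -> ratr q3 < c < ratr q4 ->
       E (t, b, c)]) ->
  exists q e, [/\ 0 < e, forall z, box q e z -> box p (2 * d) z &
    \forall z \ae leb3, box q e z -> E z].
Proof.
move=> mE HL d0 i12 Ip slices.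
pose Q (q1 q2 q3 q4 : R) : set (R3 R) :=
  [set z | q1 < z.1.2 < q2 -> q3 < z.2 < q4 -> E z].
have mQ q1 q2 q3 q4 : measurable (Q q1 q2 q3 q4).
  rewrite (_ : Q _ _ _ _ = (fun z : R3 R => z.1.2) @^-1` (~` `]q1, q2[%classic) `|`
     ((fun z : R3 R => z.2) @^-1` (~` `]q3, q4[%classic) `|` E)).
    apply: measurableU; first by apply: measurable_preimT; [mfun|exact: measurableC].
    by apply: measurableU => //; apply: measurable_preimT; [mfun|exact: measurableC].
  apply/seteqP; split => z; rewrite /Q /= !in_itv /=; last by move=> [n /n|[n _ /n|Ez _ _]].
  move=> H; have [h1|h1] := pselect (q1 < z.1.2 < q2); last by left.
  have [h2|h2] := pselect (q3 < z.2 < q4); last by right; left.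
  by right; right; exact: H.
pose G q1 q2 q3 q4 : set T := `]i1, i2[%classic `&`
  [set t | \forall b \ae leb, \forall c \ae leb, Q q1 q2 q3 q4 (t, b, c)].
have mG q1 q2 q3 q4 : measurable (G q1 q2 q3 q4).
  apply: measurableI; first exact: measurable_itv.
  exact: (measurable_ae leb (measurable_ae leb (mQ q1 q2 q3 q4))).
have [q1 [q2 [q3 [q4 [[q12 q34 qp] nG]]]]] : exists q1 q2 q3 q4 : R, [/\ q1 < q2, q3 < q4 &
    forall b c, q1 < b < q2 -> q3 < c < q4 -> `|b - hb p| < 2 * d /\ `|c - hc p| < 2 * d] /\
    ~ (\forall t \ae leb, ~ G q1 q2 q3 q4 t).
  apply: contrapT => nq; apply: (itv_not_ae_empty i12).
  have aeG : \forall t \ae leb, forall q1 q2 q3 q4 : rat, [/\ ratr q1 < ratr q2 :> R,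
      ratr q3 < ratr q4 :> R & (forall b c, ratr q1 < b < ratr q2 -> ratr q3 < c < ratr q4 ->
        `|b - hb p| < 2 * d /\ `|c - hc p| < 2 * d)] ->
      ~ G (ratr q1) (ratr q2) (ratr q3) (ratr q4) t.
    apply: ae_countable => q1; apply: ae_countable => q2.
    apply: ae_countable => q3; apply: ae_countable => q4.
    have [hq|nhq] := pselect ([/\ ratr q1 < ratr q2 :> R,
      ratr q3 < ratr q4 :> R & (forall b c, ratr q1 < b < ratr q2 -> ratr q3 < c < ratr q4 ->
        `|b - hb p| < 2 * d /\ `|c - hc p| < 2 * d)]); last by apply: aeW => t /nhq.
    apply: contrapT => nGt; apply: nq; exists (ratr q1), (ratr q2), (ratr q3), (ratr q4).
    split => // aeG; apply: nGt; by apply: filterS aeG.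
  apply: filterS2 aeG slices => t nG H it; have [q1 [q2 [q3 [q4 [q12 q34 qp aeE]]]]] := H it.
  apply: (nG q1 q2 q3 q4); first by split.
  by split; rewrite /= ?in_itv.
have [m [h [h0 _ mh]]] := high_density_interval (mG q1 q2 q3 q4) nG ltr01 ltr01.
move: h0 mh; set H : R := ratr h; set P : R := ratr m => H0; set J := `]_, _[%classic => mJ.
(* The part of the window outside [G] has measure less than [H], so it cannot almost contain a
   subinterval of length [H]. *)
have half (j1 j2 : R) : P - 3 * H <= j1 -> j2 <= P + 3 * H -> j1 + H <= j2 ->
    ~ (\forall t \ae leb, j1 < t < j2 -> ~ G q1 q2 q3 q4 t).
  move=> h1 h2 h3 aeG; move: mJ; apply/negP; rewrite -leNgt mul1r.
  apply: (@le_trans _ _ (leb `]j1, j2[%classic)).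
    rewrite lebesgue_measure_itv /= lte_fin ifT; last lra.
    by rewrite -EFinB lee_fin; lra.
  apply: le_lebesgue_ae => //.
    by apply: measurableD => //; exact: measurable_itv.
  apply: filterS aeG => t nGt; rewrite /= in_itv /= => tj; split; last exact: nGt.
  by move: tj => /andP[tj1 tj2]; rewrite /J /= in_itv /= (le_lt_trans h1 tj1) (lt_le_trans tj2 h2).
have halfE (j1 j2 : R) : P - 3 * H <= j1 -> j2 <= P + 3 * H -> j1 + H <= j2 ->
    exists2 t, j1 < t < j2 & i1 < t < i2.
  move=> h1 h2 h3; apply: contrapT => nt; apply: (half j1 j2) => //.
  by apply: aeW => t tj [it _]; apply: nt; exists t => //; move: it; rewrite /= in_itv.
exists (P, (q1 + q2) / 2, (q3 + q4) / 2).
exists (Num.min H (Num.min ((q2 - q1) / 2) ((q4 - q3) / 2))).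
have inbox z : box (P, (q1 + q2) / 2, (q3 + q4) / 2)
    (Num.min H (Num.min ((q2 - q1) / 2) ((q4 - q3) / 2))) z ->
    [/\ P - H < ha z < P + H, q1 < hb z < q2 & q3 < hc z < q4].
  rewrite /box !lt_min => -[/andP[az _] /and3P[_ bz _] /and3P[_ _ cz]].
  have {}az : `|ha z - P| < H by exact: az.
  have {}bz : `|hb z - (q1 + q2) / 2| < (q2 - q1) / 2 by exact: bz.
  have {}cz : `|hc z - (q3 + q4) / 2| < (q4 - q3) / 2 by exact: cz.
  move: az bz cz; rewrite !ltr_distl => -> /andP[b1 b2] /andP[c1 c2].
  by split=> //; apply/andP; split; [move: b1|move: b2|move: c1|move: c2]; clear; lra.
split.
- by rewrite !lt_min H0 !divr_gt0 // subr_gt0.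
- move=> z /inbox[az bz cz]; have [bz' cz'] := qp _ _ bz cz; split => //.
  have [|||t1 t1J t1I] := halfE (P - 3 * H) (P - H); try by move: H0; clear; lra.
  have [|||t2 t2J t2I] := halfE (P + H) (P + 3 * H); try by move: H0; clear; lra.
  have azp : `|ha z - ha p| < d by apply: Ip; move: t1J t1I t2J t2I az; clear; lra.
  by move: azp d0; clear; lra.
have aeGE : \forall b \ae leb, \forall c \ae leb, \forall t \ae leb,
    [set z : R3 R | G q1 q2 q3 q4 z.1.1 -> Q q1 q2 q3 q4 z] (t, b, c).
  have mGE : measurable [set z : R3 R | G q1 q2 q3 q4 z.1.1 -> Q q1 q2 q3 q4 z].
    rewrite (_ : [set z | _] = (fun z : R3 R => z.1.1) @^-1` (~` G q1 q2 q3 q4) `|` Q q1 q2 q3 q4).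
      apply: measurableU => //; apply: measurable_preimT; first by mfun.
      exact: (measurableC (mG _ _ _ _)).
    apply/seteqP; split => z; last by move=> [n /n|Qz _].
    by move=> h'; have [Gz|nz] := pselect (G q1 q2 q3 q4 z.1.1); [right; exact: h'|left].
  apply/(ae_cycle mGE); apply: aeW => t.
  have [[it aeQ]|nG'] := pselect (G q1 q2 q3 q4 t).
    by apply: filterS aeQ => b; apply: filterS => c Qz _.
  by apply: aeW => b; apply: aeW => c /nG'.
have mB : measurable [set z : heis R | P - H < ha z < P + H -> Q q1 q2 q3 q4 z].
  rewrite (_ : [set z | _] = (fun z : R3 R => z.1.1) @^-1` (~` `](P - H), (P + H)[%classic)
     `|` Q q1 q2 q3 q4).
    by apply: measurableU => //; apply: measurable_preimT; [mfun|exact: measurableC].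
  apply/seteqP; split => z; rewrite /= in_itv /=; last by move=> [n /n|Qz _].
  by move=> h'; have [Gz|nz] := pselect (P - H < z.1.1 < P + H); [right; exact: h'|left].
suff : \forall z \ae leb3, [set z : heis R | P - H < ha z < P + H -> Q q1 q2 q3 q4 z] z.
  by apply: filterS => z Hz /inbox[az bz cz]; exact: Hz.
apply/(ae_leb3P mB); move/ae_leb3: HL; apply: filterS => a.
apply: filterS2 aeGE => b; apply: filterS2 => c aeE HL.
rewrite /= /ha /= => aP bq cq; apply: contrapT => nE.
have [aeF|aeF] := HL nE; move/(ae_leb_shift (- a)): aeF => aeF.
  apply: (half (P - 3 * H) (P - H)); try by move: H0; clear; lra.
  apply: filterS2 aeE aeF => t Et Ft /andP[_ tP] Gt; move: Ft.
  rewrite hcurveX subr_lt0 addrC subrK; apply; last exact: Et.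
  by move: aP tP; clear; lra.
apply: (half (P + H) (P + 3 * H)); try by move: H0; clear; lra.
apply: filterS2 aeE aeF => t Et Ft /andP[tP _] Gt; move: Ft.
rewrite hcurveX subr_gt0 addrC subrK; apply; last exact: Et.
by move: aP tP; clear; lra.
Qed.

Lemma frame_interior (E : set (heis R)) (p : heis R) (d : R) :
  measurable E -> monotone_along E (1, 0) -> monotone_along E (0, 1) ->
  monotone_along E (1, 1) -> 0 < d ->
  ~ (\forall z \ae leb3, box p d z -> ~ E z) ->
  exists q e, [/\ 0 < e, forall z, box q e z -> box p (2 * d) z &
    \forall z \ae leb3, box q e z -> E z].
Proof.
move=> mE monX monY monW d0 nE.
have mF : measurable (~` E) by exact: measurableC.
have HLXE := half_line mE monX.
have HLXF := half_line mF (monotone_alongC monX).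
have HLYF := half_line mF (monotone_alongC monY).
have HLWF := half_line mF (monotone_alongC monW).
have mbox : measurable (box p d).
  rewrite (_ : box p d = (`](ha p - d), (ha p + d)[%classic `*` `](hb p - d), (hb p + d)[%classic)
    `*` `](hc p - d), (hc p + d)[%classic).
    by apply: measurableX; [apply: measurableX|]; exact: measurable_itv.
  apply/seteqP; split => z /=; rewrite /box !in_itv /= !ltr_distl; first by move=> [].
  by move=> [[]].
pose I (i1 i2 : R) : set T := `]i1, i2[%classic.
pose S (i1 i2 : R) : set (T * T) := [set q | [/\ `|q.1 - hb p| < d, `|q.2 - hc p| < d &
  \forall t \ae leb, I i1 i2 t -> E (t, q.1, q.2)]].
(* Almost every point of [E] in the box starts a half-line in the direction X within [E], which
   covers a rational interval of first coordinates still inside the box. If all the sets [S] for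
   these countably many intervals were null, so would be [E] in the box. *)
have [i1 [i2 [i12 Ip nS]]] : exists i1 i2 : R, [/\ i1 < i2,
    (forall t, i1 < t < i2 -> `|t - ha p| < d) &
    ~ (\forall b \ae leb, \forall c \ae leb, ~ S i1 i2 (b, c))].
  apply: contrapT => nS; apply: nE.
  have aeS : \forall b \ae leb, \forall c \ae leb, forall i1 i2 : rat,
      ratr i1 < ratr i2 :> R -> ha p - d < ratr i1 -> ratr i2 < ha p + d ->
      ~ S (ratr i1) (ratr i2) (b, c).
    have : \forall b \ae leb, forall i1 i2 : rat, \forall c \ae leb,
        ratr i1 < ratr i2 :> R -> ha p - d < ratr i1 -> ratr i2 < ha p + d ->
        ~ S (ratr i1) (ratr i2) (b, c).
      apply: ae_countable => i1; apply: ae_countable => i2.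
      have [i12|] := pselect (ratr i1 < ratr i2 :> R); last first.
        by move=> ni; apply: aeW => b; apply: aeW => c /ni.
      have [i1p|] := pselect (ha p - d < ratr i1); last first.
        by move=> ni; apply: aeW => b; apply: aeW => c _ /ni.
      have [i2p|] := pselect (ratr i2 < ha p + d); last first.
        by move=> ni; apply: aeW => b; apply: aeW => c _ _ /ni.
      apply: contrapT => nSi; apply: nS; exists (ratr i1), (ratr i2); split => //.
        move=> t; rewrite ltr_distl => /andP[t1 t2].
        by apply/andP; split; move: t1 t2 i1p i2p; clear; lra.
      move=> aeS; apply: nSi; apply: filterS aeS => b; apply: filterS => c nSbc _ _ _.
      exact: nSbc.
    by apply: filterS => b Hb; apply: ae_countable => i1; apply: ae_countable => i2.
  have mQ : measurable [set z | box p d z -> ~ E z].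
    rewrite (_ : [set z | _] = ~` (box p d) `|` ~` E).
      by apply: measurableU; exact: measurableC.
    apply/seteqP; split => z /=; last by move=> [nb /nb|].
    by move=> H; have [bz|nb] := pselect (box p d z); [right; exact: H|left].
  apply/(ae_leb3P mQ); move/ae_leb3: HLXE; apply: filterS => a.
  apply: filterS2 aeS => b; apply: filterS2 => c nSbc HL.
  rewrite /box /= => -[ap bp cp] Eabc.
  have : `|a - ha p| < d by exact: ap.
  rewrite ltr_distl => /andP[ap1 ap2].
  have fin i1 i2 : ratr i1 < ratr i2 :> R -> ha p - d < ratr i1 -> ratr i2 < ha p + d ->
      (\forall t \ae leb, ratr i1 < t < ratr i2 -> E (t, b, c)) -> False.
    move=> h1 h2 h3 aeE; by apply: (nSbc i1 i2 h1 h2 h3); split.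
  case: (HL Eabc) => [/(ae_leb_shift (- a)) aeE|/(ae_leb_shift (- a)) aeE].
    have [//|i1] := @rat_in_itvoo R (ha p - d) a.
    rewrite in_itv /= => /andP[i1p i1a].
    have [//|i2] := @rat_in_itvoo R (ratr i1) a; rewrite in_itv /= => /andP[i12 i2a].
    apply: (fin i1 i2) => //; first by move: i2a ap2; clear; lra.
    apply: filterS aeE => t + /andP[_ ti2]; rewrite hcurveX subr_lt0 addrC subrK; apply.
    by apply: lt_trans i2a.
  have [//|i2] := @rat_in_itvoo R a (ha p + d).
  rewrite in_itv /= => /andP[i2a i2p].
  have [//|i1] := @rat_in_itvoo R a (ratr i2); rewrite in_itv /= => /andP[i1a i12].
  apply: (fin i1 i2) => //; first by move: i1a ap1; clear; lra.
  apply: filterS aeE => t + /andP[i1t _]; rewrite hcurveX subr_gt0 addrC subrK; apply.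
  exact: lt_trans i1t.
have mI : measurable (I i1 i2) by exact: measurable_itv.
have mS : measurable (S i1 i2).
  have mQ : measurable [set q : (T * T) * T | I i1 i2 q.2 -> E (q.2, q.1.1, q.1.2)].
    rewrite (_ : [set q | _] = snd @^-1` (~` I i1 i2) `|`
        ((fun q : (T * T) * T => (q.2, q.1.1, q.1.2) : heis R) @^-1` E)).
      apply: measurableU; apply: measurable_preimT => //; [exact: measurableC|mfun].
    apply/seteqP; split => q; last by move=> [nq /nq|H _].
    by move=> H; have [Iq|nq] := pselect (I i1 i2 q.2); [right; exact: H|left].
  rewrite (_ : S i1 i2 = (`](hb p - d), (hb p + d)[%classic `*` `](hc p - d), (hc p + d)[%classic)
      `&` [set q : T * T | \forall t \ae leb, I i1 i2 t -> E (t, q.1, q.2)]).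
    apply: measurableI; last exact: (measurable_ae leb mQ).
    by apply: measurableX; exact: measurable_itv.
  apply/seteqP; split => q; rewrite /S /= !in_itv /= !ltr_distl; first by move=> [].
  by move=> [[]].
(* The near inclusion of the cylinder in [E], written as a property of points, can be transported
   along Y and X + Y by [ae_hcurve]. *)
pose N : set (heis R) := [set z | I i1 i2 z.1.1 -> S i1 i2 (z.1.2, z.2) -> E z].
have mN : measurable N.
  rewrite (_ : N = ((fun z : heis R => z.1.1 : T) @^-1` (~` I i1 i2)) `|`
     (((fun z : heis R => (z.1.2, z.2) : T * T) @^-1` (~` S i1 i2)) `|` E)).
    apply: measurableU; first by apply: measurable_preimT; [mfun|exact: measurableC].
    by apply: measurableU => //; apply: measurable_preimT; [mfun|exact: measurableC].
  apply/seteqP; split => z; last by move=> [n /n|[n _ /n|Ez _ _]].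
  move=> H; have [Iz|nz] := pselect (I i1 i2 z.1.1); last by left.
  have [Sz|nz] := pselect (S i1 i2 (z.1.2, z.2)); last by right; left.
  by right; right; exact: H.
have aeN : \forall z \ae leb3, N z.
  apply/(ae_leb3P mN)/(ae_cycle mN); apply: aeW => b; apply: aeW => c.
  have [Sbc|nS'] := pselect (S i1 i2 (b, c)); last by apply: aeW => a _ /nS'.
  by case: Sbc => _ _; apply: filterS => a H Ia _; exact: H.
have G2 := ae_hcurve (0, 1) HLWF.
have G3 := ae_hcurve (0, 1) (ae_hcurve (1, 1) aeN).
have Sp b c : S i1 i2 (b, c) -> `|b - hb p| < d /\ `|c - hc p| < d by move=> [].
have slices : \forall t \ae leb, i1 < t < i2 -> exists q1 q2 q3 q4 : rat,
    [/\ ratr q1 < ratr q2 :> R, ratr q3 < ratr q4 :> R,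
     (forall b c, ratr q1 < b < ratr q2 -> ratr q3 < c < ratr q4 ->
       `|b - hb p| < 2 * d /\ `|c - hc p| < 2 * d) &
     \forall b \ae leb, \forall c \ae leb, ratr q1 < b < ratr q2 -> ratr q3 < c < ratr q4 ->
       ~ (~` E) (t, b, c)].
  move: (ae_leb3 HLYF) (ae_leb3 G2) (ae_leb3 G3); apply: filterS3 => t HLY G2t G3t it.
  apply: (slice_rectangle mS nS d0 Sp it HLY G2t).
  apply: filterS G3t => b; apply: filterS => c; apply: filterS => s; apply: filterS => u.
  by move=> H i12' S12; apply; apply: H.
apply: (slices_box mE HLXF d0 i12 Ip).
apply: filterS slices => t slice it.
have [q1 [q2 [q3 [q4 [q12 q34 qp aeE]]]]] := slice it.
exists q1, q2, q3, q4; split => //; apply: filterS aeE => b; apply: filterS => c H bq cq.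
by apply: contrapT; exact: H.
Qed.
End interior_points.

Ltac cfun :=
  lazymatch goal with
  | |- continuous_at _ _ => rewrite /continuous_at; cfun
  | |- cvg_to ?F _ =>
    let G := lazymatch F with nbhs ?G => G | _ => F end in
    lazymatch G with
    | fmap (fun x => (@?f x, @?g x)) _ => apply: (cvg_pair (G := nbhs _) (H := nbhs _)); cfun
    | fmap (fun x => - @?f x) _ => apply: cvgN; cfun
    | fmap (fun x => @?f x + @?g x) _ => apply: cvgD; cfun
    | fmap (fun x => @?f x * @?g x) _ => apply: cvgM; cfun
    | fmap (fun x => fst (@?f x)) _ =>
      first [exact: cvg_fst | apply: (cvg_comp f fst); [cfun|exact: cvg_fst]]
    | fmap (fun x => snd (@?f x)) _ =>
      first [exact: cvg_snd | apply: (cvg_comp f snd); [cfun|exact: cvg_snd]]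
    | fmap (fun x => x) _ => exact: cvg_id
    | _ => first [exact: cvg_cst | exact: cvg_fst | exact: cvg_snd | idtac]
    end
  end.

Section continuity.
Context {R : realType}.
Notation H := (R^o * R^o * R^o)%type.

Lemma box_continuous (f : H -> H) (p : H) (d : R) : {for p, continuous f} -> 0 < d ->
  exists2 e, 0 < e & forall z, box p e z -> box (f p) d (f z).
Proof.
move=> cf d0; have /cf : nbhs (f p) (box (f p) d).
  apply/nbhs_ballP; exists d => // z [[/= h1 h2] h3].
  by move: h1 h2 h3; rewrite /ball /= !(distrC (f p).1.1) => h1 h2 h3; split; rewrite // distrC.
move=> /nbhs_ballP[e e0 eB]; exists e => // z [h1 h2 h3]; apply: eB.
by split; [split|] => /=; rewrite /ball /= distrC.
Qed.

End continuity.

(** * Automorphisms, and interior points for almost every slope *)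

Section shear.
Context {R : realType}.
Notation leb := (@lebesgue_measure R).
Notation leb3 := (@leb3 R).
Implicit Types (m : R) (z p : heis R) (E : set (heis R)).

Definition ess_interior E p : Prop :=
  exists2 e, 0 < e & \forall z \ae leb3, box p e z -> E z.

Lemma box_self p (e : R) : 0 < e -> box p e p.
Proof. by move=> e0; split; rewrite subrr normr0. Qed.

(* The automorphisms of the group that map X to X + mY and fix Y, respectively
   map Y to mX + Y and fix X. *)
Definition shearX m z : heis R := (ha z, hb z + m * ha z, hc z + m * (ha z * ha z) / 2).
Definition shearY m z : heis R := (ha z + m * hb z, hb z, hc z + m * (hb z * hb z) / 2).

Lemma shearXK m : cancel (shearX m) (shearX (- m)).
Proof. by move=> [[a b] c]; rewrite /shearX /ha /hb /hc /=; congr (_, _, _); ring. Qed.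

Lemma shearYK m : cancel (shearY m) (shearY (- m)).
Proof. by move=> [[a b] c]; rewrite /shearY /ha /hb /hc /=; congr (_, _, _); ring. Qed.

Lemma shearX_hcurve m z v s :
  shearX m (hcurve z v s) = hcurve (shearX m z) (v.1, v.2 + m * v.1) s.
Proof.
by rewrite /shearX /hcurve /hmul /hexp /ha /hb /hc /=; congr (_, _, _); field.
Qed.

Lemma shearY_hcurve m z v s :
  shearY m (hcurve z v s) = hcurve (shearY m z) (v.1 + m * v.2, v.2) s.
Proof.
by rewrite /shearY /hcurve /hmul /hexp /ha /hb /hc /=; congr (_, _, _); field.
Qed.

Lemma ae_shearX m (P : heis R -> Prop) :
  (\forall p \ae leb3, P p) -> \forall p \ae leb3, P (shearX m p).
Proof.
move=> aeP.
have := @ae_leb3_triangular R 0 (fun x => m * x) (fun x _ => m * (x * x) / 2) P _ aeP.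
move=> /(_ _)/wrap[]; first by mfun.
by apply: filterS => z; rewrite addr0.
Qed.

Lemma ae_shearY m (P : heis R -> Prop) :
  (\forall p \ae leb3, P p) -> \forall p \ae leb3, P (shearY m p).
Proof.
move=> /ae_leb3_swap aeP.
have := @ae_leb3_triangular R 0 (fun x => m * x) (fun x _ => m * (x * x) / 2)
  (fun p => P (p.1.2, p.1.1, p.2)) _ aeP.
move=> /(_ _)/wrap[]; first by mfun.
move=> /ae_leb3_swap; apply: filterS => z /=; by rewrite addr0.
Qed.

Lemma continuous_shearX m : continuous (shearX m : R^o * R^o * R^o -> R^o * R^o * R^o).
Proof. by move=> z; rewrite /shearX /ha /hb /hc; cfun. Qed.

Lemma continuous_shearY m : continuous (shearY m : R^o * R^o * R^o -> R^o * R^o * R^o).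
Proof. by move=> z; rewrite /shearY /ha /hb /hc; cfun. Qed.

(** This automorphism sends X, Y and X + Y to X + m Y, X + (m + 1) Y and 2 X + (2 m + 1) Y,
    directions of slopes [m], [m + 1] and [m + 2^-1]. *)
Definition frame m z := shearX m (shearY 1 z).
Definition frameV m z := shearY (- 1) (shearX (- m) z).

Lemma frameK m : cancel (frame m) (frameV m).
Proof. by move=> z; rewrite /frame /frameV shearXK shearYK. Qed.

Lemma frameVK m : cancel (frameV m) (frame m).
Proof.
move=> z; rewrite /frame /frameV.
by rewrite -{1}[1]opprK shearYK -{1}[m]opprK shearXK.
Qed.

Lemma continuous_frame m : continuous (frame m : R^o * R^o * R^o -> R^o * R^o * R^o).
Proof.
by move=> z; apply: continuous_comp; [exact: continuous_shearY|exact: continuous_shearX].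
Qed.

Lemma continuous_frameV m : continuous (frameV m : R^o * R^o * R^o -> R^o * R^o * R^o).
Proof.
by move=> z; apply: continuous_comp; [exact: continuous_shearX|exact: continuous_shearY].
Qed.

Lemma measurable_frame m : measurable_fun setT (frame m).
Proof. by rewrite /frame /shearX /shearY /ha /hb /hc /=; mfun. Qed.

Lemma monotone_along_scale E (r : R) v : r != 0 -> monotone_along E v ->
  monotone_along E (r * v.1, r * v.2).
Proof.
move=> r0; apply: filterS => z /(monotoneR_aff 0 r0).
suff -> : hcurve z (r * v.1, r * v.2) @^-1` E =
  (fun t => r * t + 0) @^-1` (hcurve z v @^-1` E) by [].
apply/funext => t; rewrite /preimage /=; congr E.
by rewrite /hcurve /=; congr (hmul _ (hexp _)); congr (_, _); ring.
Qed.

Lemma monotone_along_frame E m v :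
  monotone_along E (v.1 + v.2, v.2 + m * (v.1 + v.2)) ->
  monotone_along (frame m @^-1` E) v.
Proof.
move=> /(ae_shearX m)/(ae_shearY 1); apply: filterS => z.
suff -> : hcurve z v @^-1` (frame m @^-1` E) =
  hcurve (frame m z) (v.1 + v.2, v.2 + m * (v.1 + v.2)) @^-1` E by [].
by apply/funext => t; rewrite /preimage /= /frame shearY_hcurve shearX_hcurve /= mul1r.
Qed.

(** For almost every [m] the three slopes of [frame m] are good. The frame is a homeomorphism that
    respects null sets, so [frame_interior] for the preimage gives the result for [E]. *)
Lemma ess_interior_near E p (d : R) : measurable E ->
  (\forall m \ae leb, monotone_along E (1, m)) ->
  (forall e, 0 < e -> ~ (\forall z \ae leb3, box p e z -> ~ E z)) -> 0 < d ->
  exists2 q, box p d q & ess_interior E q.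
Proof.
move=> mE monE nE d0.
have [m [mX mY mW]] : exists m, [/\ monotone_along E (1, m), monotone_along E (1, m + 1)
    & monotone_along E (1, m + 2^-1)].
  apply: ae_leb_ex; have := ae_leb_shift 2^-1 monE; have := ae_leb_shift 1 monE.
  by move: monE; apply: filterS3 => m; split.
pose E' : set (heis R) := frame m @^-1` E.
have mE' : measurable E' by apply: measurable_preimT mE; exact: measurable_frame.
have [d' d'0 d'P] := box_continuous (@continuous_frame m (frameV m p)) d0.
rewrite frameVK in d'P.
have d'2 : 0 < d' / 2 by rewrite divr_gt0.
have [e0 e00 e0P] := box_continuous (@continuous_frameV m p) d'2.
have [|||||q [e [e_gt0 qp Eq]]] := @frame_interior R E' (frameV m p) (d' / 2) mE'.
- by apply: monotone_along_frame; rewrite /= addr0 add0r mulr1.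
- by apply: monotone_along_frame; rewrite /= add0r mulr1 addrC.
- apply: monotone_along_frame.
  have e1 : 2 * 1 = 1 + 1 :> R by ring.
  have e2 : 2 * (m + 2^-1) = 1 + m * (1 + 1) :> R by field.
  have := @monotone_along_scale E 2 (1, m + 2^-1); rewrite /= e1 e2 => H.
  by apply: H; [rewrite pnatr_eq0|exact: mW].
- exact: d'2.
- move=> /(ae_shearY (- 1))/(ae_shearX (- m)) aeE; apply: (nE e0 e00).
  apply: filterS aeE => z; rewrite -/(frameV m z) => H /e0P/H.
  by rewrite /E' /= frameVK.
exists (frame m q).
  by apply: d'P; have := qp _ (box_self q e_gt0); rewrite mulrC divfK.
have [e1 e10 e1P] := box_continuous (@continuous_frameV m (frame m q)) e_gt0.
exists e1 => //; move: Eq => /(ae_shearY (- 1))/(ae_shearX (- m)); apply: filterS => z.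
by rewrite -/(frameV m z) frameK in e1P * => H /e1P/H; rewrite /E' /= frameVK.
Qed.
End shear.

(** * Convexity of the interior along horizontal lines *)

Section ess_interior_convexity.
Context {R : realType}.
Notation leb := (@lebesgue_measure R).
Notation leb3 := (@leb3 R).
Implicit Types (E G : set (heis R)) (r : heis R) (v : R * R).

Lemma box_hcurve r v (s e : R) : 0 < e -> exists2 d, 0 < d &
  forall r' v' s', box r d r' -> `|v'.1 - v.1| < d -> `|v'.2 - v.2| < d -> `|s' - s| < d ->
    box (hcurve r v s) e (hcurve r' v' s').
Proof.
move=> e0; pose H := (R^o * R^o * R^o)%type.
pose f (w : H * H) : H := hcurve w.1 (w.2.1.1, w.2.1.2) w.2.2.
have cf : continuous f.
  by move=> w; rewrite /f /hcurve /hmul /hexp /ha /hb /hc /=; cfun.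
have fE r' v' s' : f (r', (v'.1, v'.2, s')) = hcurve r' v' s' by case: v'.
have /(cf (r, (v.1, v.2, s))) : nbhs (f (r, (v.1, v.2, s))) (box (hcurve r v s) e).
  apply/nbhs_ballP; exists e => // z [[h1 h2] h3].
  by rewrite fE in h1 h2 h3; split; rewrite distrC.
move=> /nbhs_ballP[d d0 dB]; exists d => // r' v' s' [h1 h2 h3] k1 k2 k3.
rewrite -[X in box X]fE -fE; apply: dB.
by split; (split; [split|]); rewrite /ball /= distrC.
Qed.

(** A set of slopes of full measure is dense; a [v] with first component 0 is tilted first so that
    it has a slope. *)
Lemma good_direction E v (d : R) : (\forall m \ae leb, monotone_along E (1, m)) -> 0 < d ->
  exists v', [/\ monotone_along E v', `|v'.1 - v.1| < d & `|v'.2 - v.2| < d].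
Proof.
move=> monE d0.
have [l l0 lv] : exists2 l, l != 0 & `|l - v.1| < d.
  have [v10|v10] := eqVneq v.1 0; last by exists v.1 => //; rewrite subrr normr0.
  exists (d / 2); first by rewrite gt_eqF // divr_gt0.
  by rewrite v10 subr0 gtr0_norm ?divr_gt0 //; lra.
have dl : 0 < d / `|l| by rewrite divr_gt0 // normr_gt0.
have [m mP mon] : exists2 m, v.2 / l - d / `|l| < m < v.2 / l + d / `|l| & monotone_along E (1, m).
  apply: contrapT => nm; apply: (@itv_not_ae_empty R (v.2 / l - d / `|l|) (v.2 / l + d / `|l|)).
    by lra.
  by apply: filterS monE => m mon mP; apply: nm; exists m.
exists (l, l * m); split => //=.
  by have := monotone_along_scale l0 mon; rewrite mulr1.
move: mP; rewrite -ltr_distl ltr_pdivlMr ?normr_gt0 // -normrM.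
by rewrite mulrBl divfK // mulrC.
Qed.

(** The lines through points near [r], in a good direction near [v], cross the boxes almost filled
    by [E] and [G] at times near [s1] and [s2]. For almost every such point both alternatives of
    [pat] fail, so the point is in [E]. *)
Lemma ess_interior_fill E G r v (s1 s2 d : R) : 0 < d ->
  (\forall m \ae leb, monotone_along E (1, m)) ->
  (forall v', monotone_along E v' -> \forall z \ae leb3, (~` E) z ->
    (\forall s \ae leb, s1 - d < s < s1 + d -> (~` E) (hcurve z v' s)) \/
    (\forall s \ae leb, s2 - d < s < s2 + d -> (~` G) (hcurve z v' s))) ->
  ess_interior E (hcurve r v s1) -> ess_interior G (hcurve r v s2) -> ess_interior E r.
Proof.
move=> d0 monE pat [e1 e10 aeE] [e2 e20 aeG].
have [d1 d10 near1] := box_hcurve r v s1 e10.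
have [d2 d20 near2] := box_hcurve r v s2 e20.
pose d3 := Num.min d (Num.min d1 d2).
have d30 : 0 < d3 by rewrite !lt_min d0 d10.
have d3P x : x < d3 -> [/\ x < d, x < d1 & x < d2] by rewrite !lt_min => /and3P.
have [v' [mon /d3P[_ v11 v12] /d3P[_ v21 v22]]] := good_direction v monE d30.
exists d3 => //; move: (pat _ mon) (ae_hcurve v' aeE) (ae_hcurve v' aeG).
apply: filterS3 => z patz aeEz aeGz [/d3P[_ a1 a2] /d3P[_ b1 b2] /d3P[_ c1 c2]].
have nempty (s : R) : ~ (\forall t \ae leb, ~ s - d3 < t < s + d3).
  by apply: itv_not_ae_empty; lra.
apply: contrapT => nEz; case: (patz nEz) => aeF.
- apply: (nempty s1); apply: filterS2 aeF aeEz => t Ft Et; rewrite -ltr_distl.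
  move=> /d3P[t0 t1 t2]; apply: Ft; first by rewrite -ltr_distl.
  by apply: Et; apply: near1.
- apply: (nempty s2); apply: filterS2 aeF aeGz => t Ft Et; rewrite -ltr_distl.
  move=> /d3P[t0 t1 t2]; apply: Ft; first by rewrite -ltr_distl.
  by apply: Et; apply: near2.
Qed.

Lemma ess_interior_between E r v (s1 s2 : R) : measurable E ->
  (\forall m \ae leb, monotone_along E (1, m)) -> s1 < 0 < s2 ->
  ess_interior E (hcurve r v s1) -> ess_interior E (hcurve r v s2) -> ess_interior E r.
Proof.
move=> mE monE /andP[s10 s20].
have d0 : 0 < Num.min (- s1) s2 by rewrite lt_min oppr_gt0 s10.
have [d1 d2] : Num.min (- s1) s2 <= - s1 /\ Num.min (- s1) s2 <= s2.
  by rewrite !ge_min !lexx orbT.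
apply: (ess_interior_fill d0 monE) => v' mon.
have := @monotone_along_between R (~` E) v'
  `](s1 - Num.min (- s1) s2), (s1 + Num.min (- s1) s2)[%classic
  `](s2 - Num.min (- s1) s2), (s2 + Num.min (- s1) s2)[%classic.
move=> /(_ (measurableC mE) (monotone_alongC mon) (measurable_itv _) (measurable_itv _)).
move=> /(_ _)/wrap[].
  move=> a b /=; rewrite !in_itv /= => /andP[_ a1] /andP[b1 _]; apply/andP; split; lra.
by apply: filterS => z H /H [] aeE; [left|right]; apply: filterS aeE => s; rewrite /= in_itv.
Qed.

Lemma ess_interior_beyond E r v (s1 s2 : R) : measurable E ->
  (\forall m \ae leb, monotone_along E (1, m)) -> (0 < s1 < s2) || (s2 < s1 < 0) ->
  ess_interior E (hcurve r v s1) -> ess_interior (~` E) (hcurve r v s2) -> ess_interior E r.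
Proof.
(* Intervals of this radius around [s1] and [s2] are disjoint, and the first avoids 0. *)
move=> mE monE s12; pose d := Num.min `|s1| (`|s2 - s1| / 2).
have d0 : 0 < d.
  rewrite lt_min normr_gt0; apply/andP; split.
    by case/orP: s12 => /andP[h1 h2]; [rewrite gt_eqF|rewrite lt_eqF].
  rewrite divr_gt0 // normr_gt0 subr_eq0.
  by case/orP: s12 => /andP[h1 h2]; [rewrite gt_eqF|rewrite lt_eqF].
have [d1 d2] : d <= `|s1| /\ d <= `|s2 - s1| / 2 by rewrite /d !ge_min !lexx orbT.
apply: (ess_interior_fill d0 monE) => v' mon.
have := @monotone_along_beyond R (~` E) v'
  `](s1 - d), (s1 + d)[%classic `](s2 - d), (s2 + d)[%classic.
move=> /(_ (measurableC mE) (monotone_alongC mon) (measurable_itv _) (measurable_itv _)).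
move=> /(_ _)/wrap[].
  move=> a b /=; rewrite !in_itv /= => /andP[a0 a1] /andP[b0 b1].
  case/orP: s12 => /andP[h1 h2]; [left|right]; apply/andP.
    move: d1 d2; rewrite !gtr0_norm ?subr_gt0 //; split; lra.
  move: d1 d2; rewrite !ltr0_norm ?subr_lt0 //; split; lra.
by apply: filterS => z H /H [] aeE; [left|right]; apply: filterS aeE => s; rewrite /= in_itv.
Qed.
End ess_interior_convexity.

(** * Cones additive along a symplectic form *)

Section symplectic_cone.
Context {R : realType} {V : normedModType R} (om : V -> V -> R) (M : R).
Context (omD : forall x y z, om (x + y) z = om x z + om y z)
  (omZ : forall a x z, om (a *: x) z = a * om x z)
  (omC : forall x y, om y x = - om x y)
  (M_gt0 : 0 < M) (omM : forall x y, `|om x y| <= M * `|x| * `|y|)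
  (om_nondeg : forall e, e != 0 -> exists f, om e f = 1)
  (om_perp : forall y z, om y z != 0 -> exists u1 u2,
    [/\ om u1 y = 0, om u1 z = 0, om u2 y = 0, om u2 z = 0 & om u1 u2 != 0]).
Context (C : V -> Prop)
  (C_open : forall x, C x -> exists2 r, 0 < r & forall y, `|y - x| < r -> C y)
  (CZ : forall a x, 0 < a -> C x -> C (a *: x))
  (CN : forall x, C x -> ~ C (- x))
  (C_cover : forall x, ~ C x -> forall r, 0 < r -> exists2 y, `|y - x| < r & C (- y))
  (CD : forall x y, C x -> C y -> om x y = 0 -> C (x + y)).

Let omDr x y z : om x (y + z) = om x y + om x z.
Proof. by rewrite omC omD opprD -!(omC _ x). Qed.

Let omZr a x z : om x (a *: z) = a * om x z.
Proof. by rewrite omC omZ -mulrN -omC. Qed.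

Let omNl x y : om (- x) y = - om x y.
Proof. by rewrite -scaleN1r omZ mulN1r. Qed.

Let omNr x y : om x (- y) = - om x y.
Proof. by rewrite -scaleN1r omZr mulN1r. Qed.

Let omxx x : om x x = 0.
Proof. have := omC x x; lra. Qed.

Ltac slra := clear -om omD omZ omC M_gt0 omM om_nondeg om_perp C_open CZ CN C_cover CD
  omDr omZr omNl omNr omxx; lra.

Local Notation omE := (omD, omDr, omZ, omZr, omNl, omNr, omxx).

(** [C] and its opposite are open and disjoint, so the supremum of the parameters in [C] belongs to
    neither. *)
Lemma cone_path_exit (g : R -> V) K a b : a <= b -> 0 <= K ->
  (forall s t, `|g s - g t| <= K * `|s - t|) -> C (g a) -> C (- g b) ->
  exists t, ~ C (g t) /\ ~ C (- g t).
Proof.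
move=> ab K0 gK Ca Cb; apply: contrapT => /forallNP noexit.
have dich t : C (g t) \/ C (- g t).
  have := noexit t; rewrite not_andP => -[/contrapT|/contrapT]; by [left|right].
pose A := [set t | a <= t <= b /\ C (g t)].
have Aa : A a by split => //; rewrite lexx.
have supA : has_sup A by split; [exists a|exists b => t [/andP[]]].
have K1 : 0 < K + 1 by rewrite ltr_wpDl.
have as_ : a <= sup A by apply: ub_le_sup => //; case: supA.
have sb : sup A <= b by apply: ge_sup; [exists a|move=> t [/andP[]]].
have near r s t : 0 < r -> `|s - t| < r / (K + 1) -> `|g s - g t| < r.
  move=> r0 st; apply: le_lt_trans (gK _ _) _.
  apply: (@le_lt_trans _ _ ((K + 1) * `|s - t|)); first by rewrite ler_wpM2r // lerDl.
  by rewrite mulrC -ltr_pdivlMr.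
case: (dich (sup A)) => [Cs|Cs].
- have [sb'|bs] := ltP (sup A) b; last first.
    have e : sup A = b by apply/eqP; rewrite eq_le sb bs.
    by apply: (CN Cs); rewrite e.
  have [r r0 Cr] := C_open Cs.
  have rK : 0 < r / (K + 1) by rewrite divr_gt0.
  pose t := Num.min b (sup A + r / (K + 1) / 2).
  have st : sup A < t by rewrite lt_min sb' ltrDl divr_gt0.
  have : A t.
    split; first by rewrite (le_trans as_ (ltW st)) ge_min lexx.
    apply/Cr/near => //; rewrite ger0_norm; last by rewrite subr_ge0 ltW.
    have : t <= sup A + r / (K + 1) / 2 by rewrite ge_min lexx orbT.
    lra.
  by move=> /(ub_le_sup (proj2 supA)); rewrite leNgt st.
- have [r r0 Cr] := C_open Cs.
  have rK : 0 < r / (K + 1) by rewrite divr_gt0.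
  have [t At tA] := sup_adherent rK supA.
  have ts := ub_le_sup (proj2 supA) At.
  case: At => _ /CN; apply; apply: Cr.
  rewrite -opprD normrN; apply: near => //.
  rewrite distrC ger0_norm ?subr_ge0 //; lra.
Qed.

(* Along the transversal [f] through [e], the separation [om c d] of two points
   of the cone and of its opposite is comparable to their distance. *)
Lemma separated_pair e f : om e f = 1 -> ~ C e -> ~ C (- e) ->
  exists2 k, 0 < k & forall eta, 0 < eta -> exists c d,
    [/\ C c, C (- d), `|c - e| < eta, `|d - e| < eta & k * `|c - d| <= `|om c d|].
Proof.
move=> ef nCe nCNe.
(* [L] is such that L del / 2, the least gain from moving along [f], equals the possible error M B
   del plus the [del] to be kept. *)
pose B := `|e| + 1; pose L := 2 * M * B + 2.
have B0 : 0 < B by rewrite ltr_wpDl.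
have L0 : 0 < L by rewrite addr_gt0 // !mulr_gt0.
have f0 : 0 <= `|f| by [].
have P0 : 0 < L * `|f| + 1 by rewrite ltr_wpDl // mulr_ge0 // ltW.
exists (L * `|f| + 1)^-1; first by rewrite invr_gt0.
move=> eta eta0.
have f1 : 0 < `|f| + 1 by rewrite ltr_wpDl.
pose mn := Num.min (Num.min eta 1) (2 * M * (`|f| + 1))^-1.
have mn0 : 0 < mn by rewrite /mn !lt_min eta0 ltr01 invr_gt0 !mulr_gt0.
have mnP x : `|x - e| < mn -> [/\ `|x - e| < eta, `|x| <= B & 1 / 2 <= om x f].
  rewrite /mn !lt_min => /andP[/andP[xe xe1] xe2]; split => //.
    by have := ler_normD (x - e) e; rewrite subrK /B; lra.
  have : `|om (x - e) f| <= 1 / 2.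
    apply: le_trans (omM _ _) _.
    apply: (@le_trans _ _ (M * `|x - e| * (`|f| + 1))).
      by rewrite ler_wpM2l ?mulr_ge0 // ?ltW //; lra.
    move: (ltW xe2); rewrite -[X in _ <= X]div1r ler_pdivlMr ?mulr_gt0 //; lra.
  have -> : om x f = 1 + om (x - e) f by rewrite !omE ef; lra.
  by rewrite ler_norml; lra.
have Lf0 : 0 <= L * `|f| by rewrite mulr_ge0 // ltW.
(* Keeps all points used below, up to distance [del] from [m], within [mn] of [e]. *)
pose eta' := mn / (2 * (L * `|f|) + 4).
have Q0 : 0 < 2 * (L * `|f|) + 4 by lra.
have eta'0 : 0 < eta' by rewrite divr_gt0.
have eta'E : eta' * (2 * (L * `|f|) + 4) = mn by rewrite /eta' divfK // gt_eqF.
have eta'1 : 0 <= eta' * (L * `|f|) by rewrite mulr_ge0 // ltW.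
have [c ce Cc] : exists2 c, `|c - e| < eta' & C c.
  have [y ye Cy] := C_cover nCNe eta'0.
  by exists (- y) => //; rewrite -opprD normrN -[e]opprK.
have [d de Cd] := C_cover nCe eta'0.
pose del := `|c - d|.
have del_le : del < 2 * eta'.
  rewrite /del (_ : c - d = (c - e) - (d - e)); last by rewrite opprB addrA subrK.
  apply: le_lt_trans (ler_normB _ _) _; lra.
have del0 : 0 < del.
  rewrite normr_gt0 subr_eq0; apply/eqP => cd; apply: (CN Cc); rewrite cd //.
(* If [m] is in [C], the pair is [m], [d]. Otherwise a point [m'] within [del] of [m] has its
   opposite in [C], and the pair is [c], [m']. Either way the displacement along [f] dominates
   [om]. *)
pose m := c + (L * del) *: f.
have mc : `|m - c| = L * `|f| * del.
  by rewrite /m addrAC subrr add0r normrZ gtr0_norm ?mulr_gt0 // mulrAC.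
have farm y : `|y - m| <= del -> `|y - e| < mn.
  move=> ym; rewrite (_ : y - e = (y - m) + (m - c) + (c - e)); last first.
    by rewrite !subrKA.
  apply: le_lt_trans (ler_normD _ _) _.
  apply: le_lt_trans (lerD (ler_normD _ _) (lexx _)) _.
  rewrite mc -eta'E.
  have : L * `|f| * del <= L * `|f| * (2 * eta') by rewrite ler_wpM2l // ltW.
  lra.
have [ceta cB cf] : [/\ `|c - e| < eta, `|c| <= B & 1 / 2 <= om c f] by apply: mnP; lra.
have [deta _ _] : [/\ `|d - e| < eta, `|d| <= B & 1 / 2 <= om d f] by apply: mnP; lra.
have omdel x y : `|x| <= B -> `|y| <= del -> om x y <= M * B * del.
  move=> xB ydel; apply: le_trans (ler_norm _) _; apply: le_trans (omM _ _) _.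
  by rewrite -!mulrA ler_pM2l // ler_pM.
have fin x y : `|x - y| <= L * `|f| * del + del -> del <= `|om x y| ->
    (L * `|f| + 1)^-1 * `|x - y| <= `|om x y|.
  move=> xy; apply: le_trans; rewrite mulrC ler_pdivrMr //; lra.
have big x : 1 / 2 <= om x f -> M * B * del + del <= L * del * om x f.
  move=> xf; apply: (@le_trans _ _ (L * del * (1 / 2))).
    rewrite /L; lra.
  by rewrite ler_wpM2l // ltW // mulr_gt0.
have [Cm|nCm] := pselect (C m).
  have [meta mB mf] : [/\ `|m - e| < eta, `|m| <= B & 1 / 2 <= om m f].
    by apply/mnP/farm; rewrite subrr normr0 ltW.
  exists m, d; split => //; apply: fin.
    rewrite (_ : m - d = (m - c) + (c - d)); last by rewrite subrKA.
    by rewrite -mc; exact: ler_normD.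
  rewrite -normrN; apply: le_trans (ler_norm _).
  have -> : - om m d = L * del * om m f - om m (d - c).
    have := omxx m; rewrite [in X in om m X]/m !omE; lra.
  have := omdel m (d - c) mB; rewrite distrC lexx => /(_ isT).
  have := big _ mf; lra.
have [m' m'm Cm'] := C_cover nCm del0.
have [m'eta m'B _] : [/\ `|m' - e| < eta, `|m'| <= B & 1 / 2 <= om m' f].
  by apply/mnP/farm; rewrite ltW.
exists c, m'; split => //; apply: fin.
  rewrite -mc (_ : c - m' = - ((m - c) + (m' - m))); last first.
    by rewrite -[LHS]opprB; congr (- _); rewrite [RHS]addrC subrKA.
  by rewrite normrN; apply: le_trans (ler_normD _ _) _; rewrite lerD2l ltW.
apply: le_trans (ler_norm _).
have -> : om c m' = L * del * om c f - om c (m - m').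
  have := omxx c; rewrite /m !omE; lra.
have := omdel c (m - m') cB; rewrite distrC ltW // => /(_ isT).
have := big _ cf; lra.
Qed.

Lemma quadratic_pos_root (A B G : R) : 0 < A -> 0 < G ->
  exists2 T, 0 < T & A + B * T - G * T ^+ 2 = 0.
Proof.
move=> A0 G0; pose D := B ^+ 2 + 4 * A * G.
have D0 : 0 <= D by rewrite addr_ge0 ?sqr_ge0 // ltW // !mulr_gt0.
have sD : Num.sqrt D ^+ 2 = D by rewrite sqr_sqrtr.
have BD : `|B| < Num.sqrt D.
  by rewrite -sqrtr_sqr ltr_sqrt ?ltrDl ?ltr_pwDr ?sqr_ge0 ?mulr_gt0.
exists ((B + Num.sqrt D) / (2 * G)).
  rewrite divr_gt0 ?mulr_gt0 //; have := ler_norm (- B); rewrite normrN; lra.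
have E : (B + Num.sqrt D) ^+ 2 = 2 * B * (B + Num.sqrt D) + 4 * A * G.
  by rewrite sqrrD sD /D; ring.
by rewrite exprMn E; field; rewrite gt_eqF.
Qed.

Lemma near0_lt K e : 0 < e -> \forall t \near (0 : R)^'+, K * t < e.
Proof.
move=> e0; have K0 : 0 < `|K| + 1 by rewrite ltr_wpDl.
near=> t; have t0 : 0 < t by near: t; exact: nbhs_right_gt.
have te : t < e / (`|K| + 1) by near: t; apply: nbhs_right_lt; rewrite divr_gt0.
move: te; rewrite ltr_pdivlMr //; apply: le_lt_trans.
by rewrite mulrC ler_wpM2l ?ltW //; have := ler_norm K; lra.
Unshelve. all: by end_near. Qed.

(** For [y'] orthogonal to [c] and [z'] to [d], the vectors [y' + T *: c] and [z' - T *: d] are in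
    [C]. They are orthogonal when [T] is a root of a quadratic with extreme coefficients [om y' z']
    and [- om c d]; if [om y z] and [om c d] had the same sign, there would be a positive root. The
    sum of the two vectors is then close to [y + z], whose opposite is in [C]. *)
Lemma no_triple_aux e f y z k : om e f = 1 -> om y e = 0 -> om z e = 0 ->
  C y -> C z -> C (- (y + z)) -> om y z != 0 -> 0 < k ->
  \forall eta \near (0 : R)^'+, forall c d, C c -> C (- d) ->
    `|c - e| < eta -> `|d - e| < eta -> k * `|c - d| <= `|om c d| ->
    ~ 0 < om y z * om c d.
Proof.
move=> ef ye ze Cy Cz Cx al0 k0.
have [r r0 [yr zr xr]] : exists2 r, 0 < r & [/\ forall w, `|w - y| < r -> C w,
    forall w, `|w - z| < r -> C w & forall w, `|w - - (y + z)| < r -> C w].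
  have [r1 r10 h1] := C_open Cy; have [r2 r20 h2] := C_open Cz.
  have [r3 r30 h3] := C_open Cx.
  exists (Num.min r1 (Num.min r2 r3)); first by rewrite !lt_min r10 r20 r30.
  by split=> w; rewrite !lt_min => /and3P[? ? ?]; [exact: h1|exact: h2|exact: h3].
pose Y := `|y| + `|z| + 1; pose al := `|om y z|; pose ep := r / 4.
have Y1 : 1 <= Y by rewrite /Y lerDr addr_ge0.
have MY0 : 0 < M * Y by rewrite mulr_gt0 // (lt_le_trans ltr01).
have al0' : 0 < al by rewrite normr_gt0.
have ep0 : 0 < ep by rewrite divr_gt0.
near=> eta.
have eta0 : 0 < eta by near: eta; exact: nbhs_right_gt.
have h1 : (M * `|f|) * eta < 1 / 2 by near: eta; apply: near0_lt; lra.
have h2 : (2 * (M * Y) * `|f|) * eta < ep by near: eta; exact: near0_lt.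
have h3 : (2 * (M * Y) * `|f|) * eta < 1 by near: eta; exact: near0_lt.
have h4 : (2 * (M * Y) * (2 * (M * Y) * `|f|)) * eta < al / 2.
  by near: eta; apply: near0_lt; lra.
have h5 : (2 * (2 * al / ep + 2 * (M * Y))) * eta < k * ep.
  by near: eta; apply: near0_lt; rewrite mulr_gt0.
move=> c d Cc Cd ce de kcd sgn.
have omf w : `|w - e| < eta -> 1 / 2 <= om w f.
  move=> we; have -> : om w f = 1 + om (w - e) f by rewrite !omE ef; slra.
  have : `|om (w - e) f| <= 1 / 2.
    apply: le_trans (omM _ _) _; apply: le_trans (ltW h1).
    by rewrite mulrAC ler_wpM2l ?mulr_ge0 // ltW.
  by rewrite ler_norml => /andP[]; slra.
have sbnd w v : om w e = 0 -> `|w| <= Y -> `|v - e| < eta ->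
    `|om w v / om f v| <= 2 * (M * Y) * eta.
  move=> we wY ve; have vf := omf v ve.
  rewrite normrM normfV (omC v f) normrN (ger0_norm (_ : 0 <= om v f)); last by have := vf; slra.
  rewrite ler_pdivrMr; last by have := vf; slra.
  have h : `|om w v| <= M * Y * eta.
    have -> : om w v = om w (v - e) by rewrite !omE we; slra.
    apply: le_trans (omM _ _) _; apply: ler_pM => //; last exact: ltW.
      by rewrite mulr_ge0 // ltW.
    by rewrite ler_pM2l.
  apply: (le_trans h); rewrite -[leLHS]mulr1 -mulrA.
  have : 0 <= M * Y * eta by rewrite ltW // mulr_gt0.
  move=> p0; have := ler_wpM2l p0 vf; slra.
(* Subtracting these multiples of [f] produces the two orthogonalities; they are O(eta) because [y]
   and [z] are orthogonal to [e]. *)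
pose s1 := om y c / om f c; pose s2 := om z d / om f d.
have yY : `|y| <= Y by rewrite /Y -addrA lerDl addr_ge0.
have zY : `|z| <= Y by rewrite /Y addrAC lerDr addr_ge0.
have s1b : `|s1| <= 2 * (M * Y) * eta by exact: sbnd.
have s2b : `|s2| <= 2 * (M * Y) * eta by exact: sbnd.
have sfb s : `|s| <= 2 * (M * Y) * eta -> `|s *: f| < ep /\ `|s *: f| < 1.
  move=> sb; have h : `|s *: f| <= 2 * (M * Y) * `|f| * eta.
    by rewrite normrZ mulrAC ler_wpM2r.
  by split; apply: le_lt_trans h _.
have [s1e s11] := sfb _ s1b; have [s2e s21] := sfb _ s2b.
pose y' := y - s1 *: f; pose z' := z - s2 *: f.
have y'c : om y' c = 0.
  rewrite /y' !omE /s1 divfK ?subrr // omC oppr_eq0; have := omf c ce.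
  by apply: contraTneq => ->; rewrite -ltNge; slra.
have z'd : om z' d = 0.
  rewrite /z' !omE /s2 divfK ?subrr // omC oppr_eq0; have := omf d de.
  by apply: contraTneq => ->; rewrite -ltNge; slra.
have y'y : `|y' - y| < ep by rewrite /y' addrAC subrr add0r normrN.
have z'z : `|z' - z| < ep by rewrite /z' addrAC subrr add0r normrN.
have y'Y : `|y'| <= Y.
  apply: le_trans (ler_normB _ _) _; rewrite /Y.
  by have := normr_ge0 z; have := s11; slra.
have z'Y : `|z'| <= Y.
  apply: le_trans (ler_normB _ _) _; rewrite /Y.
  by have := normr_ge0 y; have := s21; slra.
have albnd : `|om y' z' - om y z| < al / 2.
  have -> : om y' z' - om y z = - s2 * om y f - s1 * om f z by rewrite /y' /z' !omE; ring.
  have b1 w s : `|s| <= 2 * (M * Y) * eta -> `|w| <= Y ->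
      `|s * om w f| <= (2 * (M * Y) * eta) * ((M * Y) * `|f|).
    move=> sb wY; rewrite normrM; apply: ler_pM => //.
    by apply: le_trans (omM _ _) _; rewrite ler_wpM2r // ler_pM2l.
  have := b1 y _ s2b yY; have := b1 z _ s1b zY => b2 b3.
  rewrite (omC z f) mulrN opprK.
  apply: le_lt_trans (ler_normD _ _) _; rewrite mulNr normrN.
  by have := b2; have := b3; have := h4; slra.
clearbody y' z'.
(* The linear coefficient [be] is O(del), because [om y' c] and [om z' d] vanish. *)
pose del := `|c - d|; pose be := om c z' - om y' d; pose ga := om c d.
have del_ge0 : 0 <= del by exact: normr_ge0.
have beb : `|be| <= 2 * (M * Y) * del.
  have -> : be = om (c - d) z' + om y' (c - d).
    by rewrite /be !omE y'c (omC z' d) z'd; ring.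
  apply: le_trans (ler_normD _ _) _.
  have := omM (c - d) z'; have := omM y' (c - d); rewrite -/del.
  have : M * del * `|z'| <= M * Y * del by rewrite mulrAC ler_wpM2r ?ler_pM2l.
  have : M * `|y'| * del <= M * Y * del by rewrite ler_wpM2r ?ler_pM2l.
  slra.
have ga0 : ga != 0 by apply: contraTneq sgn => g0; rewrite -/ga g0 mulr0 ltxx.
have del0 : 0 < del.
  rewrite normr_gt0 subr_eq0; apply/eqP => cd; apply: (CN Cc); rewrite cd //.
have deleta : del < 2 * eta.
  rewrite /del (_ : c - d = (c - e) - (d - e)); last by rewrite opprB addrA subrK.
  apply: le_lt_trans (ler_normB _ _) _; have := ce; have := de; slra.
have [T T0 TE] : exists2 T, 0 < T & om y' z' + be * T - ga * T ^+ 2 = 0.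
  have [ga_gt|ga_le] := ltP 0 ga.
    apply: quadratic_pos_root => //.
    move: sgn; rewrite pmulr_lgt0 // => sgn; move: albnd.
    rewrite /al (gtr0_norm sgn) ltr_norml => /andP[]; have := sgn; slra.
  have ga_lt : ga < 0 by rewrite lt_neqAle ga0.
  have [||T T0 TE] := @quadratic_pos_root (- om y' z') (- be) (- ga).
  - move: sgn; rewrite nmulr_lgt0 // => sgn; move: albnd.
    rewrite /al (ltr0_norm sgn) ltr_norml => /andP[]; have := sgn; slra.
  - by rewrite oppr_gt0.
  by exists T => //; have := TE; slra.
(* If T del were at least ep, the equation for [T] and |ga| >= k del would give k T del <= del (2 al
   / ep + 2 M Y), too small for this [eta]. *)
have Tdel : T * del < ep.
  rewrite ltNge; apply/negP => Tep.
  have e1 : k * del * T ^+ 2 <= 2 * al + 2 * (M * Y) * del * T.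
    apply: (@le_trans _ _ (`|ga| * T ^+ 2)); first by rewrite ler_wpM2r ?sqr_ge0.
    have -> : `|ga| * T ^+ 2 = `|om y' z' + be * T|.
      rewrite (_ : om y' z' + be * T = ga * T ^+ 2); last by have := TE; slra.
      by rewrite normrM (ger0_norm (sqr_ge0 T)).
    apply: le_trans (ler_normD _ _) _; apply: lerD.
      have := ler_normD (om y' z' - om y z) (om y z); rewrite subrK -/al.
      by have := albnd; have := al0'; slra.
    by rewrite normrM (gtr0_norm T0) ler_wpM2r // ltW.
  have e2 : 2 * al <= 2 * al / ep * (T * del).
    by rewrite mulrAC ler_pdivlMr // ler_pM2l // mulr_gt0.
  have Td0 : 0 < T * del by rewrite mulr_gt0.
  have e3 : k * (T * del) <= del * (2 * al / ep + 2 * (M * Y)).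
    rewrite -(ler_pM2r Td0).
    apply: (@le_trans _ _ (del * (k * del * T ^+ 2))).
      by rewrite le_eqVlt (_ : _ * _ == _) //; apply/eqP; ring.
    apply: (@le_trans _ _ (del * (2 * al + 2 * (M * Y) * del * T))).
      by rewrite ler_pM2l.
    rewrite -[leRHS]mulrA ler_pM2l // [leRHS]mulrDl; have := e2; slra.
  have e4 : k * ep <= k * (T * del) by rewrite ler_pM2l.
  have e5 : del * (2 * al / ep + 2 * (M * Y)) <= 2 * eta * (2 * al / ep + 2 * (M * Y)).
    rewrite ler_wpM2r ?(ltW deleta) //.
    by apply/ltW/addr_gt0; [apply: divr_gt0 => //; exact: mulr_gt0|exact: mulr_gt0].
  have := e3; have := e4; have := e5; have := h5; slra.
have Ca : C (y' + T *: c).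
  apply: CD; [apply: yr; have := y'y; have := r0; rewrite /ep; slra|exact: CZ|].
  by rewrite omZr y'c mulr0.
have Cb : C (z' + T *: (- d)).
  apply: CD; [apply: zr; have := z'z; have := r0; rewrite /ep; slra|exact: CZ|].
  by rewrite omZr omNr z'd oppr0 mulr0.
have ab0 : om (y' + T *: c) (z' + T *: (- d)) = 0.
  rewrite !omDr !omD !omZr !omZ !omNr -[RHS]TE /be -/ga; ring.
have := CD Ca Cb ab0; rewrite -[_ + _]opprK; apply: CN; apply: xr.
have -> : - (y' + T *: c + (z' + T *: - d)) - - (y + z) =
    - ((y' - y) + (z' - z) + T *: (c - d)).
  rewrite opprK [LHS]addrC -opprB; congr (- _).
  by rewrite scalerBr scalerN addrACA [y' - y + _]addrACA -opprD [LHS]addrAC.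
rewrite normrN; apply: le_lt_trans (ler_normD _ _) _.
apply: le_lt_trans (lerD (ler_normD _ _) (lexx _)) _.
rewrite normrZ (gtr0_norm T0) -/del.
by have := y'y; have := z'z; have := Tdel; have := r0; rewrite /ep; slra.
Unshelve. all: by end_near. Qed.

Lemma cone_no_triple y z : C y -> C z -> ~ C (- (y + z)).
Proof.
move=> Cy Cz Cx; have [yz0|yz0] := eqVneq (om y z) 0.
  by apply: (CN Cx); rewrite opprK; exact: CD.
have [u1 [u2 [u1y u1z u2y u2z u12]]] := om_perp yz0.
(* Unless [u1] itself serves, [e] is found on a path from [- u1] to [u1] inside the orthogonal of
   [y] and [z]. The path avoids 0 because [om u1 u2] does not vanish. *)
have [e [e0 ey ez nCe nCNe]] : exists e,
    [/\ e != 0, om e y = 0, om e z = 0, ~ C e & ~ C (- e)].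
  wlog Cu1 : u1 u1y u1z u12 / C (- u1).
    move=> H; have [Cu|nCNu] := pselect (C (- u1)); first exact: (H u1).
    have [Cu|nCu] := pselect (C u1).
      by apply: (H (- u1)); rewrite ?opprK // omNl ?u1y ?u1z ?oppr0 // oppr_eq0.
    exists u1; split => //; apply: contraNneq u12 => ->.
    by rewrite -(scale0r 0) omZ mul0r.
  pose g t := t *: u1 + (1 - `|t|) *: u2.
  have [||s t|||t [nC1 nC2]] := @cone_path_exit g (`|u1| + `|u2|) (- 1) 1.
  - lra.
  - by rewrite addr_ge0.
  - rewrite (_ : g s - g t = (s - t) *: u1 + (`|t| - `|s|) *: u2); last first.
      rewrite /g opprD addrACA -!scalerBl; congr (_ + _ *: _); ring.
    rewrite mulrDl; apply: le_trans (ler_normD _ _) _.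
    rewrite !normrZ mulrC [X in _ + X <= _]mulrC lerD2l ler_wpM2l //.
    by rewrite (distrC s); exact: ler_dist_dist.
  - by rewrite /g normrN1 subrr scale0r addr0 scaleN1r.
  - by rewrite /g normr1 subrr scale0r addr0 scale1r.
  exists (g t); split => //; last 2 first.
  - by rewrite /g omD !omZ u1y u2y !mulr0 addr0.
  - by rewrite /g omD !omZ u1z u2z !mulr0 addr0.
  apply: contraNneq u12 => g0.
  have : om (g t) u2 = 0 by rewrite g0 -(scale0r 0) omZ mul0r.
  have : om (g t) u1 = 0 by rewrite g0 -(scale0r 0) omZ mul0r.
  rewrite /g !omE !mulr0 add0r addr0 => /eqP; rewrite mulf_eq0 (omC u1) oppr_eq0.
  move=> /orP[/eqP t1 /eqP|//]; rewrite mulf_eq0 => /orP[/eqP t0|//].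
  by move: t1; rewrite t0 normr0 subr0 => /eqP; rewrite oner_eq0.
have [f ef] := om_nondeg e0.
have [k k0 pairs] := separated_pair ef nCe nCNe.
have ye : om y e = 0 by rewrite omC ey oppr0.
have ze : om z e = 0 by rewrite omC ez oppr0.
have Cx' : C (- (z + y)) by rewrite addrC.
have zy0 : om z y != 0 by rewrite omC oppr_eq0.
(* The sign of [om c d] is not under control; exchanging [y] and [z] covers both signs. *)
have H1 := no_triple_aux ef ye ze Cy Cz Cx yz0 k0.
have H2 := no_triple_aux ef ze ye Cz Cy Cx' zy0 k0.
near ((0 : R)^'+) => eta.
have eta0 : 0 < eta by near: eta; exact: nbhs_right_gt.
have [c [d [Cc Cd ce de cd]]] := pairs _ eta0.
have cd0 : om c d != 0.
  apply: contraTneq cd => ->; rewrite normr0 -ltNge mulr_gt0 // normr_gt0 subr_eq0.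
  by apply/eqP => cd; apply: (CN Cc); rewrite cd.
have N1 : ~ 0 < om y z * om c d by move: c d Cc Cd ce de cd {cd0}; near: eta.
have N2 : ~ 0 < om z y * om c d by move: c d Cc Cd ce de cd {N1 cd0}; near: eta.
have : om y z * om c d != 0 by rewrite mulf_neq0.
rewrite neq_lt => /orP[neg|//]; apply: N2.
by rewrite omC mulNr oppr_gt0.
Unshelve. all: by end_near. Qed.

(** If [x + y] is outside [C], some nearby [w] has [- w] in [C]; then [w - y], which is close to
    [x], and [y] and [- w] form a triple of sum 0. *)
Lemma cone_convex x y : C x -> C y -> C (x + y).
Proof.
move=> Cx Cy; apply: contrapT => nC.
have [r r0 xr] := C_open Cx.
have [w wxy Cw] := C_cover nC r0.
have Cx' : C (w - y) by apply: xr; rewrite -addrA -opprD (addrC y).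
by apply: (cone_no_triple Cx' Cy); rewrite subrK.
Qed.

(** The vectors in neither [C] nor its opposite form a subspace [N], which every line parallel to a
    fixed [c0] in [C] meets once; [phi] is the coordinate along [c0] modulo [N]. *)
Lemma cone_half_space : exists phi : V -> R,
  [/\ forall x y, phi (x + y) = phi x + phi y,
      forall a x, phi (a *: x) = a * phi x &
      forall x, C x <-> 0 < phi x].
Proof.
pose N x := ~ C x /\ ~ C (- x).
have [c0 Cc0] : exists c, C c.
  have [C0|nC0] := pselect (C 0); first by exists 0.
  by have [y _ Cy] := C_cover nC0 ltr01; exists (- y).
(* [- n] is a limit of points [y] with [- y] in [C], so [c + n] is the sum of a point near [c] and
   [- y]. *)
have C_N c n : C c -> N n -> C (c + n).
  move=> Cc [_ nC]; have [r r0 cr] := C_open Cc.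
  have [y yn Cy] := C_cover nC r0.
  rewrite (_ : c + n = (c + n + y) + - y); last by rewrite addrK.
  apply: cone_convex => //; apply: cr.
  by rewrite addrC !addrA addNr add0r addrC -[n]opprK.
have NN n : N n -> N (- n) by move=> [n1 n2]; split; rewrite ?opprK.
have ND m n : N m -> N n -> N (m + n).
  have H m' n' : N m' -> N n' -> ~ C (m' + n').
    move=> Nm Nn /C_N /(_ (NN _ Nn)); rewrite addrK; exact: Nm.1.
  move=> Nm Nn; split; first exact: H.
  by rewrite opprD; apply: H; exact: NN.
have NZ a n : N n -> N (a *: n).
  have H b n' : 0 < b -> N n' -> N (b *: n').
    move=> b0 [n1 n2]; have b1 : 0 < b^-1 by rewrite invr_gt0.
    split=> /(CZ b1); rewrite -?scalerN scalerA mulVf ?gt_eqF // scale1r //.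
  move=> Nn; have [a0|a0|->] := ltgtP a 0; last first.
  - rewrite scale0r; split; last rewrite oppr0; move=> C0; apply: (CN C0);
    by rewrite oppr0.
  - exact: H.
  - by rewrite -[a]opprK scaleNr; apply/NN/H => //; rewrite oppr_gt0.
(* For large [b], openness at [c0] and homogeneity put [b *: c0 + v] and [b *: c0 - v] in [C], so
   the line leaves both cones in between. *)
have Ndec v : exists t, N (v - t *: c0).
  have [r r0 cr] := C_open Cc0.
  pose b := (`|v| + 1) / r; have b0 : 0 < b by rewrite divr_gt0 // ltr_wpDl.
  have bC w : `|w| <= `|v| -> C (w + b *: c0).
    move=> wv; have -> : w + b *: c0 = b *: (c0 + b^-1 *: w).
      by rewrite scalerDr scalerA mulfV ?gt_eqF // scale1r addrC.
    apply: CZ => //; apply: cr; rewrite addrAC subrr add0r normrZ.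
    rewrite gtr0_norm ?invr_gt0 // /b invf_div mulrC mulrA ltr_pdivrMr ?ltr_wpDl //.
    by rewrite mulrC ltr_pM2l //; lra.
  have [||s t|||t ?] := @cone_path_exit (fun t => v - t *: c0) `|c0| (- b) b; last by exists t.
  - by rewrite ge0_cp // ltW.
  - by [].
  - rewrite /= opprB addrC subrKA -scalerBl normrZ distrC mulrC //.
  - by rewrite /= scaleNr opprK; apply: bC.
  - by rewrite /= opprB addrC; apply: bC; rewrite normrN.
have Nc0 a : N (a *: c0) -> a = 0.
  move=> Na; apply/eqP; apply: contraT => a0.
  by have [] := NZ a^-1 _ Na; rewrite scalerA mulVf // scale1r.
have [phi Nphi] := choice Ndec.
have phiE v t : N (v - t *: c0) -> phi v = t.
  move=> Nt; apply/eqP; rewrite -subr_eq0; apply/eqP/Nc0.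
  rewrite (_ : _ *: _ = (v - t *: c0) + - (v - phi v *: c0)).
    exact: ND (NN _ (Nphi v)).
  by rewrite opprB [RHS]addrC subrKA -scalerBl.
exists phi; split.
- move=> x y; apply: phiE; rewrite scalerDl opprD addrACA; exact: ND.
- move=> a x; apply: phiE; rewrite -scalerA -scalerBr; exact: NZ.
- move=> x; have pos y : 0 < phi y -> C y.
    by move=> py; rewrite -[y](subrK (phi y *: c0)) addrC; apply: C_N => //; exact: CZ.
  split=> [Cx|]; last exact: pos.
  rewrite ltNge le_eqVlt; apply/negP => /orP[/eqP p0|pneg].
    by have := Nphi x; rewrite p0 scale0r subr0 => -[].
  apply: (CN Cx); apply: pos.
  suff -> : phi (- x) = - phi x by rewrite oppr_gt0.
  by apply: phiE; rewrite scaleNr -opprD; exact: NN.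
Qed.
End symplectic_cone.

(** * The cone of a monotone set *)

Section symplectic_form.
Context {R : realType}.
Notation V := (R^o * R^o * R^o * R^o)%type.
Implicit Types x y z e : V.

(* In the exponential coordinates [(a, b, c - a b / 2)] the horizontal lines are
   the affine lines [x y] with [om x y = 0] once [(a, b, g)] is embedded in the
   projective space as [(a, b, g, 1)]. *)
Definition om x y : R :=
  x.2 * y.1.2 - y.2 * x.1.2 - (x.1.1.1 * y.1.1.2 - x.1.1.2 * y.1.1.1) / 2.

Lemma omD x y z : om (x + y) z = om x z + om y z.
Proof. by rewrite /om /=; ring. Qed.

Lemma omZ (a : R) x z : om (a *: x) z = a * om x z.
Proof. by rewrite /om /= /GRing.scale /=; ring. Qed.

Lemma omC x y : om y x = - om x y.
Proof. by rewrite /om; ring. Qed.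

Lemma norm4 x : [/\ `|x.1.1.1| <= `|x|, `|x.1.1.2| <= `|x|, `|x.1.2| <= `|x| & `|x.2| <= `|x|].
Proof.
by split; rewrite !prod_normE /= !le_max ?lexx ?orbT.
Qed.

Lemma norm4_lt x (r : R) : `|x.1.1.1| < r -> `|x.1.1.2| < r -> `|x.1.2| < r ->
  `|x.2| < r -> `|x| < r.
Proof. by rewrite !prod_normE /= !gt_max => -> -> -> ->. Qed.

Lemma om_bound x y : `|om x y| <= 3 * `|x| * `|y|.
Proof.
have [xa xb xg xw] := norm4 x; have [ya yb yg yw] := norm4 y.
have b (s t : R) : `|s| <= `|x| -> `|t| <= `|y| -> `|s * t| <= `|x| * `|y|.
  by move=> sx ty; rewrite normrM ler_pM.
rewrite /om; apply: le_trans (ler_normB _ _) _.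
apply: le_trans (lerD (ler_normB _ _) (lexx _)) _.
have h1 := b _ _ xw yg; have h2 := b _ _ xg yw.
have h3 : `|(x.1.1.1 * y.1.1.2 - x.1.1.2 * y.1.1.1) / 2| <= `|x| * `|y|.
  rewrite normrM normfV (ger0_norm (_ : 0 <= 2)) // ler_pdivrMr //.
  apply: le_trans (ler_normB _ _) _.
  by have := b _ _ xa yb; have := b _ _ xb ya; lra.
by rewrite [y.2 * _]mulrC; move: h1 h2 h3; lra.
Qed.

Lemma om_nondeg e : e != 0 -> exists f, om e f = 1.
Proof.
case: e => [[[a b] g] w] e0.
have [w0|w0] := eqVneq w 0; last first.
  by exists (0, 0, w^-1, 0); rewrite /om /=; field.
have [g0|g0] := eqVneq g 0; last first.
  by exists (0, 0, 0, - g^-1); rewrite /om /=; field.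
have [a0|a0] := eqVneq a 0; last first.
  by exists (0, - 2 / a, 0, 0); rewrite /om /=; field.
have [b0|b0] := eqVneq b 0; last first.
  by exists (2 / b, 0, 0, 0); rewrite /om /=; field.
by move: e0; rewrite w0 g0 a0 b0 => /eqP.
Qed.

Lemma om_perp y z : om y z != 0 -> exists u1 u2,
  [/\ om u1 y = 0, om u1 z = 0, om u2 y = 0, om u2 z = 0 & om u1 u2 != 0].
Proof.
move=> yz0.
(* [pr] projects on the orthogonal of [y] and [z]. If [om] vanished there, the
   Plucker relation of the coordinates [om _ y], [om _ z] would make [om y z]
   times the Pfaffian of [om] equal to 0. *)
pose pr (v : V) : V := v - (om v z / om y z) *: y + (om v y / om y z) *: z.
have omE := (omD, omZ).
have omr (u v w : V) : om u (v + w) = om u v + om u w by rewrite omC omD opprD -!(omC _ u).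
have omrZ (u v : V) (a : R) : om u (a *: v) = a * om u v by rewrite omC omZ -mulrN -omC.
have omxx (v : V) : om v v = 0 by have := omC v v; lra.
have prE (v : V) : pr v = v + (- (om v z / om y z)) *: y + (om v y / om y z) *: z.
  by rewrite /pr scaleNr.
have pry v : om (pr v) y = 0.
  by rewrite prE !omE (omC y z) omxx; field.
have prz v : om (pr v) z = 0.
  by rewrite prE !omE omxx; field.
have prpr u v : om (pr u) (pr v) = om u v - (om u z * om y v - om u y * om z v) / om y z.
  by rewrite [pr v]prE !omr !omrZ pry prz prE !omE; field.
suff [u [v uv]] : exists u v, om (pr u) (pr v) != 0 by exists (pr u), (pr v); split.
apply: contrapT => nuv.
have E u v : om u z * om v y - om u y * om v z = - (om u v * om y z).
  have : om (pr u) (pr v) = 0.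
    by apply/eqP; apply: contrapT => /negP H; apply: nuv; exists u, v.
  rewrite prpr => /eqP; rewrite subr_eq0 => /eqP ->.
  by rewrite divfK // (omC v y) (omC v z); ring.
pose A : V := (1, 0, 0, 0); pose B : V := (0, 1, 0, 0).
pose G : V := (0, 0, 1, 0); pose W : V := (0, 0, 0, 1).
have plucker (p1 p2 p3 p4 q1 q2 q3 q4 : R) :
  (q1 * p2 - p1 * q2) * (q3 * p4 - p3 * q4) - (q1 * p3 - p1 * q3) * (q2 * p4 - p2 * q4)
  + (q1 * p4 - p1 * q4) * (q2 * p3 - p2 * q3) = 0 by ring.
have := plucker (om A y) (om B y) (om G y) (om W y) (om A z) (om B z) (om G z) (om W z).
rewrite !E.
have -> : om A B = - 2^-1 by rewrite /om /=; field.
have -> : om G W = - 1 by rewrite /om /=; ring.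
have -> : om A G = 0 by rewrite /om /=; ring.
have -> : om B W = 0 by rewrite /om /=; ring.
have -> : om A W = 0 by rewrite /om /=; ring.
rewrite !mul0r oppr0 !mul0r subr0 addr0 => /eqP.
rewrite !(mulf_eq0, oppr_eq0) (negPf yz0) oner_eq0 invr_eq0 pnatr_eq0.
by [].
Qed.
End symplectic_form.

Section interior_exterior.
Context {R : realType}.
Notation V := (R^o * R^o * R^o * R^o)%type.
Notation leb := (@lebesgue_measure R).
Notation leb3 := (@leb3 R).
Implicit Types (x y z : V) (E : set (heis R)) (p q : heis R).

Lemma box_not_null p (e : R) : 0 < e -> ~ (\forall z \ae leb3, ~ box p e z).
Proof.
move=> e0 /ae_leb3 aeN.
have ex (t : R) (P : R -> Prop) : (\forall s \ae leb, P s) -> exists2 s, `|s - t| < e & P s.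
  move=> aeP; apply: contrapT => ns; apply: (@itv_not_ae_empty R (t - e) (t + e)).
    by lra.
  by apply: filterS aeP => s Ps; rewrite -ltr_distl => st; apply: ns; exists s.
have [a ap aeN1] := ex (ha p) _ aeN; have [b bp aeN2] := ex (hb p) _ aeN1.
by have [c cp] := ex (hc p) _ aeN2; apply.
Qed.

Lemma ess_interior_disjoint E p : ess_interior E p -> ess_interior (~` E) p -> False.
Proof.
move=> [e e0 aeE] [e' e'0 aeF].
apply: (@box_not_null p (Num.min e e')); first by rewrite lt_min e0.
apply: filterS2 aeE aeF => z Ez Fz [].
rewrite !lt_min => /andP[a1 a2] /andP[b1 b2] /andP[c1 c2].
by apply: Fz => //; apply: Ez.
Qed.

Lemma ess_interior_open E p : ess_interior E p ->
  exists2 e, 0 < e & forall q, box p e q -> ess_interior E q.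
Proof.
move=> [e e0 aeE]; exists (e / 2); first by rewrite divr_gt0.
move=> q [a b c]; exists (e / 2); first by rewrite divr_gt0.
apply: filterS aeE => z Ez [a' b' c']; apply: Ez.
have tri (s t u : R) : `|s - t| < e / 2 -> `|t - u| < e / 2 -> `|s - u| < e.
  by move=> st tu; rewrite -(subrKA t); apply: le_lt_trans (ler_normD _ _) _; lra.
by split; [exact: tri a' a|exact: tri b' b|exact: tri c' c].
Qed.

(** Every interior point lies in one of countably many rational boxes that are almost contained in
    [E]. *)
Lemma ess_interior_ae E : \forall z \ae leb3, ess_interior E z -> E z.
Proof.
pose B (k : rat * rat * rat * rat) : set (heis R) :=
  box (ratr k.1.1.1, ratr k.1.1.2, ratr k.1.2) (ratr k.2).
have : \forall z \ae leb3, forall k, (\forall w \ae leb3, B k w -> E w) -> B k z -> E z.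
  apply: ae_countable => k; have [aeE|nE] := pselect (\forall w \ae leb3, B k w -> E w).
    by apply: filterS aeE => z Ez _.
  by apply: aeW => z /nE.
apply: filterS => z Bz [e e0 aeE].
have app (t : R) : exists r : rat, `|t - ratr r| < e / 4.
  have [|r] := @rat_in_itvoo R (t - e / 4) (t + e / 4); first by lra.
  by rewrite in_itv /= -ltr_distl distrC => h; exists r.
have [[a az] [b bz] [c cz]] : [/\ exists a : rat, `|ha z - ratr a| < e / 4,
  exists b : rat, `|hb z - ratr b| < e / 4 & exists c : rat, `|hc z - ratr c| < e / 4].
  by split; exact: app.
have [|r] := @rat_in_itvoo R (e / 4) (e / 2); first by lra.
rewrite in_itv /= => /andP[r1 r2].
apply: (Bz (a, b, c, r)); last by split; rewrite /ha /hb /hc /=; apply: lt_trans r1.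
apply: filterS aeE => w Ew [/= aw bw cw]; apply: Ew.
have tri (s t u : R) : `|s - u| < ratr r -> `|t - u| < e / 4 -> `|s - t| < e.
  move=> su tu; rewrite -(subrKA u); apply: le_lt_trans (ler_normD _ _) _.
  by rewrite [`|u - t|]distrC; lra.
by split; [exact: tri aw az|exact: tri bw bz|exact: tri cw cz].
Qed.
End interior_exterior.

(** * The cone over the interior and exterior points *)

Section cone_of_set.
Context {R : realType}.
Notation V := (R^o * R^o * R^o * R^o)%type.
Notation H := (R^o * R^o * R^o)%type.
Notation leb := (@lebesgue_measure R).
Implicit Types (x y z : V) (E : set (heis R)) (p q : heis R).

(** [x.2] is the height: dividing by it gives the exponential coordinates (a, b, g), and c = g + a b
    / 2. *)
Definition pt x : heis R :=
  (x.1.1.1 / x.2, x.1.1.2 / x.2, x.1.2 / x.2 + x.1.1.1 * x.1.1.2 / (2 * x.2 ^+ 2)).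

Definition lift p (w : R) : V := (w * ha p, w * hb p, w * (hc p - ha p * hb p / 2), w).

Lemma ptK x : x.2 != 0 -> lift (pt x) x.2 = x.
Proof.
case: x => [[[a b] g] w] /= w0; rewrite /lift /pt /ha /hb /hc /=.
by congr (_, _, _, _); field.
Qed.

Lemma liftK p (w : R) : w != 0 -> pt (lift p w) = p.
Proof.
case: p => [[a b] c] w0; rewrite /lift /pt /ha /hb /hc /=.
by congr (_, _, _); field.
Qed.

Lemma ptZ x (a : R) : a != 0 -> pt (a *: x) = pt x.
Proof.
move=> a0; case: x => [[[b c] g] w]; rewrite /pt /= /GRing.scale /=.
have [->|w0] := eqVneq w 0; last by congr (_, _, _); field; rewrite w0 a0.
by rewrite mulr0 expr0n /= mulr0 invr0 !mulr0.
Qed.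

Lemma ptN x : pt (- x) = pt x.
Proof. by rewrite -scaleN1r ptZ // oppr_eq0 oner_eq0. Qed.

(* A horizontal line through [p] and [q] corresponds to a plane of [V]; convexity
   in the affine chart [w = 1] turns into additivity once the points at [w < 0] are
   the opposites of the exterior points. *)
Definition cone0 E x : Prop :=
  0 < x.2 /\ ess_interior E (pt x) \/ x.2 < 0 /\ ess_interior (~` E) (pt x).

(** Adds points of height 0, where [pt] has no meaning: they belong to the cone when all nearby
    points of non-zero height are in [cone0]. At other heights the two cones agree. *)
Definition cone E x : Prop :=
  exists2 r, 0 < r & forall y, `|y - x| < r -> y.2 != 0 -> cone0 E y.

Lemma cone0C E x : cone0 (~` E) x <-> cone0 E (- x).
Proof.
rewrite /cone0 setCK ptN /= oppr_gt0 oppr_lt0; split=> -[]; by [left|right].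
Qed.

Lemma cone0Z E x (a : R) : 0 < a -> cone0 E x -> cone0 E (a *: x).
Proof.
move=> a0; rewrite /cone0 ptZ ?gt_eqF // /= /GRing.scale /=.
by rewrite pmulr_rgt0 // pmulr_rlt0.
Qed.

Lemma cone0_disjoint E x : cone0 E x -> ~ cone0 E (- x).
Proof.
rewrite /cone0 ptN /= oppr_gt0 oppr_lt0 => -[] [w Ex] [] [w' Ex'];
  try (by move: (lt_trans w w'); rewrite ltxx).
- exact: ess_interior_disjoint Ex Ex'.
- exact: ess_interior_disjoint Ex' Ex.
Qed.

Lemma continuous_pt x : x.2 != 0 -> {for x, continuous (pt : V -> H)}.
Proof.
move=> x0; pose inv (w : V) : V := (w.1, (w.2)^-1).
pose f (w : V) : H := (w.1.1.1 * w.2, w.1.1.2 * w.2,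
   w.1.2 * w.2 + w.1.1.1 * w.1.1.2 * (w.2 * w.2) / 2).
have -> : (pt : V -> H) = f \o inv.
  apply/funext => w; rewrite /pt /f /inv /=; congr (_, _, _).
  by rewrite invfM -exprVn expr2; ring.
have cf : continuous f by move=> w; rewrite /f; cfun.
apply: continuous_comp; last exact: cf.
rewrite /inv; apply: (cvg_pair (G := nbhs _) (H := nbhs _)); first exact: cvg_fst.
by apply: cvgV => //; exact: cvg_snd.
Qed.

Lemma cone0_open E x : cone0 E x -> exists2 r, 0 < r & forall y, `|y - x| < r -> cone0 E y.
Proof.
move=> Cx; have x0 : x.2 != 0 by case: Cx => -[w _]; [rewrite gt_eqF|rewrite lt_eqF].
have near (G : set (heis R)) : ess_interior G (pt x) ->
    exists2 r, 0 < r & forall y, `|y - x| < r -> ess_interior G (pt y).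
  move=> /ess_interior_open[e e0 eG].
  have /(continuous_pt x0) : nbhs (pt x : H) (box (pt x) e).
    apply/nbhs_ballP; exists e => // z [[h1 h2] h3].
    by split; rewrite distrC; [exact: h1|exact: h2|exact: h3].
  move=> /nbhs_ballP[r r0 rB]; exists r => // y yx; apply: eG; apply: rB.
  by rewrite -ball_normE /ball_ /= distrC.
have sgn y : `|y - x| < `|x.2| -> (0 < x.2 -> 0 < y.2) /\ (x.2 < 0 -> y.2 < 0).
  move=> yx; have [_ _ _ /= h] := norm4 (y - x); have := le_lt_trans h yx.
  by rewrite ltr_distl => /andP[h1 h2]; split=> w0; move: h1 h2;
    rewrite ?(gtr0_norm w0) ?(ltr0_norm w0) => h1 h2; lra.
case: Cx => -[w /near[r r0 rP]].
  exists (Num.min r `|x.2|); first by rewrite lt_min r0 normr_gt0.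
  move=> y; rewrite lt_min => /andP[/rP Ey /sgn[/(_ w) yw _]]; by left.
exists (Num.min r `|x.2|); first by rewrite lt_min r0 normr_gt0.
move=> y; rewrite lt_min => /andP[/rP Ey /sgn[_ /(_ w) yw]]; by right.
Qed.

Lemma cone0_cone E x : cone0 E x -> cone E x.
Proof. by move=> /cone0_open[r r0 rP]; exists r => // y /rP. Qed.

Lemma cone_open E x : cone E x -> exists2 r, 0 < r & forall y, `|y - x| < r -> cone E y.
Proof.
move=> [r r0 rP]; exists (r / 2); first by rewrite divr_gt0.
move=> y yx; exists (r / 2); first by rewrite divr_gt0.
move=> z zy; apply: rP; rewrite -(subrKA y).
by apply: le_lt_trans (ler_normD _ _) _; lra.
Qed.

Lemma coneZ E x (a : R) : 0 < a -> cone E x -> cone E (a *: x).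
Proof.
move=> a0 [r r0 rP]; exists (a * r); first by rewrite mulr_gt0.
move=> y yx y0; have a1 : a != 0 by rewrite gt_eqF.
have -> : y = a *: (a^-1 *: y) by rewrite scalerA mulfV // scale1r.
apply: cone0Z => //; apply: rP; last by rewrite /= /GRing.scale /= mulf_neq0 ?invr_eq0.
have -> : a^-1 *: y - x = a^-1 *: (y - a *: x).
  by rewrite scalerBr scalerA mulVf // scale1r.
by rewrite normrZ normfV (gtr0_norm a0) mulrC ltr_pdivrMr // mulrC.
Qed.

Lemma near_w_neq0 x (r : R) : 0 < r -> exists2 y, `|y - x| < r & y.2 != 0.
Proof.
move=> r0; have [w0|w0] := eqVneq x.2 0; last by exists x => //; rewrite subrr normr0.
exists (x.1, r / 2); last by rewrite /= gt_eqF // divr_gt0.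
apply: norm4_lt; rewrite /= ?subrr ?normr0 //.
by rewrite w0 subr0 gtr0_norm ?divr_gt0 //; lra.
Qed.

Lemma coneN E x : cone E x -> ~ cone E (- x).
Proof.
move=> [r r0 rP] [r' r'0 r'P].
have m0 : 0 < Num.min r r' by rewrite lt_min r0.
have [y] := near_w_neq0 x m0; rewrite lt_min => /andP[yr yr'] y0.
apply: (cone0_disjoint (rP y yr y0)); apply: r'P; last by rewrite /= oppr_eq0.
by rewrite -opprD normrN.
Qed.

(** Near [x] there is [y] of non-zero height outside [cone0], so [pt y] is not interior to the set
    assigned to its sign. The other set is then not null near [pt y], and [ess_interior_near]
    provides interior points of it. *)
Lemma cone_cover E x (r : R) : measurable E ->
  (\forall m \ae leb, monotone_along E (1, m)) -> ~ cone E x -> 0 < r ->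
  exists2 y, `|y - x| < r & cone E (- y).
Proof.
move=> mE monE nCx r0; have r2 : 0 < r / 2 by rewrite divr_gt0.
have mF : measurable (~` E) by exact: measurableC.
have monF : \forall m \ae leb, monotone_along (~` E) (1, m).
  by apply: filterS monE => m; exact: monotone_alongC.
have [y [yx y0 nCy]] : exists y, [/\ `|y - x| < r / 2, y.2 != 0 & ~ cone0 E y].
  apply: contrapT => ny; apply: nCx; exists (r / 2) => // y yx y0.
  by apply: contrapT => nCy; apply: ny; exists y.
have cl : {for pt y : H, continuous (fun q : H => lift q y.2)}.
  suff : continuous (fun q : H => lift q y.2 : V) by apply.
  by move=> q; rewrite /lift /ha /hb /hc; cfun.
have /cl : nbhs (lift (pt y) y.2 : V) (fun z => `|z - lift (pt y) y.2| < r / 2).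
  apply/nbhs_ballP; exists (r / 2) => // z; rewrite -ball_normE /ball_ /=.
  by rewrite distrC.
move=> /nbhs_ballP[d d0 dB].
have dP q : box (pt y) d q -> `|lift q y.2 - x| < r.
  move=> [h1 h2 h3]; rewrite -(subrKA y); apply: le_lt_trans (ler_normD _ _) _.
  have : `|lift q y.2 - y| < r / 2.
    have := dB q; rewrite /= ptK //; apply.
    by split; [split|]; rewrite /ball /= distrC.
  by lra.
have find (G : set (heis R)) : measurable G ->
    (\forall m \ae leb, monotone_along G (1, m)) -> ~ ess_interior (~` G) (pt y) ->
    exists2 q, box (pt y) d q & ess_interior G q.
  move=> mG monG nG; apply: ess_interior_near => // e e0 aeG; apply: nG.
  by exists e.
have [yw|yw] := ltP 0 y.2.
  have [q qy Fq] : exists2 q, box (pt y) d q & ess_interior (~` E) q.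
    apply: find => //; rewrite setCK => Ey; apply: nCy; by left.
  exists (lift q y.2); first exact: dP.
  apply: cone0_cone; rewrite -cone0C; left; rewrite liftK //; split => //.
have {}yw : y.2 < 0 by rewrite lt_neqAle y0.
have [q qy Eq] : exists2 q, box (pt y) d q & ess_interior E q.
  by apply: find => // Fy; apply: nCy; right.
exists (lift q y.2); first exact: dP.
by apply: cone0_cone; left; rewrite ptN liftK //= oppr_gt0.
Qed.

(** [pt (x + y)] is the barycentre of [pt x] and [pt y] on a horizontal line, with the heights,
    possibly negative, as weights. *)
Lemma pt_on_line x y : om x y = 0 -> x.2 != 0 -> y.2 != 0 -> (x + y).2 != 0 ->
  let v : R * R := (x.1.1.1 / x.2 - y.1.1.1 / y.2, x.1.1.2 / x.2 - y.1.1.2 / y.2) in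
  pt x = hcurve (pt (x + y)) v (y.2 / (x + y).2) /\
  pt y = hcurve (pt (x + y)) v (- (x.2 / (x + y).2)).
Proof.
case: x => [[[a b] g] w]; case: y => [[[a' b'] g'] w'] /= xy w0 w'0 ww'0.
have Eg : g' = (w' * g + (a * b' - b * a') / 2) / w.
  move: xy; rewrite /om /= => xy; apply/eqP; rewrite eq_sym.
  rewrite -subr_eq0 -(mulIr_eq0 _ (mulIf w0)) mulrBl divfK //; apply/eqP.
  by move: xy; lra.
rewrite Eg /pt /hcurve /hmul /hexp /ha /hb /hc /=.
by split; congr (_, _, _); field; rewrite ?w0 ?w'0 ?ww'0.
Qed.

(** With heights of the same sign the sum lies between the two points; with opposite signs, the
    point of larger absolute height separates it from the other. A sum of negative height is treated
    by negation, which exchanges [E] and its complement. *)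
Lemma cone0D E x y : measurable E -> (\forall m \ae leb, monotone_along E (1, m)) ->
  cone0 E x -> cone0 E y -> om x y = 0 -> (x + y).2 != 0 -> cone0 E (x + y).
Proof.
wlog zw : E x y / 0 < (x + y).2.
  move=> wl mE monE Cx Cy xy z0.
  have [zw|zw] := ltP 0 (x + y).2; first exact: (wl E).
  have {}zw : (x + y).2 < 0 by rewrite lt_neqAle z0.
  have := wl (~` E) (- x) (- y); rewrite -opprD !cone0C !opprK; apply.
  - by rewrite /= oppr_gt0.
  - exact: measurableC.
  - by apply: filterS monE => m; exact: monotone_alongC.
  - exact: Cx.
  - exact: Cy.
  - by move: xy; rewrite /om /= => xy; lra.
  - by rewrite /= oppr_eq0.
move=> mE monE Cx Cy xy z0.
have x0 : x.2 != 0 by case: Cx => -[w _]; [rewrite gt_eqF|rewrite lt_eqF].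
have y0 : y.2 != 0 by case: Cy => -[w _]; [rewrite gt_eqF|rewrite lt_eqF].
have [ptx pty] := pt_on_line xy x0 y0 z0.
left; split => //; rewrite /= in zw ptx pty *.
case: Cx => -[xw Ex]; case: Cy => -[yw Ey].
- rewrite ptx in Ex; rewrite pty in Ey; apply: (ess_interior_between mE monE _ Ey Ex).
  by rewrite oppr_lt0 !divr_gt0.
- rewrite ptx in Ex; rewrite pty in Ey; apply: (ess_interior_beyond mE monE _ Ex Ey).
  apply/orP; right; rewrite -mulNr ltr_pM2r ?invr_gt0 // pmulr_llt0 ?invr_gt0 // yw andbT.
  by lra.
- rewrite ptx in Ex; rewrite pty in Ey; apply: (ess_interior_beyond mE monE _ Ey Ex).
  apply/orP; left; rewrite -mulNr ltr_pM2r ?invr_gt0 // pmulr_lgt0 ?invr_gt0 // oppr_gt0 xw.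
  by rewrite /=; lra.
- by exfalso; lra.
Qed.

Lemma avoid_two (k s t : R) : 0 < k -> exists u, [/\ 0 < u, u <= k, u != s & u != t].
Proof.
move=> k0.
have [e1|n1] := boolP ((k != s) && (k != t)).
  by move: e1 => /andP[? ?]; exists k.
have [e2|n2] := boolP ((k / 2 != s) && (k / 2 != t)).
  by move: e2 => /andP[? ?]; exists (k / 2); split => //; lra.
exists (k / 3); split; [lra|lra|apply/eqP => e|apply/eqP => e];
move: n1 n2; rewrite !negb_and !negbK => /orP[/eqP n1|/eqP n1] /orP[/eqP n2|/eqP n2]; lra.
Qed.

(** [x] and [y] may have height 0, out of reach of [cone0D]. Hence every [z] of non-zero height near
    [x + y] is split afresh into orthogonal summands of non-zero height, close to [x] and [y]. *)
Lemma coneD E x y : measurable E -> (\forall m \ae leb, monotone_along E (1, m)) ->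
  cone E x -> cone E y -> om x y = 0 -> cone E (x + y).
Proof.
move=> mE monE Cx Cy xy.
have xy0 : x + y != 0.
  apply/eqP => /eqP; rewrite addr_eq0 => /eqP e; apply: (coneN Cy).
  by rewrite -e.
have [f fE] := om_nondeg xy0.
have [r [r0 xr yr]] : exists r, [/\ 0 < r,
    forall z, `|z - x| < r -> z.2 != 0 -> cone0 E z &
    forall z, `|z - y| < r -> z.2 != 0 -> cone0 E z].
  case: Cx Cy => [r1 r10 h1] [r2 r20 h2]; exists (Num.min r1 r2); split.
  - by rewrite lt_min r10.
  - by move=> z; rewrite lt_min => /andP[? _]; exact: h1.
  - by move=> z; rewrite lt_min => /andP[_ ?]; exact: h2.
have f1 : 0 < `|f| + 1 by rewrite ltr_wpDl.
have x1 : 0 < `|x| + 1 by rewrite ltr_wpDl.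
pose rho := Num.min (r / 4) (Num.min (6 * (`|f| + 1))^-1 (r / (24 * (`|x| + 1) * (`|f| + 1)))).
have rho0 : 0 < rho by rewrite !lt_min invr_gt0 !divr_gt0 ?mulr_gt0.
exists rho => // z; rewrite !lt_min => /and3P[zr zf zx] z0.
have zE : z = x + y + (z - (x + y)) by rewrite addrC subrK.
pose d := z - (x + y); rewrite -/d in zE zr zf zx.
have omf : om z f - 1 <= 1 / 2 /\ - (1 / 2) <= om z f - 1.
  have -> : om z f - 1 = om d f by rewrite zE omD fE; ring.
  have : `|om d f| <= 1 / 2.
    apply: le_trans (om_bound _ _) _.
    have : `|d| * (6 * (`|f| + 1)) < 1 by rewrite -ltr_pdivlMr ?mulr_gt0 // div1r.
    by have := mulr_ge0 (normr_ge0 d) (normr_ge0 f); have := normr_ge0 d; lra.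
  by rewrite ler_norml => /andP[? ?].
have omzf : 1 / 2 <= om z f by lra.
have omzf0 : om z f != 0 by rewrite gt_eqF //; lra.
have omxx (u : V) : om u u = 0 by have := omC u u; lra.
have omr (u v w : V) : om u (v + w) = om u v + om u w by rewrite omC omD opprD -!(omC _ u).
(* Makes [x + t *: f] orthogonal to [z]. For y' = z - x', orthogonality of [x'] to [z] is the same
   as orthogonality to [y']. *)
pose t := om x z / om z f.
have tf : `|t| * `|f| < r / 4.
  have xz : `|om x z| <= 3 * `|x| * `|d|.
    have -> : om x z = om x d by rewrite zE !omr omxx xy !add0r.
    exact: om_bound.
  have tb : `|t| <= 6 * `|x| * `|d|.
    rewrite /t normrM normfV (ger0_norm (_ : 0 <= om z f)); last by lra.
    rewrite ler_pdivrMr; last by lra.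
    have := normr_ge0 d => dd; have xd : 0 <= `|x| * `|d| by rewrite mulr_ge0.
    by have := ler_wpM2l xd omzf; lra.
  have : `|d| * (24 * (`|x| + 1) * (`|f| + 1)) < r by rewrite -ltr_pdivlMr // !mulr_gt0.
  have h1 : `|t| * `|f| <= 6 * `|x| * `|d| * `|f| by rewrite ler_wpM2r.
  have h2 : `|x| * `|d| * `|f| <= (`|x| + 1) * `|d| * (`|f| + 1).
    by rewrite ler_pM ?mulr_ge0 // ?ler_wpM2r //; lra.
  by move: h1 h2; lra.
(* A vector of height 1 orthogonal to [z]: small multiples of it change the heights of the summands
   and keep them orthogonal. *)
pose h : V := (0, 0, z.1.2 / z.2, 1).
have hz : om h z = 0 by rewrite /om /h /=; field.
have k0 : 0 < r / (4 * (`|h| + 1)) by rewrite divr_gt0 // mulr_gt0 // ltr_wpDl.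
have [u [u0 uk u1 u2]] := avoid_two (- (x + t *: f).2) ((z - x - t *: f).2) k0.
pose x' := x + t *: f + u *: h; pose y' := z - x'.
have uh : `|u *: h| < r / 4.
  have h1 : 0 < `|h| + 1 by rewrite ltr_wpDl.
  rewrite normrZ (gtr0_norm u0).
  apply: (@le_lt_trans _ _ (u * `|h|)) => //.
  apply: (@lt_le_trans _ _ (u * (`|h| + 1))); first by rewrite ltr_pM2l //; lra.
  by move: uk; rewrite ler_pdivlMr ?mulr_gt0 //; lra.
have tfn : `|t *: f| < r / 4 by rewrite normrZ.
have wr : `|t *: f + u *: h| < r / 2.
  by apply: le_lt_trans (ler_normD _ _) _; move: tfn uh; clear; lra.
have x'E : x' = x + (t *: f + u *: h) by rewrite /x' addrA.
have x'x : `|x' - x| < r.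
  by rewrite x'E [X in `|X|]addrC addKr; move: wr r0; clear; lra.
have y'y : `|y' - y| < r.
  have -> : y' - y = d - (t *: f + u *: h).
    by rewrite /y' x'E /d; move: (_ *: f + _) => w; rewrite !opprD !addrA [LHS]addrAC.
  by apply: le_lt_trans (ler_normB _ _) _; move: wr zr r0; clear; lra.
have x'w : x'.2 != 0.
  move: u1; apply: contra_neq => e; apply/eqP; rewrite -addr_eq0 addrC; apply/eqP.
  by rewrite -[RHS]e /x' /= /GRing.scale /= mulr1.
have y'w : y'.2 != 0.
  move: u2; apply: contra_neq => e; apply/eqP; rewrite -subr_eq0 -oppr_eq0 opprB; apply/eqP.
  by rewrite -[RHS]e /y' /x' /= /GRing.scale /= mulr1; ring.
have x'y' : om x' y' = 0.
  have omrN (a b : V) : om a (- b) = - om a b by rewrite /om /=; ring.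
  rewrite /y' omr omrN omxx oppr0 addr0.
  rewrite /x' !omD !omZ hz mulr0 addr0 (omC z f) /t.
  by rewrite mulrN divfK // subrr.
have -> : z = x' + y' by rewrite /y' addrC subrK.
by apply: cone0D => //; [exact: xr|exact: yr|rewrite /y' addrC subrK].
Qed.
End cone_of_set.

(** * Haar null sets *)

Section haar_null_sets.
Context {R : realType}.
Notation T := (measurableTypeR R).
Notation leb3 := (@leb3 R).
Context (mu : {measure set (heis R) -> \bar R}) (Hmu : is_haar mu).

Let mu_sigma_finite : sigma_finite setT mu.
Proof.
have [_ muK _] := Hmu.
pose I (n : nat) : set T := `[(- n%:R)%R, n%:R]%classic.
have mI n : measurable (I n) by exact: measurable_itv.
have mK n : measurable ((I n `*` I n) `*` I n) by do 2 apply: measurableX => //.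
exists (fun n => (I n `*` I n) `*` I n).
  apply/seteqP; split => // z _.
  pose n := (Num.truncn (Num.max `|ha z| (Num.max `|hb z| `|hc z|))).+1.
  have := truncnS_gt (Num.max `|ha z| (Num.max `|hb z| `|hc z|)).
  rewrite -/n !gt_max => /and3P[a b c]; exists n => //.
  by split; [split|]; rewrite /I /= in_itv /= -ler_norml ltW.
move=> n; split => //; apply: muK => //.
have cI : compact (I n : set R) by exact: segment_compact.
by apply: compact_setX => //; exact: compact_setX.
Qed.

Let smu : set (heis R) -> \bar R := mu.
HB.instance Definition _ := Measure.on smu.
HB.instance Definition _ := Measure_isSigmaFinite.Build _ _ _ smu mu_sigma_finite.

Definition hinv (g : heis R) : heis R := (- ha g, - hb g, ha g * hb g - hc g).

Lemma hmulVK (g h : heis R) : hmul (hmul h (hinv g)) g = h.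
Proof.
case: g h => [[a b] c] [[a' b'] c']; rewrite /hmul /hinv /ha /hb /hc /=.
by congr (_, _, _); ring.
Qed.

Let mu_translate g (A : set (heis R)) : measurable A -> mu (hmul g @^-1` A) = mu A.
Proof.
move=> mA; have [inv _ _] := Hmu.
have mB : measurable (hmul g @^-1` A) by exact: measurable_preimT (measurable_hmul g) mA.
rewrite -(inv g _ mB); congr (mu _).
apply/seteqP; split => [_ [h Ah <-] //|z Az].
exists (hmul (hinv g) z) => /=; rewrite (_ : hmul g _ = z) //;
by case: g z {Az mB} => [[a b] c] [[a' b'] c']; rewrite /hmul /hinv /ha /hb /hc /=;
   congr (_, _, _); ring.
Qed.

Let measurable_hmul2 : measurable_fun setT (fun p : heis R * heis R => hmul p.1 p.2).
Proof. by rewrite /hmul /ha /hb /hc /=; mfun. Qed.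

(** [mu] is left invariant and [leb3] right invariant. Fubini for the pairs whose product is in [Q]
    compares their null sets, since fixing either factor translates [Q]. *)
Lemma haar_ae_leb3 (P : heis R -> Prop) :
  (\forall z \ae mu, P z) <-> (\forall z \ae leb3, P z).
Proof.
split=> /ae_cover[Q [mQ aeQ QP]].
- suff : \forall z \ae leb3, Q z by apply: filterS.
  have mQ2 := measurable_preimT measurable_hmul2 mQ.
  have : \forall h \ae mu, \forall g \ae leb3, Q (hmul g h).
    apply: (ae_swap (m1 := leb3) (m2 := smu) mQ2); apply: aeW => g.
    apply/(ae_measurableP _ (measurable_preimT (measurable_hmul g) mQ)).
    move/(ae_measurableP _ mQ): aeQ => <-.
    exact: (mu_translate g (measurableC mQ)).
  have mu_pos : (0 < mu setT)%E.
    by have [_ _ ?] := Hmu; rewrite lt0e measure_ge0 andbT.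
  have F := ae_properfilter_algebraOfSetsType mu_pos.
  move=> /(@filter_ex _ _ F)[h /(ae_hmul_r (hinv h))]; apply: filterS => z.
  by have := hmulVK h z => {2}<-.
- suff : \forall z \ae mu, Q z by apply: filterS.
  have mQ2 := measurable_preimT measurable_hmul2 mQ.
  have : \forall g \ae leb3, \forall h \ae mu, Q (hmul g h).
    have mQ3 : measurable [set p : heis R * heis R | Q (hmul p.2 p.1)].
      by apply: measurable_preimT mQ; rewrite /hmul /ha /hb /hc /=; mfun.
    apply: (ae_swap (m1 := smu) (m2 := leb3) mQ3); apply: aeW => h /=.
    exact: ae_hmul_r.
  move=> /ae_leb3 H; have [a Ha] := ae_leb_ex H.
  have [b Hb] := ae_leb_ex Ha; have [c Hc] := ae_leb_ex Hb.
  set g : heis R := (a, b, c) in Hc.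
  apply/(ae_measurableP _ mQ); rewrite -(mu_translate g (measurableC mQ)).
  by move/(ae_measurableP _ (measurable_preimT (measurable_hmul g) mQ)): Hc.
Qed.
End haar_null_sets.

(** * Half-spaces *)

Section half_space_of_cone.
Context {R : realType}.
Notation V := (R^o * R^o * R^o * R^o)%type.
Notation leb := (@lebesgue_measure R).
Notation leb3 := (@leb3 R).
Implicit Types (E : set (heis R)) (z : heis R).

Definition affine_form (al be ga de : R) z : R :=
  al * ha z + be * hb z + ga * (hc z - ha z * hb z / 2) + de.

Lemma ess_interior_affine E : measurable E ->
  (\forall m \ae leb, monotone_along E (1, m)) ->
  exists al be ga de : R, [/\ [|| al != 0, be != 0, ga != 0 | de != 0],
    forall z, 0 < affine_form al be ga de z -> ess_interior E z &
    forall z, affine_form al be ga de z < 0 -> ess_interior (~` E) z].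
Proof.
move=> mE monE.
have [phi [phiD phiZ phiP]] := @cone_half_space R V om 3 omD omZ omC (ltr0n _ 3) om_bound
  om_nondeg om_perp (cone E) (@cone_open R E) (fun a x => @coneZ R E x a)
  (@coneN R E) (fun x nC r => @cone_cover R E x r mE monE nC)
  (fun x y Cx Cy => @coneD R E x y mE monE Cx Cy).
pose A : V := (1, 0, 0, 0); pose B : V := (0, 1, 0, 0).
pose G : V := (0, 0, 1, 0); pose W : V := (0, 0, 0, 1).
have phiE (x : V) : phi x = phi A * x.1.1.1 + phi B * x.1.1.2 + phi G * x.1.2 + phi W * x.2.
  have {1}-> : x = x.1.1.1 *: A + x.1.1.2 *: B + x.1.2 *: G + x.2 *: W.
    case: x => [[[a b] g] w]; rewrite /A /B /G /W /=.
    have ext (x y : V) : x.1.1.1 = y.1.1.1 -> x.1.1.2 = y.1.1.2 ->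
        x.1.2 = y.1.2 -> x.2 = y.2 -> x = y.
      by case: x y => [[[? ?] ?] ?] [[[? ?] ?] ?] /= -> -> -> ->.
    by apply: ext => /=; rewrite /GRing.scale /=; ring.
  by rewrite !phiD !phiZ ![phi _ * _]mulrC.
have liftE z (w : R) : phi (lift z w) = w * affine_form (phi A) (phi B) (phi G) (phi W) z.
  by rewrite phiE /lift /affine_form /=; ring.
have cone_lift z (w : R) : w != 0 -> cone E (lift z w) -> cone0 E (lift z w).
  by move=> w0 [r r0 rP]; apply: rP => //; rewrite subrr normr0.
exists (phi A), (phi B), (phi G), (phi W); split.
- apply: contrapT => /negP; rewrite !negb_or !negbK => /and4P[/eqP a /eqP b /eqP g /eqP w].
  have phi0 x : phi x = 0 by rewrite phiE a b g w !mul0r !addr0.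
  have nC x : ~ cone E x by move=> /phiP; rewrite phi0 ltxx.
  by have [y _ /nC] := cone_cover mE monE (nC 0) ltr01.
- move=> z z0; have : cone E (lift z 1) by apply/phiP; rewrite liftE mul1r.
  move=> /(cone_lift _ _ (oner_neq0 R)) [] [/=]; first by rewrite liftK ?oner_eq0.
  by rewrite ltr10.
- move=> z z0; have N1 : (-1 : R) != 0 by rewrite oppr_eq0 oner_eq0.
  have : cone E (lift z (-1)) by apply/phiP; rewrite liftE mulN1r oppr_gt0.
  move=> /(cone_lift _ _ N1) [] [/=]; last by rewrite liftK.
  by rewrite oppr_gt0 ltr10.
Qed.

Lemma affine_form_neq0 (al be ga de : R) : [|| al != 0, be != 0 | ga != 0] ->
  \forall z \ae leb3, affine_form al be ga de z != 0.
Proof.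
move=> abg.
have ae_neq (t : R) : \forall s \ae leb, s != t.
  exists [set t]; split; [exact: measurable_set1|exact: lebesgue_measure_set1|].
  by move=> s /= /negP; rewrite negbK => /eqP.
have mQ : measurable [set z : R3 R | affine_form al be ga de z != 0].
  have mf : measurable_fun setT (affine_form al be ga de : _ -> measurableTypeR R).
    by rewrite /affine_form /ha /hb /hc; mfun.
  rewrite (_ : [set z | _] = affine_form al be ga de @^-1` (~` [set 0])).
    by apply: measurable_preimT mf _; apply: measurableC; exact: measurable_set1.
  by apply/seteqP; split => z /= /eqP.
apply/(ae_leb3P mQ).
have [ga0|ga0] := eqVneq ga 0; last first.
  apply: aeW => a; apply: aeW => b.
  apply: filterS (ae_neq (a * b / 2 - (al * a + be * b + de) / ga)) => c.
  apply: contra_neq; rewrite /affine_form /ha /hb /hc /= => h.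
  apply: (mulfI ga0); rewrite mulrBr [ga * (_ / ga)]mulrC divfK //; lra.
have [be0|be0] := eqVneq be 0; last first.
  apply: aeW => a; apply: filterS (ae_neq (- (al * a + de) / be)) => b.
  move=> bn; apply: aeW => c; move: bn; apply: contra_neq.
  rewrite /affine_form /ha /hb /hc /= ga0 => h.
  by apply: (mulfI be0); rewrite [RHS]mulrC divfK //; lra.
have al0 : al != 0 by move: abg; rewrite ga0 be0 eqxx !orbF.
apply: filterS (ae_neq (- de / al)) => a an; apply: aeW => b; apply: aeW => c.
move: an; apply: contra_neq; rewrite /affine_form /ha /hb /hc /= ga0 be0 => h.
by apply: (mulfI al0); rewrite [RHS]mulrC divfK //; lra.
Qed.
End half_space_of_cone.

Section half_space_affine.
Context {R : realType}.
Notation H := (R^o * R^o * R^o)%type.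
Context (al be ga de : R).
Local Notation f := (affine_form al be ga de).

(** The centre [p] is the pole of the plane: the form at [z] is [ga] times
    [om (lift p 1) (lift z 1)], which vanishes when [z] is on a horizontal line through [p]. *)
Lemma horizontal_plane_affine : ga != 0 -> [set z | f z = 0] =
  horizontal_plane (- 2 * be / ga, 2 * al / ga, - de / ga - 2 * al * be / ga ^+ 2).
Proof.
move=> ga0; set p : heis R := (_, _, _); apply/seteqP; split=> [z /= fz|z].
- pose v : R * R := (ha z - ha p, hb z - hb p).
  have hcE : hc z = ha z * hb z / 2 - (al * ha z + be * hb z + de) / ga.
    apply: (mulfI ga0); rewrite mulrBr [ga * (_ / ga)]mulrC divfK //.
    by move: fz; rewrite /affine_form; lra.
  have [v0|v0] := pselect (v = (0, 0)).
    have -> : z = p.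
      move: v0 hcE => [/eqP]; rewrite subr_eq0 => /eqP a /eqP; rewrite subr_eq0 => /eqP b hcE.
      rewrite [LHS](_ : _ = (ha z, hb z, hc z)); last by case: (z) => -[].
      by rewrite hcE a b /p /ha /hb /hc /=; congr (_, _, _); field.
    exists (hline p (1, 0)) => /=; last by exists 0 => //; rewrite hcurve0.
    split; last by exists 0 => //; rewrite hcurve0.
    by exists p, (1, 0); split => // -[/eqP]; rewrite oner_eq0.
  exists (hline p v) => /=.
    by split; [exists p, v|exists 0 => //; rewrite hcurve0].
  exists 1 => //; rewrite [RHS](_ : _ = (ha z, hb z, hc z)); last by case: (z) => -[].
  rewrite hcE /v /p /hcurve /hmul /hexp /ha /hb /hc /=; congr (_, _, _); by field.
- move=> [_ [[g [v [v0 ->]]] [r _ gr]]] /=.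
  rewrite -(hline_affine g v r (oner_neq0 R)) gr => -[t _ <-].
  by rewrite /affine_form /p /hcurve /hmul /hexp /ha /hb /hc /=; field.
Qed.

Lemma vertical_plane_affine : ga = 0 -> (al != 0) || (be != 0) ->
  vertical_plane [set z | f z = 0].
Proof.
move=> ga0 ab0; pose n := al ^+ 2 + be ^+ 2.
have n0 : n != 0.
  rewrite gt_eqF // lt_neqAle addr_ge0 ?sqr_ge0 // andbT eq_sym.
  by rewrite paddr_eq0 ?sqr_ge0 // !sqrf_eq0 negb_and.
exists [set w : R * R | al * w.1 + be * w.2 + de = 0]; last first.
  by apply/seteqP; split => z; rewrite /affine_form /= ga0 mul0r addr0.
(* The foot of the perpendicular from the origin, and the direction of the line. *)
exists (- de * al / n, - de * be / n), (- be, al); split.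
  by move=> [/eqP]; rewrite oppr_eq0 => /eqP b0 a0; move: ab0; rewrite a0 b0 eqxx.
apply/seteqP; split => [[x y] /= xy|_ [t _ <-] /=]; last by rewrite /n; field.
have dE : de = - (al * x + be * y) by move: xy; lra.
by exists ((al * y - be * x) / n) => //; rewrite dE /n; congr (_, _); field.
Qed.

Let continuous_affine_form : continuous (f : H -> R^o).
Proof. by move=> w; rewrite /affine_form /ha /hb /hc; cfun. Qed.

Lemma half_space_affine : [|| al != 0, be != 0 | ga != 0] -> half_space [set z | 0 < f z].
Proof.
move=> abg.
exists [set z | f z = 0]; split.
  have [ga0|ga0] := eqVneq ga 0; last by right; eexists; exact: horizontal_plane_affine.
  by left; apply: vertical_plane_affine => //; move: abg; rewrite ga0 eqxx orbF.
have [x x0] : exists x : heis R, 0 < f x.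
  have [al0|al0] := eqVneq al 0; last first.
    by exists ((1 - de) / al, 0, 0); rewrite /affine_form /ha /hb /hc /=
      (_ : _ + _ = 1) ?ltr01 //; field.
  have [be0|be0] := eqVneq be 0; last first.
    by exists (0, (1 - de) / be, 0); rewrite /affine_form /ha /hb /hc /=
      (_ : _ + _ = 1) ?ltr01 //; field.
  have ga0 : ga != 0 by move: abg; rewrite al0 be0 eqxx.
  by exists (0, 0, (1 - de) / ga); rewrite /affine_form /ha /hb /hc /=
      (_ : _ + _ = 1) ?ltr01 //; field.
exists x; first by move=> /= h; move: x0; rewrite h ltxx.
(* The segment from [x] to [z] in exponential coordinates stays in the set, as the form is affine on
   it. Conversely, a connected set on which the form takes both signs meets the plane. *)
apply/seteqP; split => [z /= z0|z [B /= [Bx BP cB] Bz]].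
- pose ga_ (w : heis R) (s : R) := ha x + s * (ha w - ha x).
  pose gb_ (w : heis R) (s : R) := hb x + s * (hb w - hb x).
  pose c' (w : heis R) := hc w - ha w * hb w / 2.
  pose g (s : R^o) : H := (ga_ z s, gb_ z s, c' x + s * (c' z - c' x) + ga_ z s * gb_ z s / 2).
  have gE s : f (g s) = (1 - s) * f x + s * f z.
    by rewrite /affine_form /g /ga_ /gb_ /c' /ha /hb /hc /=; field.
  exists (g @` `[0, 1]%classic); last first.
    exists 1; first by rewrite /= in_itv /= ler01 lexx.
    rewrite [RHS](_ : _ = (ha z, hb z, hc z)); last by case: (z) => -[].
    by rewrite /g /ga_ /gb_ /c'; congr (_, _, _); field.
  split.
  + exists 0; first by rewrite /= in_itv /= ler01 lexx.
    rewrite [RHS](_ : _ = (ha x, hb x, hc x)); last by case: (x) => -[].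
    by rewrite /g /ga_ /gb_ /c'; congr (_, _, _); field.
  + move=> y [s]; rewrite /= in_itv /= => /andP[s0 s1] <-; rewrite gE => h.
    have /orP[s0'|s0'] : (s <= 1 / 2) || (1 / 2 <= s) by exact: le_total.
      have : 0 < (1 - s) * f x by apply: mulr_gt0 => //; move: s0'; lra.
      have : 0 <= s * f z by rewrite mulr_ge0 // ltW.
      by move: h; lra.
    have : 0 < s * f z by apply: mulr_gt0 => //; move: s0'; lra.
    have : 0 <= (1 - s) * f x by rewrite mulr_ge0 ?subr_ge0 // ltW.
    by move: h; lra.
  + have cg : continuous g by move=> w; rewrite /g /ga_ /gb_; cfun.
    apply: connected_continuous_connected; first exact: segment_connected.
    exact: continuous_subspaceT.
- rewrite ltNge; apply/negP => fz.
  have : connected ((f : H -> R^o) @` B).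
    apply: connected_continuous_connected cB _.
    exact: continuous_subspaceT continuous_affine_form.
  move=> /connected_intervalP /(_ (f z) (f x)) h.
  have [|||w Bw] := h _ _ 0; [by exists z|by exists x|by rewrite fz ltW|].
  exact: BP.
Qed.
End half_space_affine.

Lemma ae_negligible d (T : measurableType d) (R : realType) (m : set T -> \bar R)
    (A B : set T) : (\forall z \ae m, A z <-> B z) -> m.-negligible (A `+` B).
Proof.
move=> [N [mN N0 AB]]; exists N; split => // z ABz; apply: AB => /= -[a b].
by case: ABz => -[h1 h2]; apply: h2; [exact: a|exact: b].
Qed.

Lemma completed_ae d (T : measurableType d) (R : realType) (m : {measure set T -> \bar R})
    (E : set T) : completed_algebra_gen m E ->
  exists2 E0, measurable E0 & \forall z \ae m, E z <-> E0 z.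
Proof.
move=> [A mA [N [N' [mN' N'0 NN']] <-]]; exists A => //; exists N'; split => // z /= h.
apply: NN'; apply: contrapT => nN; apply: h; split; last by left.
by case.
Qed.

Theorem theorem5p1 (R : realType) (mu : {measure set (heis R) -> \bar R})
    (Hmu : is_haar mu) (E : set (heis R)) (HE : monotone_set mu E) :
  mu.-negligible (E `+` set0) \/
  mu.-negligible (E `+` setT) \/
  (exists W : set (heis R), half_space W /\ mu.-negligible (E `+` W)).
Proof.
(* [E] is measurable for the completion of [mu] only; [E0] is a Borel representative, equal to it up
   to a Lebesgue null set. *)
case: HE => /completed_ae[E0 mE0 /(haar_ae_leb3 Hmu) EE0] [monE _].
have [al [be [ga [de [nz pos neg]]]]] := ess_interior_affine mE0
  (filterS (fun m => monotone_along_ae EE0) (monotone_along_slope monE)).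
have aeE0 := ess_interior_ae E0; have aeNE0 := ess_interior_ae (~` E0).
have conclude (A : set (heis R)) : (\forall z \ae @leb3 R, E0 z <-> A z) ->
    mu.-negligible (E `+` A).
  move=> E0A; apply: ae_negligible; apply/(haar_ae_leb3 Hmu).
  by apply: filterS2 EE0 E0A => z -> ->.
have [abg|] := boolP [|| al != 0, be != 0 | ga != 0].
  right; right; exists [set z | 0 < affine_form al be ga de z].
  split; first exact: half_space_affine.
  apply: conclude; apply: filterS3 aeE0 aeNE0 (affine_form_neq0 de abg) => z h1 h2 h3.
  split=> [E0z|/pos/h1 //]; rewrite /= lt_neqAle eq_sym h3 leNgt.
  by apply/negP => /neg/h2.
(* When the form is a non-zero constant, every point is interior, or every point is exterior. *)
rewrite !negb_or !negbK => /and3P[/eqP al0 /eqP be0 /eqP ga0].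
have formE z : affine_form al be ga de z = de by rewrite /affine_form al0 be0 ga0 !mul0r !add0r.
move: nz; rewrite al0 be0 ga0 !eqxx /= => de0.
have [de_lt0|de_gt0|/eqP] := ltgtP de 0; last by rewrite (negPf de0).
- left; apply: conclude; apply: filterS aeNE0 => z h; split => // E0z.
  by apply: h E0z; apply: neg; rewrite formE.
- right; left; apply: conclude; apply: filterS aeE0 => z h; split => // _.
  by apply: h; apply: pos; rewrite formE.
Qed.
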